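(* Let $M$ be an oriented (Riemannian) orbifold and let $S$ be the set of its singular points. Assume that $S$ has codimension at least $4$, i.e. for every non-trivial element of any singularity group of $M$ the fixed point set of that element has codimension at least $4$. Then $M$ is spin (admits a spin structure) if and only if the smooth manifold $M\setminus S$ is spin. Moreover, the spin structures on $M$ are in one-to-one correspondence with the spin structures on $M\setminus S$.
   Context: Orbifolds. An $n$-dimensional orbifold $M$ is a Hausdorff topological space with an atlas of charts $(U,f)$, where $U\subset M$ is open and $f:U\to\mathbb{R}^n/\Gamma_f$ is a homeomorphism, $\Gamma_f$ a finite subgroup of $GL(n,\mathbb{R})$, such that transition functions $g\circ f^{-1}$ lift locally to differentiable maps between the corresponding open subsets of $\mathbb{R}^n$ (i.e. near each $x\in U\cap V$ there is a differentiable $F$ with $g\circ f^{-1}\circ\pi_f=\pi_g\circ F$, where $\pi_f:\mathbb{R}^n\to\mathbb{R}^n/\Gamma_f$, $\pi_g:\mathbb{R}^n\to\mathbb{R}^n/\Gamma_g$ are the projections). $M$ is oriented if an atlas is chosen for which the lifts of transition functions have positive Jacobian determinant; then one takes all groups $\Gamma_f\subset SO(n)$. The singularity group $\Gamma_x\subset SO(n)$ of a point $x$ is the conjugacy class of a minimal finite group $\Gamma_f$ among charts $(U,f)$ around $x$; such a chart is minimal and gives a ramified covering (the minimal smooth covering around $x$) of a neighbourhood of $x$ by an open set of $\mathbb{R}^n$ on which $\Gamma_x$ acts, $0$ being the only preimage of $x$. A point is smooth if $\Gamma_x=\{1\}$ and singular otherwise. A Riemannian metric on $M$ is locally a $\Gamma_x$-invariant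 metric on the minimal smooth covering around $x$. Frame bundle and spin structures. The oriented orthonormal frame ''bundle'' $SO(M)$ is the space which, over a neighbourhood of $x$, is the quotient of the oriented orthonormal frame bundle of the minimal smooth covering around $x$ by the (free) action of $\Gamma_x$ by isometries. $SO(M)$ is a smooth manifold with a right action of $SO(n)$, and $SO_x$ denotes its fiber over $x\in M$. A spin structure on $M$ is a two-fold covering of $SO(M)$ which is non-trivial over each fiber $SO_x$, $x\in M$. $M$ is spin if it admits a spin structure. Spin structures are considered up to isomorphism of coverings of $SO(M)$. *)

(* Defs.v *)
From HB Require Import structures.
From Stdlib Require Import Relation_Operators.
From mathcomp Require Import all_boot all_order all_algebra.
From mathcomp Require Import generic_quotient.
From mathcomp Require Import all_classical all_reals all_analysis.
Import Order.TTheory GRing.Theory Num.Theory.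
Import numFieldNormedType.Exports.

Set Implicit Arguments.
Unset Strict Implicit.
Unset Printing Implicit Defensive.

Local Open Scope quotient_scope.
Local Open Scope classical_set_scope.
Local Open Scope card_scope.
Local Open Scope ring_scope.

(* Vectors of R^n are row vectors: a matrix [a] acts by [v *m a], and          *)
(* ['d F v h = h *m jacobian F v].                                             *)

(* C^k on an open set [U]: differentiable, with C^(k-1) partial derivatives. *)
Fixpoint Ck_on {R : realType} {V W : normedModType R} (k : nat) (U : set V)
    (F : V -> W) : Prop :=
  if k is k'.+1 then
    (forall v, U v -> differentiable F v) /\
    (forall h, Ck_on k' U (fun v => 'd F v h))
  else forall v, U v -> {for v, continuous F}.

Definition smooth_on {R : realType} {V W : normedModType R} (U : set V)
    (F : V -> W) : Prop := forall k, Ck_on k U F.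

Definition smooth_near {R : realType} {V W : normedModType R} (v : V)
    (F : V -> W) : Prop := exists2 U, open_nbhs v U & smooth_on U F.

Definition finite_subgroup_SO {R : realType} {n : nat} (G : set 'M[R]_n) : Prop :=
  [/\ finite_set G, G 1%:M,
      (forall a b, G a -> G b -> G (a *m b)),
      (forall a, G a -> G (invmx a)) &
      (forall a, G a -> a *m a^T = 1%:M /\ \det a = 1)].

(* A chart f : U -> R^n / G is recorded by its folding map                     *)
(* f^-1 \o pi : R^n -> M. By the universal property of the quotient topology,  *)
(* f is a homeomorphism from an open U onto R^n / G iff the folding map is     *)
(* continuous and open and its fibres are exactly the orbits of G; U is then   *)
(* the range of the folding map.                                               *)
Record chart (R : realType) (n : nat) (M : topologicalType) := Chart {
  chart_group : set 'M[R]_n ;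
  fold : 'rV[R]_n -> M ;
  chart_groupP : finite_subgroup_SO chart_group ;
  fold_continuous : continuous fold ;
  fold_open : forall W, open W -> open (fold @` W) ;
  fold_fiber : forall v w,
    fold v = fold w <-> exists2 a, chart_group a & w = v *m a }.

Section Orbifold.
Context {R : realType} {n : nat} {M : topologicalType}.
Implicit Types (c d : chart R n M) (x : M).

Definition chart_dom c : set M := range (fold c).

(* [F] is, near [v], a smooth orientation-preserving lift of the transition    *)
(* function from [c] to [d].                                                   *)
Definition oriented_lift c d (F : 'rV[R]_n -> 'rV[R]_n) (v : 'rV[R]_n) : Prop :=
  [/\ smooth_near v F,
      (\forall w \near v, fold d (F w) = fold c w) &
      0 < \det (jacobian F v)].

Definition compatible c d : Prop :=
  forall v, chart_dom d (fold c v) -> exists F, oriented_lift c d F v.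

Record oriented_atlas := OrientedAtlas {
  atlas : set (chart R n M) ;
  atlas_cover : forall x, exists2 c, atlas c & chart_dom c x ;
  atlas_compatible : forall c d, atlas c -> atlas d -> compatible c d }.

Definition maximal_atlas (A : oriented_atlas) : Prop :=
  forall c, (forall d, atlas A d -> compatible c d /\ compatible d c) ->
    atlas A c.

Definition minimal_chart (A : oriented_atlas) x c : Prop :=
  [/\ atlas A c, chart_dom c x &
      forall d, atlas A d -> chart_dom d x -> chart_group c #<= chart_group d].

(* The conjugacy class "singularity group of x" is represented by the set of   *)
(* its members that are groups of minimal charts; this presupposes that the    *)
(* atlas is maximal.                                                           *)
Definition singularity_group (A : oriented_atlas) x (G : set 'M[R]_n) : Prop :=
  exists2 c, minimal_chart A x c & G = chart_group c.

Definition smooth_point (A : oriented_atlas) x : Prop :=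
  singularity_group A x [set 1%:M].

Definition singular_set (A : oriented_atlas) : set M :=
  [set x | ~ smooth_point A x].

Definition fixed_codim (a : 'M[R]_n) : nat := (n - \rank (eigenspace a 1))%N.

Definition singular_codim_ge (A : oriented_atlas) (k : nat) : Prop :=
  forall x G a, singularity_group A x G -> G a -> a <> 1%:M ->
    (k <= fixed_codim a)%N.

(* A metric is given by its Gram matrices in the charts. Invariance under      *)
(* lifts contains, for c = d, the invariance under [chart_group c].            *)
Record riemannian_metric (A : oriented_atlas) := RiemannianMetric {
  gram : chart R n M -> 'rV[R]_n -> 'M[R]_n ;
  gram_smooth : forall c, atlas A c -> smooth_on setT (gram c) ;
  gram_sym : forall c v, atlas A c -> (gram c v)^T = gram c v ;
  gram_pos : forall c v (u : 'rV[R]_n), atlas A c -> u != 0 ->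
    0 < (u *m gram c v *m u^T) 0 0 ;
  gram_lift : forall c d F v, atlas A c -> atlas A d -> oriented_lift c d F v ->
    gram c v = jacobian F v *m gram d (F v) *m (jacobian F v)^T }.

End Orbifold.

Arguments oriented_atlas R n M : clear implicits.

Section FrameBundle.
Context {R : realType} {n : nat} {M : topologicalType}.
Variables (A : oriented_atlas R n M) (g : riemannian_metric A).

(* Pairs of a point of R^n and an oriented orthonormal frame at this point,    *)
(* whose vectors are the rows of the matrix.                                   *)
Definition chart_frames (c : chart R n M) : set ('rV[R]_n * 'M[R]_n) :=
  [set ve | ve.2 *m gram g c ve.1 *m ve.2^T = 1%:M /\ 0 < \det ve.2].

Definition atlas_chart := {c : chart R n M | atlas A c}.

Definition local_frames : topologicalType :=
  {c : {classic atlas_chart} & set_type (chart_frames (sval c))}.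

Definition lf_chart (p : local_frames) : chart R n M := sval (projT1 p).
Definition lf_point (p : local_frames) : 'rV[R]_n := (set_val (projT2 p)).1.
Definition lf_frame (p : local_frames) : 'M[R]_n := (set_val (projT2 p)).2.

Definition frame_transition (p q : local_frames) : Prop :=
  exists F, [/\ oriented_lift (lf_chart p) (lf_chart q) F (lf_point p),
                F (lf_point p) = lf_point q &
                lf_frame p *m jacobian F (lf_point p) = lf_frame q].

(* [frame_transition] is itself an equivalence relation; generating one        *)
(* spares the inverse function theorem here.                                   *)
Definition frame_equiv : rel local_frames :=
  fun p q => `[< clos_refl_sym_trans _ frame_transition p q >].

Lemma frame_equiv_refl : reflexive frame_equiv.
Proof. by move=> p; apply/asboolP; exact: rst_refl. Qed.

Lemma frame_equiv_sym : symmetric frame_equiv.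
Proof.
by move=> p q; apply/idP/idP => /asboolP pq; apply/asboolP; exact: rst_sym.
Qed.

Lemma frame_equiv_trans : transitive frame_equiv.
Proof.
move=> q p r /asboolP pq /asboolP qr; apply/asboolP.
exact: rst_trans pq qr.
Qed.

Canonical frame_equiv_equiv :=
  EquivRel frame_equiv frame_equiv_refl frame_equiv_sym frame_equiv_trans.

(* Within one chart the identification is by the action of its group, so this  *)
(* glues the quotients of the frame bundles of the charts by their groups.     *)
Definition SO_bundle : topologicalType :=
  quotient_topology {eq_quot frame_equiv}.

Definition SO_pi (p : local_frames) : SO_bundle :=
  (\pi_({eq_quot frame_equiv}) p)%qT.

Definition SO_repr (q : SO_bundle) : local_frames :=
  repr (q : {eq_quot frame_equiv}).

Definition SO_proj (q : SO_bundle) : M :=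
  fold (lf_chart (SO_repr q)) (lf_point (SO_repr q)).

Definition SO_fiber (x : M) : set SO_bundle := [set q | SO_proj q = x].

End FrameBundle.

(* [p] restricted to [p @^-1` U] is isomorphic, over [U], to [U * bool].       *)
Definition trivial_over {E B : topologicalType} (p : E -> B) (U : set B) : Prop :=
  exists (s : B * bool -> E) (t : E -> bool),
    [/\ {within U `*` setT, continuous s}, {within p @^-1` U, continuous t},
        (forall b i, U b -> p (s (b, i)) = b /\ t (s (b, i)) = i) &
        (forall e, U (p e) -> s (p e, t e) = e)].

Record twofold_covering (B : topologicalType) := TwofoldCovering {
  total : topologicalType ;
  cov : total -> B ;
  cov_continuous : continuous cov ;
  cov_locally_trivial :
    forall b, exists2 U, open_nbhs b U & trivial_over cov U }.

Definition covering_iso {B : topologicalType} (C D : twofold_covering B) : Prop :=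
  exists (f : total C -> total D) (h : total D -> total C),
    [/\ continuous f, continuous h, cancel f h, cancel h f &
        forall e, cov (f e) = cov e].

Section SpinStructure.
Context {R : realType} {n : nat} {M : topologicalType}.
Context {A : oriented_atlas R n M}.

Record spin_structure (g : riemannian_metric A) := SpinStructure {
  spin_cov :> twofold_covering (SO_bundle g) ;
  spin_nontrivial : forall x, ~ trivial_over (@cov _ spin_cov) (SO_fiber x) }.

Definition spin (g : riemannian_metric A) : Prop := inhabited (spin_structure g).

Definition spin_iso_class (g : riemannian_metric A) (E : spin_structure g) :
    spin_structure g -> Prop := fun E' => covering_iso E E'.

Definition spin_class (g : riemannian_metric A) : Type :=
  {C : spin_structure g -> Prop | exists E, C = spin_iso_class E}.

Definition spin_class_of (g : riemannian_metric A) (E : spin_structure g) :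
    spin_class g :=
  exist _ (spin_iso_class E) (ex_intro _ E erefl).

End SpinStructure.

(* The smooth manifold M \ S, with the charts of M that have a trivial group   *)
(* and the restriction of the metric.                                          *)
Section RegularPart.
Context {R : realType} {n : nat} {M : topologicalType}.
Variable A : oriented_atlas R n M.

Definition regular_part : topologicalType := set_type (~` singular_set A).

Lemma trivial_group_le (c d : chart R n M) :
  chart_group c = [set 1%:M] -> chart_group c #<= chart_group d.
Proof.
move=> ->; apply: subset_card_le => _ ->.
by have [] := chart_groupP d.
Qed.

Lemma trivial_chart_regular (c : chart R n M) :
  atlas A c -> chart_group c = [set 1%:M] ->
  chart_dom c `<=` ~` singular_set A.
Proof.
move=> Ac c1 x cx; apply; exists c => //; split=> // d Ad dx.
exact: trivial_group_le.
Qed.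

Lemma regularP x : (~` singular_set A) x -> exists c,
  [/\ atlas A c, chart_group c = [set 1%:M] & chart_dom c x].
Proof. by move=> /contrapT[c [Ac cx _] c1]; exists c. Qed.

Lemma open_regular : open (~` singular_set A).
Proof.
rewrite openE => x /regularP[c [Ac c1 cx]].
rewrite /interior; apply: filterS (trivial_chart_regular Ac c1) _.
apply: open_nbhs_nbhs; split=> //; apply: fold_open; exact: openT.
Qed.

Definition regular_val (x : regular_part) : M := set_val x.

Lemma regular_val_continuous : continuous regular_val.
Proof. exact: initial_continuous. Qed.

Lemma regular_val_open (W : set regular_part) :
  open W -> open (regular_val @` W).
Proof.
move=> [U oU <-].
have -> : regular_val @` (regular_val @^-1` U) = U `&` ~` singular_set A.
  rewrite eqEsubset; split=> [_ [x Ux <-]|x [Ux rx]].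
    by split=> //; exact: set_valP.
  by exists (SigSub (mem_set rx)).
by apply: openI => //; exact: open_regular.
Qed.

(* A chart of M \ S seen as a chart of M. *)
Program Definition chart_incl (c : chart R n regular_part) : chart R n M :=
  @Chart R n M (chart_group c) (fun v => regular_val (fold c v))
    (chart_groupP c) _ _ _.
Next Obligation.
move=> c v; apply: continuous_comp; first exact: fold_continuous.
exact: regular_val_continuous.
Qed.
Next Obligation.
move=> c W oW; rewrite -image_comp.
by apply: regular_val_open; exact: fold_open.
Qed.
Next Obligation.
move=> c v w; rewrite -fold_fiber; split=> [|-> //]; exact: val_inj.
Qed.

Lemma chart_incl_surj (c : chart R n M) :
  atlas A c -> chart_group c = [set 1%:M] -> exists c', chart_incl c' = c.
Proof.
move=> Ac c1.
have cr v : (~` singular_set A) (fold c v).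
  by apply: (trivial_chart_regular Ac c1); exists v.
pose f v : regular_part := SigSub (mem_set (cr v)).
have fc : continuous f.
  by apply: continuous_comp_initial; exact: fold_continuous.
have fo W : open W -> open (f @` W).
  move=> oW; exists (fold c @` W); first exact: fold_open.
  rewrite eqEsubset; split=> [x [v Wv vx]|_ [v Wv <-]]; last by exists v.
  by exists v => //; exact: val_inj.
have ff v w : f v = f w <-> exists2 a, chart_group c a & w = v *m a.
  rewrite -fold_fiber; split=> [[]//|vw]; exact: val_inj.
exists (Chart (chart_groupP c) fc fo ff); rewrite /chart_incl.
case: c Ac c1 cr @f fc fo ff => G F p1 p2 p3 p4 /= *.
by congr Chart; exact: Prop_irrelevance.
Qed.

Program Definition regular_atlas : oriented_atlas R n regular_part :=
  @OrientedAtlas R n regular_part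
    [set c | atlas A (chart_incl c) /\ chart_group c = [set 1%:M]] _ _.
Next Obligation.
move=> x; have [c [Ac c1 [v _ vx]]] := regularP (set_valP x).
have [c' c'c] := chart_incl_surj Ac c1; exists c'; rewrite /= ?c'c.
  by split=> //; rewrite -c1 -c'c.
by exists v => //; apply: val_inj; rewrite -[RHS]vx -c'c.
Qed.
Next Obligation.
move=> c d [Ac _] [Ad _] v [w _ wv].
have [|F [sF lF dF]] := atlas_compatible Ac Ad (v := v).
  by exists w => //=; rewrite wv.
exists F; split=> //; apply: filterS lF => u; exact: val_inj.
Qed.

Lemma chart_incl_lift (c d : chart R n regular_part) F v :
  oriented_lift c d F v -> oriented_lift (chart_incl c) (chart_incl d) F v.
Proof. by move=> [sF lF dF]; split=> //; apply: filterS lF => u /= ->. Qed.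

Variable g : riemannian_metric A.

Program Definition regular_metric : riemannian_metric regular_atlas :=
  @RiemannianMetric R n regular_part regular_atlas
    (fun c => gram g (chart_incl c)) _ _ _ _.
Next Obligation. by move=> c [Ac _]; exact: gram_smooth. Qed.
Next Obligation. by move=> c v [Ac _]; exact: gram_sym. Qed.
Next Obligation. by move=> c v u [Ac _]; exact: gram_pos. Qed.
Next Obligation.
by move=> c d F v [Ac _] [Ad _] /chart_incl_lift; exact: gram_lift.
Qed.

Definition local_frames_incl (p : local_frames regular_metric) : local_frames g :=
  existT (fun c : {classic atlas_chart A} => set_type (chart_frames g (sval c)))
    (exist _ (chart_incl (lf_chart p)) (proj1 (svalP (projT1 p))))
    (projT2 p).

Definition SO_incl (q : SO_bundle regular_metric) : SO_bundle g :=
  SO_pi (local_frames_incl (SO_repr q)).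

(* [E'] is the pull-back of [E] under the inclusion of SO(M \ S) in SO(M).     *)
Definition restricts_to (E : twofold_covering (SO_bundle g))
    (E' : twofold_covering (SO_bundle regular_metric)) : Prop :=
  exists u : total E' -> total E,
    [/\ continuous u,
        (forall e, cov (u e) = SO_incl (cov e)) &
        (forall q e, cov e = SO_incl q -> exists! e', cov e' = q /\ u e' = e)].

End RegularPart.

(* Main.v *)
(* The complement of SO(M \ S) in SO(M) has codimension at least 4, hence every  *)
(* twofold covering of SO(M \ S) extends uniquely to SO(M). Indeed, in a minimal *)
(* chart the singular set is a finite union of linear subspaces L of codimension *)
(* at least 4. A ball minus these subspaces is connected, since two points are   *)
(* joined by two segments through a third point in general position. A twofold   *)
(* covering of it is trivial: outside the cones over the L with generic apex x,  *)
(* which have codimension at least 3, it is trivial because that set is          *)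
(* star-shaped around x, and the section obtained extends across the cones       *)
(* because their complement is locally connected. So the covering extends by     *)
(* germs of its local sections. An extended covering that is trivial over a      *)
(* singular fibre is trivial over a regular fibre too, by homotopy lifting.      *)

Require Import Defs.
From mathcomp Require Import all_boot all_order all_algebra.
From mathcomp Require Import all_classical all_reals all_analysis.
From HB Require Import structures.
From Stdlib Require Import Relation_Operators.
From mathcomp Require Import generic_quotient ring lra.
Import Order.TTheory GRing.Theory Num.Theory.
Import numFieldNormedType.Exports.

Set Implicit Arguments.
Unset Strict Implicit.
Unset Printing Implicit Defensive.

Local Open Scope classical_set_scope.
Local Open Scope card_scope.
Local Open Scope ring_scope.

(** * Twofold coverings *)

(** Write [i] for the inclusion [SO_incl] of SO(M \ S) in SO(M). It is an open embedding
    ([SO_incl_continuous], [SO_incl_inj], [SO_incl_open]) onto the frames over regular points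
    ([range_SO_incl]). Spin structures are twofold coverings with a condition on fibres, so the
    question is how twofold coverings behave under restriction along [i].

    Restriction is pull-back: it exists by [is_restriction_exists] and is determined up to
    isomorphism by [is_restriction_iso]. For the converse, two local properties of [i] are
    established. Every frame of M has arbitrarily small neighbourhoods whose trace on SO(M \ S) is
    nonempty and connected ([frames_locally_connected]); lifts therefore extend uniquely over the
    missing frames ([extend_lift], [lifts_dense]), and coverings with a common restriction are
    isomorphic ([is_restriction_inj]). Moreover every covering of SO(M \ S) has a section over the
    trace of some neighbourhood of each frame of M ([regular_cover_locally_trivial]), and the germs
    of such sections are the points of an extended covering ([is_restriction_surj]).

    Both properties are checked in [frame_chart], which parametrises the frames over a chart by
    pairs of a point and a basis of positive determinant. The regular points of a chart are those
    with trivial stabiliser ([regular_free_point], [free_point_regular]); in a minimal chart they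
    form the complement of finitely many linear subspaces of codimension at least 4
    ([free_point_subspaces]). So [cut_ball_connected] and [cut_ball_lift] apply to a ball of pairs
    from which these subspaces are removed.

    The condition on fibres is preserved both ways ([restriction_spin]): regular fibres are the same
    in SO(M \ S) and in SO(M) ([restriction_fiber]), and a section over a singular fibre can be
    moved to a regular fibre of the same chart ([trivial_over_regular_fiber]). *)

Lemma within_continuousP {T U : topologicalType} (A : set T) (f : T -> U) :
  {within A, continuous f} <->
  forall x V, A x -> nbhs (f x) V -> \forall y \near x, A y -> V (f y).
Proof.
split=> [/subspace_continuousP cf x V Ax fxV|cf]; first exact: cf Ax V fxV.
by apply/subspace_continuousP => x Ax V /= fxV; exact: cf.
Qed.

(** The points of [A] where [P] holds form a nonempty subset that is relatively open and relatively
    closed. *)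
Lemma connected_locally_constant {T : topologicalType} (A : set T)
    (P : T -> Prop) x y :
    connected A ->
    (forall z, A z -> \forall w \near z, A w -> (P w <-> P z)) ->
  A x -> A y -> P x -> P y.
Proof.
move=> cA loc Ax Ay Px.
suff AE : [set w | A w /\ P w] = A.
  by have : A y by []; rewrite -{1}AE => -[].
apply: cA.
- by exists x.
- exists (interior [set w | A w -> P w]); first exact: open_interior.
  rewrite eqEsubset; split=> w [Aw] => [e|/interior_subset H]; split=> //=; last exact: H.
  by apply: filterS (loc w Aw) => v /[apply] /iffRL; apply.
- exists (~` interior [set w | A w -> ~ P w]).
    by apply: open_closedC; exact: open_interior.
  rewrite eqEsubset; split=> w [Aw] => [e|n]; split=> //=.
    by move=> /interior_subset/(_ Aw).
  apply: contrapT => e; apply: n => /=.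
  by apply: filterS (loc w Aw) => v /[apply] /iffLR H /H.
Qed.

(** * Sheets, deck involution and local sections of a twofold covering *)

Section Covering.
Context {B : topologicalType} (C : twofold_covering B).
Local Notation E := (Defs.total C).
Local Notation p := (@cov B C).

Lemma fiber_other (e : E) : exists e' : E,
  [/\ p e' = p e, e' <> e & forall e'', p e'' = p e -> e'' = e \/ e'' = e'].
Proof.
have [U [_ Ue] [s [t [_ _ st ts]]]] := cov_locally_trivial C (p e).
have [ps tsi] := st (p e) (~~ t e) Ue.
exists (s (p e, ~~ t e)); split=> // [se|e'' pe''].
  by have := tsi; rewrite se; case: (t e).
have /ts <- : U (p e'') by rewrite pe''.
have /ts {1}<- : U (p e) by [].
by rewrite pe''; case: (t e) (t e'') => [] []; solve [by left|by right].
Qed.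

(** The deck involution, which exchanges the two sheets. *)
Definition flip (e : E) : E := sval (cid (fiber_other e)).

Lemma cov_flip e : p (flip e) = p e.
Proof. by rewrite /flip; case: cid => ? []. Qed.

Lemma flip_neq e : flip e <> e.
Proof. by rewrite /flip; case: cid => ? []. Qed.

Lemma fiber_flip e e' : p e' = p e -> e' = e \/ e' = flip e.
Proof. by move=> pe; rewrite /flip; case: cid => x /= [_ _ H]; exact: H. Qed.

Lemma flipK : involutive flip.
Proof.
move=> e; have [//|] := fiber_flip (etrans (cov_flip (flip e)) (cov_flip e)).
by move/flip_neq.
Qed.

Lemma fiber_nonempty b : exists e : E, p e = b.
Proof.
have [U [_ Ub] [s [t [_ _ st _]]]] := cov_locally_trivial C b.
by exists (s (b, true)); case: (st b true Ub).
Qed.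

Lemma local_sheet (e : E) : exists (U : set B) (t : E -> bool),
  [/\ open_nbhs (p e) U, {within p @^-1` U, continuous t} &
      forall e1 e2, U (p e1) -> p e1 = p e2 -> t e1 = t e2 -> e1 = e2].
Proof.
have [U oU [s [t [_ ct _ ts]]]] := cov_locally_trivial C (p e).
exists U, t; split=> // e1 e2 Ue1 e12 t12.
by rewrite -(ts e1)// -(ts e2) -?e12// t12.
Qed.

(** Over a trivialising open set the sheet number is locally constant along each of the two maps,
    and two points of the same fibre are equal exactly when their sheet numbers are. *)
Lemma lifts_locally {T : topologicalType} (A : set T) (g h : T -> E) y :
    {within A, continuous g} -> {within A, continuous h} ->
    (forall z, A z -> p (g z) = p (h z)) -> A y ->
  \forall z \near y, A z -> (g z = h z <-> g y = h y).
Proof.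
move=> /within_continuousP cg /within_continuousP ch gh Ay.
have [U [t [[oU Ug] ct inj]]] := local_sheet (g y).
have pU : nbhs (g y) (p @^-1` U).
  by apply: (@cov_continuous _ C); exact: open_nbhs_nbhs.
have pUh : nbhs (h y) (p @^-1` U).
  by apply: (@cov_continuous _ C); rewrite -gh//; exact: open_nbhs_nbhs.
move/within_continuousP: ct => ct.
have tg : nbhs (t (g y)) [set t (g y)] by [].
have th : nbhs (t (h y)) [set t (h y)] by [].
have {tg}tg := ct _ _ Ug tg.
have {th}th : nbhs (h y) (fun e => (p @^-1` U) e -> [set t (h y)] (t e)).
  by apply: ct th; rewrite /= -gh.
apply: filterS (filterI (filterI (cg _ _ Ay tg) (ch _ _ Ay th))
  (filterI (cg _ _ Ay pU) (ch _ _ Ay pUh))) => z [[]] /[swap].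
move=> H1 H2 [H3 H4] Az.
have Ug' := H3 Az; have Uh' := H4 Az.
have Eg := H2 Az Ug'; have Eh := H1 Az Uh'.
split=> [ghz|ghy]; apply: inj => //; rewrite ?gh//.
  by rewrite -Eg -Eh ghz.
by rewrite Eg Eh ghy.
Qed.

Lemma lifts_connected {T : topologicalType} (A : set T) (g h : T -> E) y :
    {within A, continuous g} -> {within A, continuous h} ->
    (forall z, A z -> p (g z) = p (h z)) -> connected A ->
    A y -> g y = h y ->
  forall z, A z -> g z = h z.
Proof.
move=> cg ch gh cA Ay ghy z Az.
apply: (@connected_locally_constant _ A (fun w => g w = h w) y z) => // w Aw.
exact: lifts_locally.
Qed.

Lemma flip_continuous : continuous flip.
Proof.
move=> e; have [U [oU Ue] [s [t [cs ct st ts]]]] := cov_locally_trivial C (p e).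
have nU : nbhs e (p @^-1` U).
  by apply: (@cov_continuous _ C); exact: open_nbhs_nbhs.
have flipE e' : U (p e') -> flip e' = s (p e', ~~ t e').
  move=> Ue'; have [ps tsi] := st (p e') (~~ t e') Ue'.
  have [se|//] := fiber_flip ps.
  by have := tsi; rewrite se; case: (t e').
move=> V; rewrite flipE// => nV.
have [/within_continuousP cs' /within_continuousP ct'] := (cs, ct).
have [[P Q] /= [nP nQ] PQ] := cs' (p e, ~~ t e) V (conj Ue I) nV.
have te : nbhs (t e) [set t e] by [].
have nPe : nbhs e (p @^-1` P) by exact: (@cov_continuous _ C).
apply: filterS (filterI (filterI nU nPe) (ct' _ _ Ue te)) => e' [[Ue' Pe'] te'].
rewrite /preimage /= flipE//; apply: (PQ (p e', ~~ t e')) => //; split=> //=.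
by rewrite (te' Ue'); exact: nbhs_singleton nQ.
Qed.

Lemma local_section (e : E) : exists (U : set B) (s : B -> E),
  [/\ open_nbhs (p e) U, {within U, continuous s},
      (forall b, U b -> p (s b) = b) & s (p e) = e].
Proof.
have [U [oU Ue] [s [t [cs ct st ts]]]] := cov_locally_trivial C (p e).
exists U, (fun b => s (b, t e)); split=> //; last exact: ts.
- apply/within_continuousP => b V Ub nV.
  have /within_continuousP/(_ (b, t e) V (conj Ub I) nV) := cs.
  move=> [[P Q] /= [nP nQ] PQ].
  apply: filterS nP => b' Pb' Ub'; apply: (PQ (b', t e)) => //; split=> //=.
  exact: nbhs_singleton nQ.
- by move=> b Ub; case: (st b (t e) Ub).
Qed.

(** A section and its flip are the two sheets; the sheet number of [e] tells whether [e] lies on the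
    section, which is locally constant by [lifts_locally]. *)
Lemma trivial_overP (U : set B) :
  trivial_over p U <-> exists s : B -> E,
    {within U, continuous s} /\ forall b, U b -> p (s b) = b.
Proof.
split=> [[s [t [cs ct st ts]]]|[s [cs ps]]].
  exists (fun b => s (b, true)); split; last by move=> b Ub; case: (st b true Ub).
  apply/within_continuousP => b V Ub nV.
  have /within_continuousP/(_ (b, true) V (conj Ub I) nV) := cs.
  move=> [[P Q] /= [nP nQ] PQ].
  apply: filterS nP => b' Pb' Ub'; apply: (PQ (b', true)) => //; split=> //=.
  exact: nbhs_singleton nQ.
pose r (bi : B * bool) := if bi.2 then s bi.1 else flip (s bi.1).
exists r, (fun e => `[< s (p e) = e >]); split.
- apply/within_continuousP => -[b i] V [/= Ub _] nV.
  exists ([set b' | U b' -> V (r (b', i))], [set i]) => /=; last first.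
    by move=> [b' j] /= [H ->] [/= /H].
  split=> //; move/within_continuousP: cs => cs.
  case: i nV => nV; rewrite /r /= in nV *; first exact: cs.
  by apply: (cs b (flip @^-1` V)) => //; exact: flip_continuous.
- apply/within_continuousP => e V Ue nV.
  have cs' : {within p @^-1` U, continuous (s \o p)}.
    apply/within_continuousP => e' W Ue' nW.
    have nW' : nbhs (p e') (fun b => U b -> W (s b)).
      by move/within_continuousP: cs; exact.
    exact: (@cov_continuous _ C e' _ nW').
  have ci : {within p @^-1` U, continuous (@id E)}.
    by apply/within_continuousP => ? W _; apply: filterS.
  have := lifts_locally cs' ci (fun e (Ue : U (p e)) => ps _ Ue) Ue.
  apply: filterS => e' /[apply] /= ee'; suff -> : `[< s (p e') = e' >] = `[< s (p e) = e >].
    exact: nbhs_singleton nV.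
  exact: asbool_equiv_eq.
- move=> b i Ub; rewrite /r; case: i => /=.
    by split; [exact: ps|apply/asboolP; rewrite ps].
  rewrite cov_flip ps//; split=> //; apply/asboolPn => /esym; exact: flip_neq.
- move=> e Ue; rewrite /r /=; case: asboolP => //= se.
  by have [//|->] := @fiber_flip e (s (p e)) (ps _ Ue); rewrite flipK.
Qed.

End Covering.

(** Since [Q] is single-valued on [A], an arbitrary choice of values agrees near each point with the
    local continuous solution [h]. The inhabitant of [U] only serves as a value off [A]. *)
Lemma glue_continuous {T U : topologicalType} (A : set T) (Q : T -> U -> Prop) :
    (T -> inhabited U) ->
    (forall y u v, A y -> Q y u -> Q y v -> u = v) ->
    (forall y, A y -> exists h : T -> U,
       (forall V, nbhs (h y) V -> \forall z \near y, A z -> V (h z)) /\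
       \forall z \near y, A z -> Q z (h z)) ->
  exists2 G : T -> U, {within A, continuous G} & forall y, A y -> Q y (G y).
Proof.
move=> iU fQ loc.
have [G QG] : {G : T -> U & forall y, A y -> Q y (G y)}.
  apply: (@choice _ _ (fun y u => A y -> Q y u)) => y; have [Ay|nAy] := pselect (A y).
    have [h [_ /nbhs_singleton/(_ Ay)]] := loc y Ay; by exists (h y).
  by have [u] := iU y; exists u.
exists G => //; apply/within_continuousP => y V Ay nV.
have [h [ch Qh]] := loc y Ay.
have hG : h y = G y by exact: (fQ y _ _ Ay (nbhs_singleton Qh Ay) (QG y Ay)).
rewrite -hG in nV.
apply: filterS (filterI (ch V nV) Qh) => z [Vz Qz] Az.
by rewrite (fQ z _ _ Az (QG z Az) (Qz Az)); exact: Vz.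
Qed.

Lemma pair_continuous {T U V : topologicalType} (f : T -> U) (g : T -> V) :
  continuous f -> continuous g -> continuous (fun x => (f x, g x)).
Proof.
by move=> cf cg x; exact: (@cvg_pair _ _ _ _ _ _ _ _ _ f g (cf x) (cg x)).
Qed.

Lemma fst_continuous {T U : topologicalType} : continuous (@fst T U).
Proof. by move=> [x y]; exact: cvg_fst. Qed.

Lemma snd_continuous {T U : topologicalType} : continuous (@snd T U).
Proof. by move=> [x y]; exact: cvg_snd. Qed.

Lemma within_comp {T U V : topologicalType} (A : set T) (D : set U)
    (f : T -> U) (s : U -> V) :
    {within A, continuous f} -> {within D, continuous s} ->
    (forall y, A y -> D (f y)) ->
  {within A, continuous (s \o f)}.
Proof.
move=> /within_continuousP cf /within_continuousP cs fAD.
apply/within_continuousP => x W Ax nW.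
apply: filterS (cf _ _ Ax (cs _ _ (fAD _ Ax) nW)) => y H Ay.
exact: H (fAD _ Ay).
Qed.

Lemma within_compl {T U V : topologicalType} (A : set T)
    (f : T -> U) (s : U -> V) :
  {within A, continuous f} -> continuous s -> {within A, continuous (s \o f)}.
Proof.
move=> cf cs; apply: (@within_comp _ _ _ _ setT) => //.
apply/within_continuousP => x W _ nW.
have : nbhs x (s @^-1` W) by exact: cs.
by apply: filterS.
Qed.

Lemma continuous_within {T U : topologicalType} (A : set T) (f : T -> U) :
  continuous f -> {within A, continuous f}.
Proof.
move=> cf; apply/within_continuousP => x W _ nW.
have : nbhs x (f @^-1` W) by exact: cf.
by apply: filterS.
Qed.

Lemma within_id {T : topologicalType} (A : set T) : {within A, continuous (@id T)}.
Proof. by apply: continuous_within => x; exact: cvg_id. Qed.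

(** [Z] is dense at the points of [Y] and does not locally separate them. This is the form in which
    complements of subsets of codimension at least 2 enter. *)
Definition locally_connected_in {T : topologicalType} (Y Z : set T) : Prop :=
  forall y V, Y y -> nbhs y V ->
  exists W, [/\ nbhs y W, W `<=` V, W `&` Z !=set0 & connected (W `&` Z)].

(** * Lifts of maps and their extension across small sets *)

Section Lifts.
Context {B : topologicalType} (C : twofold_covering B).
Local Notation E := (Defs.total C).
Local Notation p := (@cov B C).

Definition is_lift {T : topologicalType} (A : set T) (f : T -> B) (g : T -> E) :=
  {within A, continuous g} /\ forall y, A y -> p (g y) = f y.

Lemma is_liftS {T : topologicalType} (A A' : set T) (f : T -> B) (g : T -> E) :
  A' `<=` A -> is_lift A f g -> is_lift A' f g.
Proof.
move=> AA' [cg pg]; split; first exact: continuous_subspaceW AA' cg.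
by move=> y /AA'/pg.
Qed.

Lemma is_lift_flip {T : topologicalType} (A : set T) (f : T -> B) (g : T -> E) :
  is_lift A f g -> is_lift A f (@flip _ C \o g).
Proof.
move=> [cg pg]; split; first by apply: within_compl cg _; exact: flip_continuous.
by move=> y Ay /=; rewrite cov_flip pg.
Qed.

Lemma is_lift_eq_near {T : topologicalType} (A : set T) (f : T -> B)
    (g h : T -> E) y :
    is_lift A f g -> is_lift A f h -> A y ->
  \forall z \near y, A z -> (g z = h z <-> g y = h y).
Proof.
move=> [cg pg] [ch ph] Ay; apply: lifts_locally => // z Az.
by rewrite pg// ph.
Qed.

Lemma is_lift_eq {T : topologicalType} (A : set T) (f : T -> B)
    (g h : T -> E) y :
    is_lift A f g -> is_lift A f h -> connected A -> A y -> g y = h y ->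
  forall z, A z -> g z = h z.
Proof.
move=> [cg pg] [ch ph] cA Ay gh; apply: (lifts_connected cg ch) Ay gh => //.
by move=> z Az; rewrite pg// ph.
Qed.

(** One neighbourhood [U] serves all points over it, so it can be fixed before the point is known:
    the section through [e] is a given one or its flip. *)
Lemma local_section_through b : exists U (s : E -> B -> E), open_nbhs b U /\
  forall e, U (p e) -> is_lift U id (s e) /\ s e (p e) = e.
Proof.
have [e0 <-] := fiber_nonempty C b.
have [U [s [oU cs ps _]]] := local_section e0.
exists U, (fun e => if `[< s (p e) = e >] then s else @flip _ C \o s).
split=> // e Ue; case: asboolP => se; first by split.
split; first exact: (is_lift_flip (f := id) (conj cs ps)).
by have [//|/= ->] := fiber_flip (ps _ Ue); rewrite flipK.
Qed.

(** Near a point of [Y] the map [f] runs in an evenly covered set, and on a small connected trace of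
    [Z] the lift [g] coincides with one section composed with [f]; that composite is the extension.
    [Q y e] says that [e] is the value at [y] of some such local extension, and it is single-valued
    because two of them agree at points of [Z] near [y]. *)
Lemma extend_lift {T : topologicalType} (Y Z : set T) (f : T -> B) (g : T -> E) :
    {within Y, continuous f} -> Z `<=` Y -> locally_connected_in Y Z ->
    is_lift Z f g ->
  exists2 G, is_lift Y f G & forall z, Z z -> G z = g z.
Proof.
move=> cf ZY lcd lg.
pose Q y e := exists W h, [/\ nbhs y W, is_lift (W `&` Y) f h,
  forall z, W z -> Z z -> h z = g z & h y = e].
have fQ y u v : Y y -> Q y u -> Q y v -> u = v.
  move=> Yy [W [h [nW lh hg <-]]] [W' [h' [nW' lh' hg' <-]]].
  have lh1 : is_lift (W `&` W' `&` Y) f h.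
    by apply: is_liftS lh => z [[]].
  have lh1' : is_lift (W `&` W' `&` Y) f h'.
    by apply: is_liftS lh' => z [[]].
  have Ay : (W `&` W' `&` Y) y by split=> //; split; exact: nbhs_singleton.
  have nb := is_lift_eq_near lh1 lh1' Ay.
  have [X [nX XV [z [Xz Zz]] _]] := lcd _ _ Yy (filterI nb (filterI nW nW')).
  have [+ [Wz W'z]] := XV _ Xz; case=> [|H _]; first by split=> //; exact: ZY.
  by apply: H; rewrite hg// hg'.
have [||G cG QG] := @glue_continuous _ _ Y Q _ fQ.
- by move=> y; have [e _] := fiber_nonempty C (f y).
- move=> y Yy; have [U [s [[oU Uy] ls]]] := local_section_through (f y).
  have nU : nbhs (f y) U by exact: open_nbhs_nbhs.
  move/within_continuousP : (cf) => /(_ y U Yy nU) nfU.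
  have [W [nW WU [z0 [Wz0 Zz0]] cW]] := lcd _ _ Yy nfU.
  have gU : U (p (g z0)) by rewrite lg.2//; apply: WU => //; exact: ZY.
  have [[cs ps] sg] := ls _ gU.
  have lh : is_lift (W `&` Y) f (s (g z0) \o f).
    split; last by move=> z [Wz Yz] /=; rewrite ps//; exact: WU.
    apply: (@within_comp _ _ _ _ U) => //; last by move=> z [Wz Yz]; exact: WU.
    by apply: continuous_subspaceW cf => z [].
  have WZY : W `&` Z `<=` W `&` Y by move=> z [Wz /ZY].
  have hg z : W z -> Z z -> (s (g z0) \o f) z = g z.
    move=> Wz Zz; apply: (is_lift_eq (is_liftS WZY lh) _ cW _ _ (conj Wz Zz)).
    - by apply: is_liftS lg => ? [].
    - exact: (conj Wz0 Zz0).
    - by rewrite /= -(lg.2 _ Zz0).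
  exists (s (g z0) \o f); split.
    move=> V nV; have := lh.1 => /within_continuousP/(_ y V).
    move=> /(_ (conj (nbhs_singleton nW) Yy) nV) nV'.
    by apply: filterS (filterI nW nV') => z [Wz H] Yz; exact: H.
  apply: filterS (nbhs_interior nW) => z nWz Yz.
  by exists W, (s (g z0) \o f).
exists G.
  split=> // y /[dup] Yy /QG[W [h [nW lh _ <-]]].
  by apply: lh.2; split=> //; exact: nbhs_singleton.
move=> z Zz; have [W [h [nW lh hg <-]]] := QG z (ZY _ Zz).
by apply: hg => //; exact: nbhs_singleton.
Qed.

End Lifts.

(** * Homotopy lifting *)

Section HomotopyLifting.
Context {R : realType} {B : topologicalType} (C : twofold_covering B).
Local Notation E := (Defs.total C).
Local Notation p := (@cov B C).
Context {T : topologicalType} (A : set T) (H : T * R -> B).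
Local Notation I b := [set t : R | 0 <= t <= b].
Hypothesis cH : {within A `*` I 1, continuous H}.
Variable s0 : T -> E.
Hypothesis ls0 : is_lift A (fun y => H (y, 0)) s0.

(** Agreement with [s0] is only asked at [y] itself; it holds at nearby points of [A] as well, by
    local constancy. *)
Local Definition tube y b := exists (N : set T) (h : T * R -> E), [/\ nbhs y N,
  is_lift ((N `&` A) `*` I b) H h & h (y, 0) = s0 y].

Local Lemma within_slice (X : topologicalType) (N : set T) (D : set R)
    (h : T * R -> X) t :
  {within N `*` D, continuous h} -> D t -> {within N, continuous (fun z => h (z, t))}.
Proof.
move=> ch Dt; apply: (@within_comp _ _ _ N (N `*` D) (fun z => (z, t)) h) => //.
by apply: continuous_within; apply: pair_continuous => x; [exact: cvg_id|exact: cvg_cst].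
Qed.

(** Between the times [b] and [b'] the homotopy runs in the evenly covered set [U], so the lift is
    continued by the section through [h (y, b)]. *)
Local Lemma tube_extend y b b' N0 U (s : E -> B -> E) :
    A y -> 0 <= b -> b <= b' -> b' <= 1 -> nbhs y N0 ->
    (forall z t, N0 z -> A z -> b <= t <= b' -> U (H (z, t))) ->
    (forall e, U (p e) -> is_lift U id (s e) /\ s e (p e) = e) ->
  tube y b -> tube y b'.
Proof.
move=> Ay b0 bb' b'1 nN0 N0U ls [N [h [nN lh hy]]].
have Ny := nbhs_singleton nN; have N0y := nbhs_singleton nN0.
have Ib : I b b by rewrite /= b0 lexx.
have phb : p (h (y, b)) = H (y, b) by rewrite lh.2.
have Uhb : U (p (h (y, b))) by rewrite phb; apply: N0U; rewrite ?lexx.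
have [[cs ps] sh] := ls _ Uhb.
set A' := N `&` N0 `&` A.
have A'y : A' y by [].
have bI1 : I 1 b by rewrite /= b0 (le_trans bb').
have cHb : {within A, continuous (fun z => H (z, b))} by exact: within_slice cH bI1.
have l1 : is_lift A' (fun z => H (z, b)) (fun z => h (z, b)).
  split; last by move=> z [[Nz _] Az]; apply: lh.2.
  have := within_slice lh.1 Ib; apply: continuous_subspaceW.
  by move=> z [[]].
have l2 : is_lift A' (fun z => H (z, b)) (fun z => s (h (y, b)) (H (z, b))).
  split; last by move=> z [[_ N0z] Az]; rewrite ps//; apply: N0U; rewrite ?lexx.
  apply: (@within_comp _ _ _ A' U) => //.
    by apply: continuous_subspaceW cHb => z [].
  by move=> z [[_ N0z] Az]; apply: N0U; rewrite ?lexx.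
have n12 := is_lift_eq_near l1 l2 A'y.
(* Shrink to where the old lift at time [b] already lies on that section, so that the two pieces of
   [h'] fit together. *)
pose N1 := N `&` N0 `&` [set z | A' z -> h (z, b) = s (h (y, b)) (H (z, b))].
have nN1 : nbhs y N1.
  apply: filterI; first exact: filterI.
  by apply: filterS n12 => z /[apply] /iffRL; apply; rewrite -phb sh.
pose h' (zt : T * R) := if zt.2 <= b then h zt else s (h (y, b)) (H zt).
exists N1, h'; split=> //; last by rewrite /h' /= b0.
split; last first.
  move=> [z t] [/= [[[Nz N0z] _] Az] /andP[t0 tb']]; rewrite /h' /=.
  case: leP => tb; first by apply: lh.2; split=> //=; rewrite t0.
  by rewrite ps//; apply: N0U => //; rewrite ltW.
apply/within_continuousP => -[z t] V [/= [[[Nz N0z] Ez] Az] /andP[t0 tb']] nV.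
have hb : h (z, b) = s (h (y, b)) (H (z, b)) by apply: Ez.
have bt_h : t <= b -> h' (z, t) = h (z, t) by rewrite /h' /= => ->.
have tb_s : b <= t -> h' (z, t) = s (h (y, b)) (H (z, t)).
  by rewrite le_eqVlt /h' /= => /predU1P[<-|/lt_geF ->//]; rewrite lexx.
(* Continuity is checked on the two closed halves [w.2 <= b] and [b <= w.2] separately; a half that
   does not contain [t] imposes nothing near [(z, t)]. *)
have near1 : \forall w \near (z, t), ((N1 `&` A) `*` I b') w -> w.2 <= b -> V (h w).
  have [tb|bt] := leP t b; last first.
    exists (setT, [set u | b < u]) => /=; last first.
      by move=> [w u] [_ /= bu] _; rewrite leNgt bu.
    by split; [exact: filterT|exact: lt_nbhsr].
  rewrite bt_h// in nV; have := lh.1 => /within_continuousP/(_ (z, t) V).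
  have NAzt : ((N `&` A) `*` I b) (z, t) by split=> //=; rewrite t0.
  move=> /(_ NAzt nV); apply: filterS => -[w u] /= Vw [[[[Nw _] _] Aw] /andP[u0 _]] ub.
  by apply: Vw; split=> //=; rewrite u0.
have near2 : \forall w \near (z, t), ((N1 `&` A) `*` I b') w -> b <= w.2 ->
    V (s (h (y, b)) (H w)).
  have [bt|tb] := leP b t; last first.
    exists (setT, [set u | u < b]) => /=; last first.
      by move=> [w u] [_ /= bu] _; rewrite leNgt bu.
    by split; [exact: filterT|exact: lt_nbhsl].
  rewrite tb_s// in nV.
  have UH : U (H (z, t)) by apply: N0U => //; rewrite bt.
  move/within_continuousP : (cs) => /(_ (H (z, t)) V UH nV) nV'.
  have It : (A `*` I 1) (z, t) by split=> //=; rewrite t0 (le_trans tb').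
  move/within_continuousP : (cH) => /(_ (z, t) _ It nV').
  apply: filterS => -[w u] /= Vw [[[[Nw N0w] _] Aw] /andP[u0 ub']] bu.
  apply: Vw; first by split=> //=; rewrite u0 (le_trans ub').
  by apply: N0U => //; rewrite bu.
apply: filterS (filterI near1 near2) => -[w u] [V1 V2] NAw.
rewrite /h' /=; case: leP => ub; first exact: V1.
by apply: V2 => //; exact: ltW.
Qed.

Local Lemma tube_le y b b' : b' <= b -> tube y b -> tube y b'.
Proof.
move=> b'b [N [h [nN lh hy]]]; exists N, h; split=> //.
apply: is_liftS lh => -[z t] [/= Nz /andP[t0 tb]]; split=> //=.
by rewrite t0 (le_trans tb).
Qed.

(** A tube can be extended or cut off at will as long as the time stays in an interval that
    [H (y, _)] sends into one evenly covered set. *)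
Local Lemma tube_near y t : A y -> I 1 t ->
  \forall b \near t, I 1 b -> (tube y b <-> tube y t).
Proof.
move=> Ay It; have [U [s [[oU Ut] ls]]] := local_section_through C (H (y, t)).
have nU : nbhs (H (y, t)) U by exact: open_nbhs_nbhs.
move/within_continuousP : (cH) => /(_ (y, t) U (conj Ay It) nU).
move=> [[P Q] /= [nP nQ] PQ].
have key b b' : Q b -> Q b' ->
    (forall u, Num.min b b' <= u <= Num.max b b' -> Q u) ->
    I 1 b -> I 1 b' -> tube y b -> tube y b'.
  move=> Qb Qb' QI /andP[b0 b1] /andP[b'0 b'1].
  have [bb'|b'b] := leP b b'; last by apply: tube_le; exact: ltW.
  apply: (tube_extend Ay b0 bb' b'1 nP _ ls) => z u Pz Az ub.
  apply: (PQ (z, u)); split=> //=.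
    by apply: QI; rewrite (min_idPl bb') (max_idPr bb').
  by case/andP: ub => bu ub; rewrite (le_trans b0)// (le_trans ub).
have [d /= d0 dQ] : nbhs_ball t Q by rewrite nbhs_ballE.
have Qt u b b' : ball t d b -> ball t d b' -> Num.min b b' <= u <= Num.max b b' -> Q u.
  rewrite /ball /= => tb tb' ub; apply: dQ; rewrite /ball /=.
  move: tb tb' ub; rewrite !ltr_distl => /andP[? ?] /andP[? ?].
  rewrite ge_min le_max => /andP[/orP[]? /orP[]?]; lra.
exists d => //= b tb Ib; have tt := ballxx t d0.
have Qb := dQ _ tb; have Qt' := dQ _ tt.
by split; apply: key => // u; exact: Qt.
Qed.

(** By connectedness of [[0, 1]] every point of [A] has a tube of full height; the values of the
    tubes at time 1 are then glued. *)
Lemma homotopy_lifting :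
  exists s1 : T -> E, is_lift A (fun y => H (y, 1)) s1.
Proof.
have c01 : connected (I 1).
  have -> : I 1 = `[0, 1]%classic :> set R.
    by apply/seteqP; split=> x /=; rewrite in_itv.
  exact: segment_connected.
have I0 : I 1 0 by rewrite /= lexx ler01.
have I1 : I 1 1 by rewrite /= lexx ler01.
have tube1 y : A y -> tube y 1.
  move=> Ay; apply: (connected_locally_constant c01 _ I0 I1).
    by move=> t It; exact: tube_near.
  exists setT, (fun zt => s0 zt.1); split=> //; first exact: filterT.
  have t0 t : I 0 t -> t = 0 by rewrite /= -eq_le => /eqP.
  split; last by move=> [z t] [/= [_ Az] /t0 ->]; rewrite ls0.2.
  apply: (@within_comp _ _ _ _ A) ls0.1 _; last by move=> z [[]].
  by apply: continuous_within; exact: fst_continuous.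
(* The value at [y] is the endpoint of the lift of the path [H (y, _)] from [s0 y]. This lift is
   unique, so the tubes agree. *)
pose Q y e := exists g : R -> E,
  [/\ is_lift (I 1) (fun t => H (y, t)) g, g 0 = s0 y & g 1 = e].
have [||y Ay|s1 cs1 Qs1] := @glue_continuous _ _ A Q.
- by move=> y; have [e _] := fiber_nonempty C (H (y, 0)).
- move=> y u v Ay [g [lg g0 <-]] [g' [lg' g'0 <-]].
  by apply: (is_lift_eq lg lg' c01 I0) => //; rewrite g0.
- have [N [h [nN lh hy]]] := tube1 y Ay.
  exists (fun z => h (z, 1)).
  have NAy : (N `&` A) y by split=> //; exact: nbhs_singleton.
  split.
    move=> V nV; have := within_slice lh.1 I1 => /within_continuousP/(_ _ _ NAy nV) nV'.
    by apply: filterS (filterI nN nV') => z [Nz /[swap] Az]; apply.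
  have ls0' : is_lift (N `&` A) (fun z => H (z, 0)) s0 by apply: is_liftS ls0 => z [].
  have lh0 : is_lift (N `&` A) (fun z => H (z, 0)) (fun z => h (z, 0)).
    by split; [exact: within_slice lh.1 I0|move=> z Nz; apply: lh.2].
  apply: filterS (filterI nN (is_lift_eq_near lh0 ls0' NAy)) => z [Nz H0] Az.
  exists (fun t => h (z, t)); split=> //; last by apply/H0.
  split; last by move=> t It; apply: lh.2.
  apply: (@within_comp _ _ _ _ ((N `&` A) `*` I 1) (fun t => (z, t)) h) => //.
    by apply: continuous_within; apply: pair_continuous => x; [exact: cvg_cst|exact: cvg_id].
  exact: lh.1.
- exists s1; split=> // y /Qs1[g [lg _ <-]]; exact: lg.2.
Qed.

End HomotopyLifting.

Lemma lifts_dense {B : topologicalType} (C : twofold_covering B)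
    {T : topologicalType} (Y Z : set T) (f : T -> B) (g h : T -> Defs.total C) :
    Z `<=` Y -> locally_connected_in Y Z -> is_lift Y f g -> is_lift Y f h ->
  (forall z, Z z -> g z = h z) -> forall y, Y y -> g y = h y.
Proof.
move=> ZY lcd lg lh gh y Yy.
have [W [_ WV [z [Wz Zz]] _]] := lcd _ _ Yy (is_lift_eq_near lg lh Yy).
by apply/(WV _ Wz (ZY _ Zz)); exact: gh.
Qed.

(** For [i := SO_incl] this is convertible to [restricts_to], which lets the general lemmas below
    apply to spin structures directly. *)
Definition is_restriction {B B' : topologicalType} (i : B' -> B)
    (E : twofold_covering B) (E' : twofold_covering B') : Prop :=
  exists u : Defs.total E' -> Defs.total E,
    [/\ continuous u,
        (forall e, cov (u e) = i (cov e)) &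
        (forall q e, cov e = i q -> exists! e', cov e' = q /\ u e' = e)].

(** * Restriction of coverings along an open embedding: uniqueness *)

Section OpenEmbedding.
Context {B B' : topologicalType} (i : B' -> B).
Hypothesis i_cont : continuous i.
Hypothesis i_inj : injective i.
Hypothesis i_open : forall W, open W -> open (i @` W).

Lemma open_embedding_nbhs x V : nbhs x V -> nbhs (i x) (i @` V).
Proof.
rewrite nbhsE => -[W [oW Wx] WV]; rewrite nbhsE; exists (i @` W).
  by split; [exact: i_open|exists x].
exact: image_subset.
Qed.

Lemma open_embedding_factor {T : topologicalType} (A : set T) (f : T -> B) :
    (T -> inhabited B') -> {within A, continuous f} ->
    (forall y, A y -> range i (f y)) ->
  exists2 f' : T -> B', {within A, continuous f'} & forall y, A y -> i (f' y) = f y.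
Proof.
move=> iB' cf fi.
have [f' if'] : {f' : T -> B' & forall y, A y -> i (f' y) = f y}.
  apply: (@choice _ _ (fun y x => A y -> i x = f y)) => y.
  have [Ay|nAy] := pselect (A y); first by have [x _ ix] := fi y Ay; exists x.
  by have [x] := iB' y; exists x.
exists f' => //; apply/within_continuousP => y V Ay nV.
have := open_embedding_nbhs nV; rewrite if'// => nfV.
move/within_continuousP : cf => /(_ y _ Ay nfV); apply: filterS => z H Az.
by have [x Vx] := H Az; rewrite -if'// => /i_inj <-.
Qed.

(** The universal property of the pull-back. The point of [E'] over [f y] is forced; it varies
    continuously because a local section of [E'] followed by [u] is a lift that agrees with [h] at
    [y], hence nearby. *)
Lemma restriction_lift (E : twofold_covering B) (E' : twofold_covering B')
    (u : Defs.total E' -> Defs.total E) :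
    continuous u -> (forall e, cov (u e) = i (cov e)) ->
    (forall q e, cov e = i q -> exists! e', cov e' = q /\ u e' = e) ->
  forall (T : topologicalType) (A : set T) (f : T -> B') (h : T -> Defs.total E),
    {within A, continuous f} -> is_lift A (i \o f) h ->
  exists2 h' : T -> Defs.total E', is_lift A f h' & forall y, A y -> u (h' y) = h y.
Proof.
move=> cu pu eu T A f h cf lh.
pose Q y e' := @cov _ E' e' = f y /\ u e' = h y.
have [||y Ay|h' ch' Qh'] := @glue_continuous _ _ A Q.
- by move=> y; have [e _] := fiber_nonempty E' (f y).
- move=> y e1 e2 Ay Q1 Q2.
  have [e [_ He]] := eu _ _ (lh.2 y Ay).
  by rewrite -(He _ Q1) -(He _ Q2).
- have [e [[pe ue] _]] := eu _ _ (lh.2 y Ay).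
  have [U [s [[oU Uy] ls]]] := local_section_through E' (f y).
  have Ue : U (cov e) by rewrite pe.
  have [[cs ps] se] := ls _ Ue; rewrite pe in se.
  have nU : nbhs (f y) U by exact: open_nbhs_nbhs.
  move/within_continuousP : (cf) => /(_ y U Ay nU) nfU.
  pose A1 := A `&` f @^-1` U.
  have lsf : is_lift A1 f (s e \o f).
    split; last by move=> z [Az Uz] /=; rewrite ps.
    apply: (@within_comp _ _ _ _ U) => //; last by move=> z [].
    by apply: continuous_subspaceW cf => z [].
  have lusf : is_lift A1 (i \o f) (u \o (s e \o f)).
    split; first exact: (within_compl lsf.1 cu).
    by move=> z A1z /=; rewrite pu; congr i; exact: lsf.2.
  have A1y : A1 y by [].
  have lh1 : is_lift A1 (i \o f) h by apply: is_liftS lh => z [].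
  exists (s e \o f); split.
    move=> V nV; have := lsf.1 => /within_continuousP/(_ y V A1y nV) nV'.
    by apply: filterS (filterI nfU nV') => z [H1 H2] Az; apply: H2; split=> //; exact: H1.
  have := is_lift_eq_near lusf lh1 A1y.
  move=> nE; apply: filterS (filterI nfU nE) => z [H1 H2] Az.
  have A1z : A1 z by split=> //; exact: H1.
  split; first by rewrite (lsf.2 z).
  by apply/(H2 A1z); rewrite /= se ue.
- exists h'; last by move=> y /Qh'[].
  by split=> // y /Qh'[].
Qed.

Lemma within_setT {T U : topologicalType} (f : T -> U) :
  {within setT, continuous f} -> continuous f.
Proof.
move=> /within_continuousP cf x V nV.
by have := cf x V I nV; apply: filterS => y; apply.
Qed.

(** [restriction_lift], applied to the projections of [E1] and [E2], gives maps in both directions;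
    uniqueness of points in the pull-back makes them mutually inverse. *)
Lemma is_restriction_iso (E : twofold_covering B) (E1 E2 : twofold_covering B') :
  is_restriction i E E1 -> is_restriction i E E2 -> covering_iso E1 E2.
Proof.
move=> [u1 [cu1 pu1 eu1]] [u2 [cu2 pu2 eu2]].
have mk F1 F2 (v1 : Defs.total F1 -> Defs.total E) (v2 : Defs.total F2 -> Defs.total E) :
    continuous v1 -> (forall e, cov (v1 e) = i (cov e)) ->
    continuous v2 -> (forall e, cov (v2 e) = i (cov e)) ->
    (forall q e, cov e = i q -> exists! e', cov e' = q /\ v2 e' = e) ->
    exists h : Defs.total F1 -> Defs.total F2, [/\ continuous h,
      (forall e, cov (h e) = cov e) & forall e, v2 (h e) = v1 e].
  move=> cv1 pv1 cv2 pv2 ev2.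
  have [||h [ch ph] vh] :=
      restriction_lift cv2 pv2 ev2 (A := setT) (f := @cov _ F1) (h := v1).
  - exact: continuous_within (@cov_continuous _ _).
  - by split; [exact: continuous_within|move=> y _; exact: pv1].
  by exists h; split; [exact: within_setT|move=> e; exact: ph|move=> e; exact: vh].
have [h [ch ph vh]] := mk _ _ _ _ cu1 pu1 cu2 pu2 eu2.
have [k [ck pk vk]] := mk _ _ _ _ cu2 pu2 cu1 pu1 eu1.
exists h, k; split=> // e.
  have [e' [_ He]] := eu1 (cov e) (u1 e) (pu1 e).
  by rewrite -[RHS](He e)// -(He (k (h e)))// pk ph vk vh.
have [e' [_ He]] := eu2 (cov e) (u2 e) (pu2 e).
by rewrite -[RHS](He e)// -(He (h (k e)))// ph pk vh vk.
Qed.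

Lemma is_restriction_isol (E1 E2 : twofold_covering B) (E' : twofold_covering B') :
  covering_iso E1 E2 -> is_restriction i E1 E' -> is_restriction i E2 E'.
Proof.
move=> [f [h [cf ch fK hK pf]]] [u [cu pu eu]]; exists (f \o u); split.
- by move=> x; apply: continuous_comp; [exact: cu|exact: cf].
- by move=> e /=; rewrite pf.
- move=> q e pe; have [|e' [[pe' ue'] He']] := eu q (h e).
    by rewrite -pf hK.
  exists e'; split; first by rewrite /= ue' hK.
  by move=> e'' [pe'' /= fue]; apply: He'; rewrite -fue fK.
Qed.

Lemma is_restriction_isor (E : twofold_covering B) (E1 E2 : twofold_covering B') :
  covering_iso E1 E2 -> is_restriction i E E1 -> is_restriction i E E2.
Proof.
move=> [f [h [cf ch fK hK pf]]] [u [cu pu eu]]; exists (u \o h).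
have ph e : cov (h e) = cov e by rewrite -pf hK.
split.
- by move=> x; apply: continuous_comp; [exact: ch|exact: cu].
- by move=> e /=; rewrite pu ph.
- move=> q e pe; have [e' [[pe' ue'] He']] := eu q e pe.
  exists (f e'); split; first by rewrite /= pf fK.
  by move=> e'' [pe'' /= uhe]; rewrite (He' (h e'')) ?hK// ph.
Qed.

Hypothesis i_dense : locally_connected_in setT (range i).

Lemma dense_inhabited : B -> inhabited B'.
Proof.
move=> b; have [W [_ _ [_ [_ [x _ _]]] _]] := i_dense (y := b) I filterT.
by constructor.
Qed.

(** The property of the base passes to the total space, because a local section carries small traces
    in the base to small traces on its sheet. *)
Lemma cov_locally_connected_in (E : twofold_covering B) :
  locally_connected_in setT (@cov _ E @^-1` range i).
Proof.
move=> e V _ nV; have [U [s [oU cs ps se]]] := local_section e.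
have nU := open_nbhs_nbhs oU.
have nsV : nbhs (cov e) (fun b => U b -> V (s b)).
  by move/within_continuousP : (cs) => /(_ (cov e) V (nbhs_singleton nU)); rewrite se; exact.
have [W [nW WV [b [Wb ib]] cW]] := i_dense (y := cov e) I (filterI nU nsV).
have WU b' : W b' -> U b' by move=> /WV[].
exists [set e' | W (cov e') /\ s (cov e') = e']; split.
- have np : nbhs e (@cov _ E @^-1` W) by exact: cov_continuous.
  have lsp : is_lift (@cov _ E @^-1` W) (@cov _ E) (s \o @cov _ E).
    split; last by move=> e' We' /=; rewrite ps//; exact: WU.
    apply: (@within_comp _ _ _ _ U) => //; last by move=> e' /WU.
    by apply: continuous_within; exact: cov_continuous.
  have lid : is_lift (@cov _ E @^-1` W) (@cov _ E) (@id (Defs.total E)).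
    by split=> //; exact: within_id.
  have := is_lift_eq_near lsp lid (nbhs_singleton np).
  by move=> nE; apply: filterS (filterI np nE) => e' [We' H]; split=> //; exact/H.
- by move=> e' [/WV[Ue' Ve'] <-]; exact: Ve'.
- exists (s b); have pb : cov (s b) = b by apply: ps; exact: WU.
  by split; rewrite /preimage /= pb.
- have -> : [set e' | W (cov e') /\ s (cov e') = e'] `&` @cov _ E @^-1` range i =
      s @` (W `&` range i).
    apply/seteqP; split=> [e' [[We' <-] ie']|_ [b' [Wb' ib'] <-]].
      by exists (cov e') => //; split=> //; move: ie'; rewrite /preimage /= ps//; exact: WU.
    have pb' : cov (s b') = b' by apply: ps; exact: WU.
    by split; rewrite /preimage /= ?pb'.
  apply: connected_continuous_connected => //.
  by apply: continuous_subspaceW cs => b' [/WU].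
Qed.

(** The parts of [E1] and [E2] over the range of [i] are both identified with [E']. The resulting
    map between these dense parts extends by [extend_lift], and the composites of the two extensions
    are identities by [lifts_dense]. *)
Lemma is_restriction_inj (E1 E2 : twofold_covering B) (E' : twofold_covering B') :
  is_restriction i E1 E' -> is_restriction i E2 E' -> covering_iso E1 E2.
Proof.
move=> [u1 [cu1 pu1 eu1]] [u2 [cu2 pu2 eu2]].
have mk F1 F2 (v1 : Defs.total E' -> Defs.total F1) (v2 : Defs.total E' -> Defs.total F2) :
    continuous v1 -> (forall e, cov (v1 e) = i (cov e)) ->
    (forall q e, cov e = i q -> exists! e', cov e' = q /\ v1 e' = e) ->
    continuous v2 -> (forall e, cov (v2 e) = i (cov e)) ->
    exists h : Defs.total F1 -> Defs.total F2, [/\ continuous h,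
      (forall e, cov (h e) = cov e) & forall e', h (v1 e') = v2 e'].
  move=> cv1 pv1 ev1 cv2 pv2.
  set Z := @cov _ F1 @^-1` range i.
  have [|||f' cf' if'] := @open_embedding_factor _ Z (@cov _ F1).
  - by move=> e; exact: dense_inhabited (cov e).
  - by apply: continuous_within; exact: cov_continuous.
  - by [].
  have [||w lw vw] := restriction_lift cv1 pv1 ev1 (A := Z) (f := f') (h := id).
  - exact: cf'.
  - by split; [exact: within_id|move=> z Zz /=; rewrite if'].
  have [||||h [ch ph] hw] := @extend_lift _ F2 _ setT Z (@cov _ F1) (v2 \o w).
  - by apply: continuous_within; exact: cov_continuous.
  - by [].
  - exact: cov_locally_connected_in.
  - split; first exact: (within_compl lw.1 cv2).
    by move=> z Zz /=; rewrite pv2 lw.2// if'.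
  exists h; split; [exact: within_setT|by move=> e; exact: ph|move=> e'].
  have Ze' : Z (v1 e') by rewrite /Z /preimage /= pv1; exists (cov e').
  rewrite hw//=; congr v2.
  have [e'' [_ He]] := ev1 (cov e') (v1 e') (pv1 e').
  rewrite -[RHS](He e')// -(He (w (v1 e')))//; split; last exact: vw.
  by apply: i_inj; rewrite lw.2// if'// pv1.
have [h [ch ph vh]] := mk _ _ _ _ cu1 pu1 eu1 cu2 pu2.
have [k [ck pk vk]] := mk _ _ _ _ cu2 pu2 eu2 cu1 pu1.
have idl F (g : Defs.total F -> Defs.total F) v : continuous g ->
    (forall e, cov (g e) = cov e) ->
    (forall q e, @cov _ F e = i q -> exists! e', @cov _ E' e' = q /\ v e' = e) ->
    (forall e', g (v e') = v e') -> forall e, g e = e.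
  move=> cg pg ev gv e.
  apply: (@lifts_dense _ F _ setT _ _ g id _ (@cov_locally_connected_in F)) => //.
  - by split; [exact: continuous_within|move=> y _; exact: pg].
  - by split; [exact: within_id|].
  - by move=> z [q _ iq]; have [|e' [[_ <-] _]] := ev q z.
exists h, k; split=> //.
- apply: (idl _ (k \o h) u1) => //=.
  + by move=> x; apply: continuous_comp; [exact: ch|exact: ck].
  + by move=> e; rewrite pk ph.
  + by move=> e'; rewrite vh vk.
- apply: (idl _ (h \o k) u2) => //=.
  + by move=> x; apply: continuous_comp; [exact: ck|exact: ch].
  + by move=> e; rewrite ph pk.
  + by move=> e'; rewrite vk vh.
Qed.

End OpenEmbedding.

Lemma within_set_type {T U : topologicalType} (A : set T) (D : set U)
    (f : T -> set_type D) :
  {within A, continuous (fun x => set_val (f x))} -> {within A, continuous f}.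
Proof.
move=> /within_continuousP cf; apply/within_continuousP => x V Ax.
rewrite nbhsE => -[W [[G oG <-] /= Gfx] WV].
have := cf x G Ax (open_nbhs_nbhs (conj oG Gfx)).
by apply: filterS => y H Ay; apply: WV; exact: H.
Qed.

(** * Pull-back of a twofold covering *)

Section Pullback.
Context {B B' : topologicalType} (i : B' -> B).
Hypothesis i_cont : continuous i.
Variable E : twofold_covering B.

Local Notation pb := (set_type [set xe : B' * Defs.total E | i xe.1 = cov xe.2]).
Local Definition pb_cov (w : pb) : B' := (set_val w).1.
Local Definition pb_map (w : pb) : Defs.total E := (set_val w).2.

Local Lemma pb_cov_continuous : continuous pb_cov.
Proof.
move=> w; apply: (@continuous_comp _ _ _ (@set_val _ _) fst).
  exact: initial_continuous.
exact: fst_continuous.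
Qed.

Local Lemma pb_map_continuous : continuous pb_map.
Proof.
move=> w; apply: (@continuous_comp _ _ _ (@set_val _ _) snd).
  exact: initial_continuous.
exact: snd_continuous.
Qed.

Local Lemma pb_mapE w : cov (pb_map w) = i (pb_cov w).
Proof. by have := set_valP w. Qed.

Local Lemma pb_eq w w' : pb_cov w = pb_cov w' -> pb_map w = pb_map w' -> w = w'.
Proof.
move=> c m; apply: val_inj; rewrite /= [LHS]surjective_pairing.
by rewrite [RHS]surjective_pairing; congr pair.
Qed.

Local Lemma pb_ex x e : cov e = i x -> exists w, pb_cov w = x /\ pb_map w = e.
Proof.
move=> /esym xe.
by exists (SigSub (mem_set (xe : [set xe : B' * Defs.total E | i xe.1 = cov xe.2] (x, e)))).
Qed.

Local Lemma pb_locally_trivial x :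
  exists2 U, open_nbhs x U & trivial_over pb_cov U.
Proof.
have [U [oU Ux] [s [t [cs ct st ts]]]] := cov_locally_trivial E (i x).
exists (i @^-1` U); first by split=> //; apply: open_comp => // y _; exact: i_cont.
have [s' s'E] : {s' : B' * bool -> pb &
    forall xb, pb_cov (s' xb) = xb.1 /\ (U (i xb.1) -> pb_map (s' xb) = s (i xb.1, xb.2))}.
  apply: (@choice _ _ (fun xb w => pb_cov w = xb.1 /\
    (U (i xb.1) -> pb_map w = s (i xb.1, xb.2)))) => -[y b] /=.
  have [Uy|nUy] := pselect (U (i y)).
    have [|w [w1 w2]] := @pb_ex y (s (i y, b)); first by have [] := st _ b Uy.
    by exists w.
  have [e ey] := fiber_nonempty E (i y).
  by have [w [w1 w2]] := pb_ex ey; exists w.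
exists s', (t \o pb_map); split.
- apply: within_set_type.
  have cs' : {within i @^-1` U `*` setT, continuous (fun yb => (yb.1, s (i yb.1, yb.2)))}.
    apply/within_continuousP => -[y b] V [/= Uy _] [[V1 V2] /= [nV1 nV2] V12].
    move/within_continuousP : cs => /(_ (i y, b) V2 (conj Uy I) nV2).
    move=> [[W1 W2] /= [nW1 nW2] W12].
    exists (V1 `&` i @^-1` W1, W2) => /=.
      by split=> //; apply: filterI => //; exact: i_cont.
    move=> [z c] [/= [V1z W1z] W2c] [Uz _]; apply: (V12 (z, _)); split=> //=.
    by apply: (W12 (i z, c)).
  apply/within_continuousP => yb V [Uy _].
  have E1 zb : U (i zb.1) -> set_val (s' zb) = (zb.1, s (i zb.1, zb.2)).
    move=> Uz; have [c m] := s'E zb.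
    by rewrite [LHS]surjective_pairing -/(pb_cov _) -/(pb_map _) c m.
  rewrite E1// => nV; move/within_continuousP : cs' => /(_ yb V (conj Uy I) nV).
  by apply: filterS => zb H [Uz _]; rewrite E1//; exact: H.
- apply: (@within_comp _ _ _ _ (@cov _ E @^-1` U)) ct _.
    by apply: continuous_within; exact: pb_map_continuous.
  by move=> w; rewrite /preimage /= pb_mapE.
- move=> y b Uy; have [c m] := s'E (y, b); split=> //=.
  by rewrite m//=; have [] := st _ b Uy.
- move=> w Uw; have [c m] := s'E (pb_cov w, t (pb_map w)).
  apply: pb_eq => //=; rewrite m//= -pb_mapE ts// pb_mapE; exact: Uw.
Qed.

Lemma is_restriction_exists : exists E', is_restriction i E E'.
Proof.
exists (TwofoldCovering pb_cov_continuous pb_locally_trivial), pb_map; split.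
- exact: pb_map_continuous.
- exact: pb_mapE.
- move=> x e xe; have [w [wx we]] := pb_ex xe; exists w; split=> // w' [w'x w'e].
  by apply: pb_eq; rewrite /= ?we ?w'e// wx.
Qed.

End Pullback.

(** * Extension of a covering by germs of local sections *)

Section Extension.
Context {B B' : topologicalType} (i : B' -> B).
Hypothesis i_cont : continuous i.
Hypothesis i_inj : injective i.
Hypothesis i_open : forall W, open W -> open (i @` W).
Hypothesis i_dense : locally_connected_in setT (range i).
Variables (E : twofold_covering B') (U : B -> set B) (s : B -> B' -> Defs.total E).
Hypothesis nU : forall b, nbhs b (U b).
Hypothesis ls : forall b, is_lift (i @^-1` U b) id (s b).

(** [P] holds at all points of [B'] that [i] sends near [b]: the trace on [B'] of the neighbourhood
    filter of [b]. *)
Local Definition ev (b : B) (P : set B') := \forall z \near b, forall x, i x = z -> P x.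

Local Lemma ev_ex b P : ev b P -> exists x, P x.
Proof.
move=> eP; have [W [nW WP [y [Wb [x _ xb]]] _]] := i_dense (y := b) I eP.
by exists x; apply: (WP _ Wb).
Qed.

Local Lemma evS2 b P Q S : (forall x, P x -> Q x -> S x) -> ev b P -> ev b Q -> ev b S.
Proof.
rewrite /ev => PQS eP eQ; apply: filterS (filterI eP eQ) => z [Pz Qz] x ix.
by apply: PQS; [exact: Pz|exact: Qz].
Qed.

Local Lemma ev_point x P : ev (i x) P -> P x.
Proof. by rewrite /ev => /nbhs_singleton; apply. Qed.

Local Lemma ev_open b P : ev b P ->
  exists V, [/\ open V, V b & forall z, V z -> ev z P].
Proof.
move=> eP; exists (interior [set z | forall x, i x = z -> P x]).
split; first exact: open_interior.
  exact: eP.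
by move=> z Vz; exact: Vz.
Qed.

Local Definition sgn (j : bool) (e : Defs.total E) := if j then e else flip e.

Local Lemma cov_sgn j e : cov (sgn j e) = cov e.
Proof. by case: j; rewrite //= cov_flip. Qed.

Local Lemma sgn_inj j j' e : sgn j e = sgn j' e -> j = j'.
Proof. by case: j j' => [] [] //= => [/esym|] /flip_neq. Qed.

Local Lemma is_lift_sgn {T : topologicalType} (A : set T) f g j :
  is_lift A f g -> is_lift A f (sgn j \o g).
Proof. by move=> lg; case: j => //; exact: is_lift_flip. Qed.

Local Notation local_lift V sg := (is_lift (C := E) (i @^-1` V) id sg).

(** Two sections over a connected trace coincide or differ by the flip, so there are exactly two
    germs at [b]. *)
Local Lemma local_lift_comparable b V sg ta :
    nbhs b V -> local_lift V sg -> local_lift V ta ->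
  exists j, ev b (fun x => sg x = sgn j (ta x)).
Proof.
move=> nV lsg lta.
have iB : B -> inhabited B' by exact: dense_inhabited i_dense.
have [W [nW WV [y [Wb [x0 _ xy]]] cW]] := i_dense (y := b) I nV.
rewrite -{}xy {y} in Wb.
have [r cr ri] := open_embedding_factor i_inj i_open (A := W `&` range i) iB
  (@within_id _ _) (fun y Wy => Wy.2).
have cW' : connected (i @^-1` W).
  have -> : i @^-1` W = r @` (W `&` range i).
    apply/seteqP; split=> [x Wx|_ [y [Wy iy] <-]]; last by rewrite /preimage /= ri.
    have Wix : (W `&` range i) (i x) by split=> //; exists x.
    by exists (i x) => //; apply: i_inj; rewrite ri.
  exact: connected_continuous_connected.
have [j jE] : exists j, sg x0 = sgn j (ta x0).
  have ct : cov (sg x0) = cov (ta x0) by rewrite lsg.2 ?lta.2//; exact: WV.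
  by have [->|->] := fiber_flip ct; [exists true|exists false].
exists j; rewrite /ev; apply: filterS nW => z Wz x iz.
have WV' : i @^-1` W `<=` i @^-1` V by move=> y /WV.
apply: (is_lift_eq (is_liftS WV' lsg) (is_liftS WV' (is_lift_sgn j lta)) cW' _ jE).
  by [].
by rewrite /preimage /= iz.
Qed.

(* A point over [b] is a germ at [b] of a section defined on the preimage of a *)
(* neighbourhood of [b]; [(b, true)] and [(b, false)] stand for the germs of   *)
(* [s b] and of its flip.                                                      *)
Local Definition ext_total : Type := (B * bool)%type.

Local Definition germ (sg : B' -> Defs.total E) (e : ext_total) :=
  ev e.1 (fun x => sg x = sgn e.2 (s e.1 x)).

Local Lemma germ_ex b V sg : nbhs b V -> local_lift V sg -> exists j, germ sg (b, j).
Proof.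
move=> nV lsg; have [|||j jE] := @local_lift_comparable b (V `&` U b) sg (s b); last by exists j.
- exact: filterI.
- by apply: is_liftS lsg => x [].
- by apply: is_liftS (ls b) => x [].
Qed.

Local Lemma germ_uniq sg b j j' : germ sg (b, j) -> germ sg (b, j') -> j = j'.
Proof.
move=> g g'; have [x] := ev_ex (evS2 (fun x => @conj _ _) g g').
by move=> [/= -> /sgn_inj].
Qed.

Local Lemma germ_eq sg ta e : germ sg e -> germ ta e -> ev e.1 (fun x => sg x = ta x).
Proof. by apply: evS2 => x -> ->. Qed.

Local Lemma eq_germ sg ta e : ev e.1 (fun x => sg x = ta x) -> germ sg e -> germ ta e.
Proof. by apply: evS2 => x ->. Qed.

Local Lemma germ_self e : germ (sgn e.2 \o s e.1) e.
Proof. by rewrite /germ /ev; apply: filterS filterT => z _ x. Qed.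

(** The topology of a space of germs: the germs of one section at the points of an open set form a
    basic open set. *)
Local Definition ext_open (O : set ext_total) := forall e, O e ->
  exists V sg, [/\ open V, V e.1, local_lift V sg, germ sg e &
                  forall e', V e'.1 -> germ sg e' -> O e'].

Local Lemma ext_openT : ext_open setT.
Proof.
move=> e _; exists (interior (U e.1)), (sgn e.2 \o s e.1); split=> //.
- exact: open_interior.
- exact: nU.
- apply: is_lift_sgn; apply: is_liftS (ls e.1) => x; exact: interior_subset.
- exact: germ_self.
Qed.

Local Lemma ext_openI : setI_closed ext_open.
Proof.
move=> O1 O2 o1 o2 e [/o1[V1 [s1 [oV1 Ve1 l1 g1 H1]]] /o2[V2 [s2 [oV2 Ve2 l2 g2 H2]]]].
have [V [oV Ve VE]] := ev_open (germ_eq g1 g2).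
exists (V1 `&` V2 `&` V), s1; split=> //.
- by apply: openI => //; exact: openI.
- by apply: is_liftS l1 => x [[]].
- move=> e' [[V1e' V2e'] Ve'] g; split; first exact: H1.
  by apply: H2 => //; apply: eq_germ g; exact: VE.
Qed.

Local Lemma ext_open_bigU (I : Type) (f : I -> set ext_total) :
  (forall k, ext_open (f k)) -> ext_open (\bigcup_k f k).
Proof.
move=> of_ e [k _ /of_[V [sg [oV Ve l g H]]]]; exists V, sg; split=> // e' Ve' ge'.
by exists k => //; exact: H.
Qed.

Local Definition ext_space : topologicalType :=
  HB.pack_for topologicalType ext_total (Choice.on (B * bool)%type)
    (@isOpenTopological.Build ext_total ext_open ext_openT ext_openI ext_open_bigU).

Local Lemma ext_openE (O : set ext_space) : open O = ext_open O.
Proof. by []. Qed.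

Local Lemma nbhs_germ (e : ext_space) V sg :
    open V -> V e.1 -> local_lift V sg -> germ sg e ->
  nbhs e [set e' : ext_space | V e'.1 /\ germ sg e'].
Proof.
move=> oV Ve lsg g; apply: open_nbhs_nbhs; split=> //; rewrite ext_openE => e' [Ve' ge'].
by exists V, sg; split.
Qed.

Local Definition ext_cov (e : ext_space) : B := e.1.

Local Lemma ext_cov_continuous : continuous ext_cov.
Proof.
move=> e V nV; have oI := @open_interior _ (V `&` U e.1).
have nVU : (V `&` U e.1)° e.1 by apply: filterI => //; exact: nU.
have := nbhs_germ oI nVU (_ : local_lift _ (sgn e.2 \o s e.1)) (germ_self e).
move=> H; apply: filterS (H _) => [e' [/interior_subset[]]//|].
by apply: is_lift_sgn; apply: is_liftS (ls e.1) => x /interior_subset[].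
Qed.

Local Lemma ext_locally_trivial b :
  exists2 V, open_nbhs b V & trivial_over ext_cov V.
Proof.
pose V := (U b)°.
have lV : local_lift V (s b) by apply: is_liftS (ls b) => x /interior_subset.
exists V; first by split; [exact: open_interior|exact: nU].
have [S SE] : {S : B * bool -> ext_space & forall c,
    (S c).1 = c.1 /\ (V c.1 -> germ (sgn c.2 \o s b) (S c))}.
  apply: (@choice _ _ (fun c (e : ext_space) =>
    e.1 = c.1 /\ (V c.1 -> germ (sgn c.2 \o s b) e))) => -[c j] /=.
  have [Vc|nVc] := pselect (V c); last by exists (c, true).
  have nVc : nbhs c V by apply: open_nbhs_nbhs; split=> //; exact: open_interior.
  by have [k kE] := germ_ex nVc (is_lift_sgn j lV); exists (c, k).
pose t (e : ext_space) := `[< germ (s b) e >].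
have tE (e : ext_space) : V e.1 -> exists2 j, germ (sgn j \o s b) e & t e = j.
  move=> Ve; have nVe : nbhs e.1 V by apply: open_nbhs_nbhs; split=> //; exact: open_interior.
  have [k kE] := germ_ex nVe lV.
  (* [k] is the sign of [s b] relative to [s e.1], and [e.2] that of the germ [e]; so [e] is the
     germ of [s b] itself if they agree and of its flip otherwise. *)
  exists (e.2 == k); last first.
    apply/asboolP/eqP => [g|ek]; last by rewrite -ek -surjective_pairing in kE.
    by apply: germ_uniq kE; rewrite -surjective_pairing.
  move: kE; rewrite /germ /ev /=; apply: filterS => z H x iz; rewrite /= H//.
  by case: (e.2) (k) => [] []; rewrite /= ?flipK.
have germ_t (e : ext_space) j : germ (sgn j \o s b) e -> t e = j.
  move=> g; apply/asboolP; case: j g => //= g g'.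
  have [x /= xE] := ev_ex (germ_eq g g'); exact: flip_neq xE.
exists S, t; split.
- apply/within_continuousP => -[c j] W [Vc _].
  rewrite nbhsE => -[W' []]; rewrite ext_openE => oW' W'S W'W.
  have [Sc gS] := SE (c, j); have {}gS := gS Vc.
  have [X [sg [oX Xe lsg gsg XW]]] := oW' _ W'S.
  have [Y [oY Yc YE]] := ev_open (germ_eq gS gsg).
  rewrite Sc /= in Yc Xe.
  exists (X `&` Y, [set j]) => /=.
    by split=> //; apply: open_nbhs_nbhs; split=> //; exact: openI.
  move=> [c' j'] [/= [Xc' Yc'] ->] [/= Vc' _].
  have [Sc' gS'] := SE (c', j); have {}gS' := gS' Vc'.
  apply: W'W; apply: XW; first by rewrite Sc'.
  by apply: eq_germ gS'; rewrite Sc'; exact: YE.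
- apply/within_continuousP => e W Ve nW.
  have [j jE te] := tE e Ve.
  have := nbhs_germ (open_interior _) Ve (is_lift_sgn j lV) jE.
  apply: filterS => e' [Ve' /germ_t ->] _.
  by rewrite -te; exact: nbhs_singleton nW.
- move=> c j Vc; have [Sc gS] := SE (c, j); split=> //.
  exact/germ_t/gS.
- move=> e Ve; have [j jE te] := tE e Ve.
  have [Sc gS] := SE (e.1, t e); have {}gS := gS Ve.
  have Sp : S (e.1, t e) = (e.1, (S (e.1, t e)).2).
    by rewrite [LHS]surjective_pairing Sc.
  have S2 : (S (e.1, t e)).2 = e.2.
    apply: (germ_uniq (sg := sgn j \o s b) (b := e.1)).
      by rewrite -Sp -te.
    by rewrite -surjective_pairing.
  by rewrite /ext_cov Sp S2 -surjective_pairing.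
Qed.

Local Definition ext_cover : twofold_covering B :=
  TwofoldCovering ext_cov_continuous ext_locally_trivial.

(** Sends [e] to the germ at its base point of the section through [e]. *)
Local Definition ext_map (e : Defs.total E) : ext_space :=
  (i (cov e), `[< s (i (cov e)) (cov e) = e >]).

Local Lemma ext_mapE e : sgn (ext_map e).2 (s (i (cov e)) (cov e)) = e.
Proof.
rewrite /ext_map /=; case: asboolP => //= ne.
have Ue : (i @^-1` U (i (cov e))) (cov e) by exact: nbhs_singleton (nU _).
by have [//|->] := fiber_flip ((ls (i (cov e))).2 _ Ue); rewrite flipK.
Qed.

Local Lemma germ_ext_map V sg e : open V -> V (i (cov e)) -> local_lift V sg ->
  germ sg (ext_map e) <-> sg (cov e) = e.
Proof.
move=> oV Ve lsg; rewrite -{3}(ext_mapE e).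
split; first exact: ev_point.
move=> sge; set b := i (cov e).
have VU x : (i @^-1` (V `&` U b)) x -> (i @^-1` V) x by case.
have UV x : (i @^-1` (V `&` U b)) x -> (i @^-1` U b) x by case.
have Ae : (i @^-1` (V `&` U b)) (cov e).
  by split=> //; exact: nbhs_singleton (nU _).
have nA : nbhs (cov e) (i @^-1` (V `&` U b)).
  have nVU : nbhs b (V `&` U b) by apply: filterI; [exact: open_nbhs_nbhs|exact: nU].
  exact: (@i_cont (cov e) _ nVU).
have := is_lift_eq_near (is_liftS VU lsg) (is_lift_sgn (ext_map e).2 (is_liftS UV (ls b))) Ae.
move=> nE.
have nI : nbhs b (i @` [set x | sg x = sgn (ext_map e).2 (s b x)]).
  apply: (open_embedding_nbhs i_open).
  by apply: filterS (filterI nA nE) => x [Ax H]; exact/(H Ax).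
change (nbhs b [set z | forall x, i x = z -> sg x = sgn (ext_map e).2 (s b x)]).
by apply: filterS nI => z [x H <-] y /i_inj ->.
Qed.

Lemma is_restriction_ext : is_restriction i ext_cover E.
Proof.
exists ext_map; split=> //.
- move=> e W; rewrite nbhsE => -[W' []]; rewrite ext_openE => oW' W'e W'W.
  have [V [sg [oV Ve lsg gsg VW]]] := oW' _ W'e.
  have sge : sg (cov e) = e by exact/(germ_ext_map oV Ve lsg).
  pose A := @cov _ E @^-1` (i @^-1` V).
  have nA : nbhs e A.
    have niV : nbhs (cov e) (i @^-1` V).
      by apply: (@i_cont (cov e)); exact: open_nbhs_nbhs.
    exact: (@cov_continuous _ E e _ niV).
  have l1 : is_lift A (@cov _ E) (sg \o @cov _ E).
    split; last by move=> e' Ae' /=; rewrite lsg.2.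
    apply: (within_comp (D := i @^-1` V)) lsg.1 _ => //.
    by apply: continuous_within; exact: cov_continuous.
  have l2 : is_lift A (@cov _ E) (@id (Defs.total E)) by split=> //; exact: within_id.
  have nE := is_lift_eq_near l1 l2 (nbhs_singleton nA).
  apply: filterS (filterI nA nE) => e' [Ae' H].
  apply: W'W; apply: VW => //; apply/(germ_ext_map oV) => //.
  exact/(H Ae').
- move=> q [b j] /= bq; rewrite /ext_cov /= in bq; subst b.
  have cs : cov (s (i q) q) = q by apply: (ls (i q)).2; exact: nbhs_singleton (nU _).
  exists (sgn j (s (i q) q)); split.
    rewrite cov_sgn cs; split=> //; rewrite /ext_map cov_sgn cs; congr pair.
    apply/asboolP; case: j => //= /esym; exact: flip_neq.
  by move=> e [<- em]; rewrite -[RHS]ext_mapE em.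
Qed.

End Extension.

Lemma is_restriction_surj {B B' : topologicalType} (i : B' -> B)
    (E' : twofold_covering B') :
    continuous i -> injective i -> (forall W, open W -> open (i @` W)) ->
    locally_connected_in setT (range i) ->
    (forall b : B, exists2 U, nbhs b U &
       exists s : B' -> Defs.total E', is_lift (i @^-1` U) id s) ->
  exists E, is_restriction i E E'.
Proof.
move=> ci ii oi di lt.
have [Us UsE] : {Us : B -> set B * (B' -> Defs.total E') & forall b,
    nbhs b (Us b).1 /\ is_lift (i @^-1` (Us b).1) id (Us b).2}.
  apply: (@choice _ _ (fun b (Us : set B * (B' -> Defs.total E')) =>
    nbhs b Us.1 /\ is_lift (i @^-1` Us.1) id Us.2)) => b.
  by have [U nU [s ls]] := lt b; exists (U, s).
eexists; exact: (is_restriction_ext ci ii oi di (fun b => (UsE b).1) (fun b => (UsE b).2)).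
Qed.

(** * Complements of linear subspaces *)

Section MatrixLimits.
Context {R : realType} {T : Type} {F : set_system T} {FF : Filter F}.

Lemma cvg_mx {m n} (f : T -> 'M[R]_(m, n)) (a : 'M[R]_(m, n)) :
  (forall i j, (fun x => f x i j) @ F --> a i j) -> f @ F --> a.
Proof.
move=> cf V [P nP PV].
have H : F [set x | forall i j, P i j (f x i j)].
  apply: (@filter_forall _ _ (fun i x => forall j, P i j (f x i j))) => i.
  by apply: (@filter_forall _ _ (fun j x => P i j (f x i j))) => j; exact: cf (nP i j).
by move: H; apply: (@filterS _ F) => x Px; apply: PV => i j; exact: Px.
Qed.

Lemma cvg_coord {m n} (f : T -> 'M[R]_(m, n)) (a : 'M[R]_(m, n)) i j :
  f @ F --> a -> (fun x => f x i j) @ F --> a i j.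
Proof.
move=> fa; apply: (cvg_comp f (fun M : 'M[R]_(m, n) => M i j) fa).
exact: coord_continuous.
Qed.

Lemma cvg_mulmx {m n k} (f : T -> 'M[R]_(m, n)) (g : T -> 'M[R]_(n, k))
    (a : 'M[R]_(m, n)) (b : 'M[R]_(n, k)) :
  f @ F --> a -> g @ F --> b -> (fun x => f x *m g x) @ F --> a *m b.
Proof.
move=> fa gb; apply: cvg_mx => i j; rewrite mxE.
rewrite (_ : (fun _ => _) = (fun x => \sum_k f x i k * g x k j)).
  by apply: (cvg_big add_continuous) => l _; apply: cvgM; exact: cvg_coord.
by apply/funext => x; rewrite mxE.
Qed.

Lemma cvg_trmx {m n} (f : T -> 'M[R]_(m, n)) (a : 'M[R]_(m, n)) :
  f @ F --> a -> (fun x => (f x)^T) @ F --> a^T.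
Proof.
move=> fa; apply: cvg_mx => i j; rewrite mxE.
rewrite (_ : (fun _ => _) = (fun x => f x j i)); first exact: cvg_coord.
by apply/funext => x; rewrite mxE.
Qed.

Lemma cvg_det {n} (f : T -> 'M[R]_n) (a : 'M[R]_n) :
  f @ F --> a -> (fun x => \det (f x)) @ F --> \det a.
Proof.
move=> fa; apply: (cvg_big add_continuous) => s _.
apply: cvgM; first exact: cvg_cst.
by apply: (cvg_big mul_continuous) => i _; exact: cvg_coord.
Qed.

End MatrixLimits.

Lemma open_neq0 {K : numFieldType} {V : normedModType K} : open [set x : V | x != 0].
Proof.
have -> : [set x : V | x != 0] = ~` [set 0] by apply/seteqP; split=> x /= /eqP.
rewrite openC; apply: accessible_closed_set1.
by apply: hausdorff_accessible; exact: norm_hausdorff.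
Qed.

(** * Balls cut by linear subspaces *)

Section GeneralPosition.
Context {R : realType} {n : nat}.
Implicit Types (Qs : seq 'M[R]_n) (Q : 'M[R]_n) (u v x : 'rV[R]_n).

Definition on_some Qs v := has (fun Q => (v <= Q)%MS) Qs.

Definition codims_ge k Qs := all (fun Q => \rank Q + k <= n)%N Qs.

(** The span of [Q] and [x] contains every line through [x] and a point of [Q], that is, the cone
    over [Q] with apex [x]. *)
Definition cones x Qs := [seq (Q + x)%MS | Q <- Qs].

Lemma open_notin_subspace Q : open [set v : 'rV[R]_n | ~~ (v <= Q)%MS].
Proof.
have -> : [set v : 'rV[R]_n | ~~ (v <= Q)%MS] = (fun v => v *m cokermx Q) @^-1` [set x | x != 0].
  by apply/seteqP; split=> v /=; rewrite submxE.
apply: open_comp; last exact: open_neq0.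
move=> v _; apply: (@cvg_mulmx _ _ (nbhs v) _ _ _ _ id (cst (cokermx Q)) v).
  exact: cvg_id.
exact: cvg_cst.
Qed.

(** The subspaces are left one at a time: a small step along a basis vector outside [Q] leaves [Q],
    and openness keeps room for the next step. *)
Lemma general_position Qs (O : set 'rV[R]_n) v0 :
  codims_ge 1 Qs -> open O -> O v0 -> exists2 v, O v & ~~ on_some Qs v.
Proof.
elim: Qs O v0 => [|Q Qs IH] O v0 /=; first by exists v0.
move=> /andP[rQ cQs] oO Ov0.
pose O' := O `&` [set v : 'rV[R]_n | ~~ (v <= Q)%MS].
have oO' : open O' by apply: openI => //; exact: open_notin_subspace.
suff [v1 O'v1] : O' !=set0.
  by have [v [Ov /= vQ] vQs] := IH _ _ cQs oO' O'v1; exists v; rewrite // negb_or vQ.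
have [v0Q|v0Q] := boolP (v0 <= Q)%MS; last by exists v0.
have [i wQ] : exists i, ~~ (row i (1%:M : 'M[R]_n) <= Q)%MS.
  apply/row_subPn; apply/negP => /mxrankS; rewrite mxrank1 => nQ.
  by move: rQ; rewrite addn1 ltnNge nQ.
set w := row i _ in wQ.
have ct : (fun t : R => v0 + t *: w) @ (0 : R) --> v0.
  rewrite -[X in _ --> X]addr0 -[X in _ + X](scale0r w).
  by apply: cvgD; [exact: cvg_cst|apply: cvgZ; [exact: cvg_id|exact: cvg_cst]].
have /nbhs_ballP[e /= e0 eO] : nbhs (0 : R) (fun t => O (v0 + t *: w)).
  by apply: ct; exact: open_nbhs_nbhs.
exists (v0 + (e / 2) *: w); split.
  apply: eO; rewrite /ball /= sub0r normrN gtr0_norm ?divr_gt0//; lra.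
apply: contra wQ => /= wQ; have e2 : e / 2 != 0 by rewrite gt_eqF// divr_gt0.
have := addmx_sub wQ (scalemx_sub (-1) v0Q).
rewrite scaleN1r addrAC subrr add0r => /(scalemx_sub (e / 2)^-1).
by rewrite scalerA mulVf// scale1r.
Qed.

Lemma codims_cones k x Qs : codims_ge k.+1 Qs -> codims_ge k (cones x Qs).
Proof.
rewrite /codims_ge all_map => /allP H; apply/allP => Q /H /= rQ.
apply: leq_trans rQ; rewrite addnS -addSn leq_add2r.
apply: leq_trans (mxrank_adds_leqif Q x) _.
by rewrite -[X in (_ <= X)%N]addn1 leq_add2l rank_leq_row.
Qed.

Lemma codims_geS k Qs : codims_ge k.+1 Qs -> codims_ge k Qs.
Proof. by apply: sub_all => Q; apply: leq_trans; rewrite leq_add2l. Qed.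

Lemma on_some_cones x Qs v : on_some Qs v -> on_some (cones x Qs) v.
Proof.
move=> /hasP[Q QQs vQ]; apply/hasP; exists (Q + x)%MS; first exact: map_f.
by apply: submx_trans vQ _; exact: addsmxSl.
Qed.

(** For [t != 0] the point [v] is a combination of [x] and the point at time [t], so if the latter
    were in [Q], then [v] would be in the cone over [Q]. *)
Lemma segment_avoids Qs x v t : ~~ on_some Qs x -> ~~ on_some (cones x Qs) v ->
  ~~ on_some Qs (x + t *: (v - x)).
Proof.
move=> nx nv; apply/hasPn => Q QQs; apply/negP => zQ.
have [t0|t0] := eqVneq t 0.
  move: zQ; rewrite t0 scale0r addr0; apply/negP.
  by move/hasPn: nx; exact.
move/hasPn: nv => /(_ (Q + x)%MS (map_f _ QQs)) /negP; apply.
have -> : v = t^-1 *: (x + t *: (v - x)) + (1 - t^-1) *: x.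
  rewrite scalerDr scalerA mulVf// scale1r scalerBl scale1r.
  by rewrite -addrA [(v - x) + _]addrA subrK addrC subrK.
by apply: addmx_sub_adds; exact: scalemx_sub.
Qed.

(** The points are pairs of a base point and a matrix; only the base point is constrained by the
    subspaces. *)
Definition cut_ball Qs (c : 'rV[R]_n * 'M[R]_n) (r : R) :=
  [set w | ball c r w /\ ~~ on_some Qs w.1].

Definition seg {V : lmodType R} (a b : V) (t : R) := a + t *: (b - a).

Lemma seg0 {V : lmodType R} (a b : V) : seg a b 0 = a.
Proof. by rewrite /seg scale0r addr0. Qed.

Lemma seg1 {V : lmodType R} (a b : V) : seg a b 1 = b.
Proof. by rewrite /seg scale1r addrC subrK. Qed.

Lemma ball_seg {V : normedModType R} (c : V) r a b t :
  ball c r a -> ball c r b -> 0 <= t <= 1 -> ball c r (seg a b t).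
Proof.
rewrite -!ball_normE /ball_ /= => ca cb /andP[t0 t1].
have -> : c - seg a b t = (1 - t) *: (c - a) + t *: (c - b).
  have E : t *: (a - b) = - (t *: (c - a)) + t *: (c - b).
    rewrite [RHS]addrC -scalerBr; congr (_ *: _).
    by rewrite opprB [RHS]addrC addrA subrK.
  by rewrite /seg opprD addrA -scalerN opprB scalerBl scale1r E addrA.
apply: le_lt_trans (ler_normD _ _) _; rewrite !normrZ !ger0_norm ?subr_ge0//.
have [t_eq0|t_neq0] := eqVneq t 0; first by rewrite t_eq0 subr0 mul1r mul0r addr0.
have tp : 0 < t by rewrite lt_neqAle eq_sym t_neq0.
have -> : r = (1 - t) * r + t * r by ring.
by apply: ler_ltD; [apply: ler_wpM2l; [rewrite subr_ge0|exact: ltW]|rewrite ltr_pM2l].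
Qed.

Lemma seg_continuous {V : normedModType R} :
  continuous (fun abt : (V * V) * R => seg abt.1.1 abt.1.2 abt.2).
Proof.
move=> x; apply: cvgD; first by apply: (@continuous_comp _ _ _ fst fst) => //; exact: fst_continuous.
apply: cvgZ; first exact: snd_continuous.
by apply: cvgB; apply: (@continuous_comp _ _ _ fst) => //; try exact: fst_continuous; exact: snd_continuous.
Qed.

(** A relatively clopen subset containing one point of a segment contains the whole segment, since
    [[0, 1]] is connected. *)
Lemma connected_segments {V : normedModType R} (S : set V) :
    (forall x y : V, S x -> S y -> exists z, forall t, 0 <= t <= 1 ->
       S (seg x z t) /\ S (seg y z t)) ->
  connected S.
Proof.
move=> Ss D [x Dx] [G oG DG] [K cK DK].
have Sx : S x by move: Dx; rewrite DG => -[].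
have half a b : (forall t, 0 <= t <= 1 -> S (seg a b t)) ->
    forall t t' : R, 0 <= t <= 1 -> 0 <= t' <= 1 -> D (seg a b t) -> D (seg a b t').
  move=> Sab t t' t01 t'01 Dt.
  have cs : continuous (seg a b).
    move=> v; apply: (@continuous_comp _ _ _ (fun t => ((a, b), t)) (fun abt => seg abt.1.1 abt.1.2 abt.2)).
      by apply: pair_continuous => ?; [exact: cvg_cst|exact: cvg_id].
    exact: seg_continuous.
  suff -> : D (seg a b t') = (`[0, 1]%classic `&` seg a b @^-1` D) t'.
    rewrite (_ : `[0, 1]%classic `&` seg a b @^-1` D = `[0, 1]%classic).
      by rewrite /= in_itv.
    apply: segment_connected.
    - by exists t; split=> //=; rewrite in_itv.
    - exists (seg a b @^-1` G); first by apply: open_comp => // ? _; exact: cs.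
      rewrite eqEsubset DG; split=> v [/= v01 H]; split=> //; first exact: H.2.
      by split=> //; apply: Sab; rewrite in_itv in v01.
    - exists (seg a b @^-1` K); first by apply: closed_comp => // ? _; exact: cs.
      rewrite eqEsubset DK; split=> v [/= v01 H]; split=> //; first exact: H.2.
      by split=> //; apply: Sab; rewrite in_itv in v01.
  by apply/propext; split=> [Du|[]//]; split=> //=; rewrite in_itv.
rewrite eqEsubset; split=> [y|y Sy]; first by rewrite DG => -[].
have [z Hz] := Ss x y Sx Sy.
have I0 : 0 <= (0 : R) <= 1 by rewrite lexx ler01.
have I1 : 0 <= (1 : R) <= 1 by rewrite lexx ler01.
have Dz : D z.
  rewrite -(seg1 x z); apply: (half x z _ 0 1) => //; last by rewrite seg0.
  by move=> t /Hz[].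
rewrite -(seg0 y z); apply: (half y z _ 1 0) => //; last by rewrite seg1.
by move=> t /Hz[].
Qed.

Lemma cut_ball_nonempty Qs c r : 0 < r -> codims_ge 1 Qs -> cut_ball Qs c r !=set0.
Proof.
move=> r0 cQs; have [||v vr vQ] := @general_position Qs (ball c.1 r) c.1 cQs.
- exact: ball_open.
- exact: ballxx.
- by exists (v, c.2); split=> //; split=> //=; exact: ballxx.
Qed.

(** Two points are joined through a third one off the cones with these two apexes; in codimension 2
    the cones are still proper subspaces. *)
Lemma cut_ball_connected Qs c r : codims_ge 2 Qs -> connected (cut_ball Qs c r).
Proof.
move=> cQs; apply: connected_segments => x y [xr xQ] [yr yQ].
have [|||z zr] := @general_position (cones x.1 Qs ++ cones y.1 Qs) (ball c.1 r) x.1.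
- by rewrite /codims_ge all_cat; apply/andP; split; exact: codims_cones.
- apply: ball_open; exact: le_lt_trans (xr.1).
- exact: xr.1.
rewrite /on_some has_cat negb_or => /andP[zx zy].
(* The matrix component is free, so that of [x] is kept. *)
exists (z, x.2) => t t01; split; split; rewrite /=.
- by apply: ball_seg => //; split=> //=; exact: xr.2.
- exact: segment_avoids.
- by apply: ball_seg => //; split=> //=; exact: xr.2.
- exact: segment_avoids.
Qed.

(** Fix an apex [x] in the cut ball. Off the cones with apex [x], the segment from [x] to [z] stays
    in the cut ball, so [homotopy_lifting], started at a constant, lifts [f] there. The cones have
    codimension at least 2, and [extend_lift] extends the lift across them. *)
Lemma cut_ball_lift {B : topologicalType} (C : twofold_covering B)
    (f : 'rV[R]_n * 'M[R]_n -> B) Qs c r :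
    0 < r -> codims_ge 3 Qs -> {within cut_ball Qs c r, continuous f} ->
  exists h : 'rV[R]_n * 'M[R]_n -> Defs.total C, is_lift (cut_ball Qs c r) f h.
Proof.
move=> r0 cQs cf.
have [x [xr xQ]] := cut_ball_nonempty c r0 (codims_geS (codims_geS cQs)).
set Y := cut_ball Qs c r; set Z := cut_ball (cones x.1 Qs) c r.
have ZY : Z `<=` Y by move=> w [wr wQ]; split=> //; apply: contra wQ; exact: on_some_cones.
pose H (zt : ('rV[R]_n * 'M[R]_n) * R) := f (seg x zt.1 zt.2).
have HY zt : (Z `*` [set t : R | 0 <= t <= 1]) zt -> Y (seg x zt.1 zt.2).
  move=> [[zr zQ] t01]; split; first exact: ball_seg.
  exact: segment_avoids.
have cH : {within Z `*` [set t : R | 0 <= t <= 1], continuous H}.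
  apply: (within_comp (D := Y)) cf HY; apply: continuous_within => zt.
  apply: (@continuous_comp _ _ _ (fun zt => ((x, zt.1), zt.2)) (fun abt => seg abt.1.1 abt.1.2 abt.2)).
    apply: pair_continuous; last exact: snd_continuous.
    by apply: pair_continuous => ?; [exact: cvg_cst|exact: fst_continuous].
  exact: seg_continuous.
have [e ex] := fiber_nonempty C (f x).
have [|h lh] := homotopy_lifting (C := C) cH (s0 := fun=> e).
  split; first by apply: continuous_within => ?; exact: cvg_cst.
  by move=> z Zz; rewrite /H /= seg0.
have lh' : is_lift Z f h.
  by split; [exact: lh.1|move=> z Zz; rewrite lh.2// /H /= seg1].
have [|G lG _] := extend_lift cf ZY _ lh'; last by exists G.
(* Inside a small ball around [y], the complement of the cones is again a cut ball, hence
   connected. *)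
move=> y V [yr yQ] nV.
have nVr : nbhs y (V `&` ball c r).
  apply: filterI => //; apply: open_nbhs_nbhs; split=> //; exact: ball_open.
have /nbhs_ballP[e' /= e'0 e'V] := nVr.
exists (ball y e'); split.
- exact: nbhsx_ballx.
- by move=> w /e'V[].
- have [w [wy wQ]] := cut_ball_nonempty y e'0 (codims_geS (codims_cones x.1 cQs)).
  by exists w; split=> //; split=> //; exact: (e'V _ wy).2.
- have -> : ball y e' `&` Z = cut_ball (cones x.1 Qs) y e'.
    apply/seteqP; split=> [w [wy []]//|w [wy wQ]]; split=> //; split=> //.
    exact: (e'V _ wy).2.
  exact: cut_ball_connected (codims_cones _ _).
Qed.

End GeneralPosition.

(** * Smooth maps and lifts of transition functions *)

Section CkCalculus.
Context {R : realType}.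
Implicit Types V W : normedModType R.

Lemma near_is_diff V W (f g : V -> W) x :
    (\forall y \near x, f y = g y) -> differentiable f x ->
  differentiable g x /\ 'd g x = 'd f x :> (V -> W).
Proof.
move=> fg df.
have fgx := nbhs_singleton fg.
have [cdf ef] := (diff_locallyP x f).1 df.
have eg : g \o shift x = cst (g x) + 'd f x +o_ (0 : V) id.
  apply/eqaddoP => e e0.
  have nf : \forall h \near (0 : V), f (h + x) = g (h + x).
    have cs : (fun h : V => h + x) @ (0 : V) --> x.
      by rewrite -[X in _ --> X]add0r; apply: cvgD; [exact: cvg_id|exact: cvg_cst].
    exact: cs fg.
  move/eqaddoP : ef => /(_ e e0) nE.
  apply: filterS (filterI nf nE) => h [fh] /=.
  by rewrite !fctE /= fgx fh.
have dg := diff_unique cdf eg.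
split; last exact: dg.
by apply/diff_locallyP; rewrite dg; exact: (conj cdf eg).
Qed.

Lemma Ck_eq V W k (U : set V) (F G : V -> W) :
  open U -> (forall v, U v -> F v = G v) -> Ck_on k U F -> Ck_on k U G.
Proof.
move=> oU; elim: k F G => [|k IH] F G FG.
  move=> cF v Uv; have nU : nbhs v U by exact: open_nbhs_nbhs.
  have FGn : \forall w \near v, F w = G w by apply: filterS nU => w; exact: FG.
  move=> X; rewrite -(FG v Uv) => nX; have := cF v Uv X nX.
  by move=> /(filterI FGn); apply: filterS => w [FGw]; rewrite /preimage /= FGw.
move=> [dF cF]; have FGn v : U v -> \forall w \near v, F w = G w.
  by move=> Uv; apply: filterS (open_nbhs_nbhs (conj oU Uv)) => w; exact: FG.
split=> [v Uv|h]; first by have [] := near_is_diff (FGn v Uv) (dF v Uv).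
apply: IH (cF h) => v Uv.
by have [_ ->] := near_is_diff (FGn v Uv) (dF v Uv).
Qed.

Lemma CkS V W k (U : set V) (F : V -> W) : Ck_on k.+1 U F -> Ck_on k U F.
Proof.
elim: k F => [|k IH] F [dF cF].
  by move=> v Uv; apply: differentiable_continuous; exact: dF.
by split=> // h; exact: IH.
Qed.

Lemma Ck_cst V W k (U : set V) (a : W) : Ck_on k U (cst a : V -> W).
Proof.
elim: k a => [|k IH] a; first by move=> v _; exact: cvg_cst.
split=> [v _|h]; first exact: differentiable_cst.
rewrite (_ : (fun v => _) = cst 0); first exact: IH.
by apply/funext => v; rewrite diff_cst.
Qed.

Lemma Ck_linear V W k (U : set V) (L : {linear V -> W}) :
  continuous L -> Ck_on k U L.
Proof.
case: k => [|k] cL; first by move=> v _; exact: cL.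
split=> [v _|h]; first exact: linear_differentiable.
rewrite (_ : (fun v => _) = cst (L h)); first exact: Ck_cst.
by apply/funext => v; rewrite diff_lin.
Qed.

Lemma Ck_postlinear V W (W' : normedModType R) k (U : set V) (F : V -> W)
    (L : {linear W -> W'}) :
  open U -> continuous L -> Ck_on k U F -> Ck_on k U (L \o F).
Proof.
move=> oU cL; elim: k F => [|k IH] F.
  by move=> cF v Uv; apply: continuous_comp; [exact: cF|exact: cL].
move=> [dF cF]; split=> [v Uv|h].
  by apply: differentiable_comp; [exact: dF|exact: linear_differentiable].
apply: Ck_eq oU _ (IH _ (cF h)) => v Uv /=.
have dL : differentiable L (F v) by exact: linear_differentiable.
by rewrite (diff_comp (dF v Uv) dL) /= diff_lin.
Qed.

Lemma CkD V W k (U : set V) (F G : V -> W) :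
  open U -> Ck_on k U F -> Ck_on k U G -> Ck_on k U (F + G).
Proof.
move=> oU; elim: k F G => [|k IH] F G.
  by move=> cF cG v Uv; apply: cvgD; [exact: cF|exact: cG].
move=> [dF cF] [dG cG]; split=> [v Uv|h].
  by apply: differentiableD; [exact: dF|exact: dG].
apply: Ck_eq oU _ (IH _ _ (cF h) (cG h)) => v Uv /=.
by rewrite (diffD (dF v Uv) (dG v Uv)).
Qed.

Lemma Ck_sum V W k (U : set V) (I : Type) (r : seq I) (F : I -> V -> W) :
  open U -> (forall i, Ck_on k U (F i)) -> Ck_on k U (\sum_(i <- r) F i).
Proof.
move=> oU cF; elim: r => [|i r IH]; first by rewrite big_nil; exact: Ck_cst.
by rewrite big_cons; exact: CkD.
Qed.

Lemma CkM V k (U : set V) (f g : V -> R) :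
  open U -> Ck_on k U f -> Ck_on k U g -> Ck_on k U (f * g).
Proof.
move=> oU; elim: k f g => [|k IH] f g.
  by move=> cF cG v Uv; apply: cvgM; [exact: cF|exact: cG].
move=> cf cg; have [df df'] := cf; have [dg dg'] := cg.
split=> [v Uv|h]; first by apply: differentiableM; [exact: df|exact: dg].
have cs : Ck_on k U (f * (fun v => 'd g v h) + g * (fun v => 'd f v h)).
  exact: (CkD oU (IH _ _ (CkS cf) (dg' h)) (IH _ _ (CkS cg) (df' h))).
apply: Ck_eq oU _ cs => v Uv.
by rewrite (diffM (df v Uv) (dg v Uv)).
Qed.

Lemma continuous_mulmxr {m n p} (a : 'M[R]_(n, p)) :
  continuous (fun v : 'M[R]_(m, n) => v *m a).
Proof.
move=> v; apply: (@cvg_mulmx _ _ (nbhs v) _ _ _ _ id (cst a) v).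
  exact: cvg_id.
exact: cvg_cst.
Qed.

Lemma Ck_coord V k (U : set V) n (F : V -> 'rV[R]_n) i :
  open U -> Ck_on k U F -> Ck_on k U (fun v => F v 0 i).
Proof.
move=> oU cF.
have lin : linear (fun v : 'rV[R]_n => v 0 i : R^o).
  by move=> a u v; rewrite !mxE.
pose Lm := GRing.isLinear.Build _ _ _ _ _ lin.
pose L : {linear 'rV[R]_n -> R^o} := HB.pack (fun v : 'rV[R]_n => v 0 i : R^o) Lm.
exact: (@Ck_postlinear _ _ R^o k U F L oU (@coord_continuous _ _ _ 0 i) cF).
Qed.

Lemma Ck_row V k (U : set V) n (F : V -> 'rV[R]_n) :
  open U -> (forall i, Ck_on k U (fun v => F v 0 i)) -> Ck_on k U F.
Proof.
move=> oU cF.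
rewrite (_ : F = \sum_i (fun v => F v 0 i *: 'e_i)); last first.
  by apply/funext => v; rewrite fct_sumE [LHS]row_sum_delta.
apply: Ck_sum => // i.
have lin : linear (fun t : R^o => t *: ('e_i : 'rV[R]_n)).
  by move=> a u v; rewrite scalerDl scalerA.
pose Lm := GRing.isLinear.Build _ _ _ _ _ lin.
pose L : {linear R^o -> 'rV[R]_n} := HB.pack (fun t : R^o => t *: ('e_i : 'rV[R]_n)) Lm.
apply: (@Ck_postlinear _ _ _ k U (fun v => F v 0 i : R^o) L oU) => //.
by move=> t; apply: cvgZ; [exact: cvg_id|exact: cvg_cst].
Qed.

Lemma linear_row_sum n (L : {linear 'rV[R]_n -> R}) w :
  L w = \sum_i w 0 i * L 'e_i.
Proof.
rewrite [in LHS](row_sum_delta w) linear_sum.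
by apply: eq_bigr => i _; rewrite linearZ.
Qed.

(** By the chain rule in coordinates, a directional derivative of [G \o F] is a sum of products of
    derivatives of the coordinates of [F] with partial derivatives of [G] composed with [F], to
    which the induction hypothesis applies. *)
Lemma Ck_comp_scalar V k (U : set V) n (U' : set 'rV[R]_n) (F : V -> 'rV[R]_n)
    (G : 'rV[R]_n -> R) :
    open U -> (forall v, U v -> U' (F v)) ->
  Ck_on k U F -> Ck_on k U' G -> Ck_on k U (G \o F).
Proof.
move=> oU FU; elim: k F G FU => [|k IH] F G FU.
  by move=> cF cG v Uv; apply: continuous_comp; [exact: cF|exact/cG/FU].
move=> cF cG; have [dF dF'] := cF; have [dG dG'] := cG.
split=> [v Uv|h].
  by apply: differentiable_comp; [exact: dF|exact/dG/FU].
have cs : Ck_on k U (\sum_i ((fun v => ('d F v h) 0 i) * ((fun w => 'd G w 'e_i) \o F))).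
  apply: Ck_sum => // i.
  have c0 : Ck_on k U (fun v => ('d F v h) 0 i) by exact (Ck_coord i oU (dF' h)).
  have c1 : Ck_on k U ((fun w => 'd G w 'e_i) \o F).
    exact (IH F (fun w => 'd G w 'e_i) FU (CkS cF) (dG' 'e_i)).
  exact (CkM oU c0 c1).
apply: Ck_eq oU _ cs => v Uv.
rewrite (diff_comp (dF v Uv) (dG _ (FU v Uv))) /=.
rewrite fct_sumE; exact: esym (linear_row_sum ('d G (F v)) ('d F v h)).
Qed.

Lemma Ck_comp V k (U : set V) m n (U' : set 'rV[R]_n) (F : V -> 'rV[R]_n)
    (G : 'rV[R]_n -> 'rV[R]_m) :
    open U -> open U' -> (forall v, U v -> U' (F v)) ->
  Ck_on k U F -> Ck_on k U' G -> Ck_on k U (G \o F).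
Proof.
move=> oU oU' FU cF cG; apply: Ck_row => // i.
apply: (Ck_comp_scalar (U' := U') (G := fun w => G w 0 i)) => //.
exact: Ck_coord.
Qed.

Lemma smooth_near_comp V m n (F : V -> 'rV[R]_n) (G : 'rV[R]_n -> 'rV[R]_m) v :
  smooth_near v F -> smooth_near (F v) G -> smooth_near v (G \o F).
Proof.
move=> [U [oU Uv] sF] [U' [oU' U'v] sG].
have cF w : U w -> {for w, continuous F} by exact: (sF 0%N).
exists (U `&` F @^-1` U').
  split=> //; rewrite openE => w [Uw U'w]; apply: filterI; first exact: open_nbhs_nbhs.
  by apply: cF => //; exact: open_nbhs_nbhs.
have oI : open (U `&` F @^-1` U').
  rewrite openE => w [Uw U'w]; apply: filterI; first exact: open_nbhs_nbhs.
  by apply: cF => //; exact: open_nbhs_nbhs.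
move=> k.
have sub : U `&` F @^-1` U' `<=` U by move=> w [].
have sC j (F' : V -> 'rV[R]_n) : Ck_on j U F' -> Ck_on j (U `&` F @^-1` U') F'.
  elim: j F' => [|j IH] F' /=; first by move=> H w /sub; exact: H.
  by move=> [H1 H2]; split=> [w /sub|h]; [exact: H1|exact/IH/H2].
exact (Ck_comp oI oU' (fun w => @proj2 _ _) (sC k F (sF k)) (sG k)).
Qed.

End CkCalculus.

(** * Jacobian matrices *)

Section Jacobians.
Context {R : realType}.

Lemma mulmx_jacobian {m n} (F : 'rV[R]_m -> 'rV[R]_n) v h :
  h *m jacobian F v = 'd F v h.
Proof. exact: mul_rV_lin1. Qed.

Lemma mulmx_rV_inj {m n} (a b : 'M[R]_(m, n)) :
  (forall h : 'rV[R]_m, h *m a = h *m b) -> a = b.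
Proof. by move=> ab; apply/row_matrixP => i; rewrite !rowE. Qed.

Lemma jacobian_comp {m n p} (F : 'rV[R]_m -> 'rV[R]_n) (G : 'rV[R]_n -> 'rV[R]_p) v :
    differentiable F v -> differentiable G (F v) ->
  jacobian (G \o F) v = jacobian F v *m jacobian G (F v).
Proof.
move=> dF dG; apply: mulmx_rV_inj => h.
by rewrite mulmxA !mulmx_jacobian (diff_comp dF dG).
Qed.

Lemma differentiable_mulmxr {m n} (a : 'M[R]_(m, n)) (v : 'rV[R]_m) :
  differentiable (mulmxr a) v.
Proof. by apply: linear_differentiable; exact: continuous_mulmxr. Qed.

Lemma jacobian_mulmxr {m n} (a : 'M[R]_(m, n)) (v : 'rV[R]_m) :
  jacobian (mulmxr a) v = a.
Proof.
apply: mulmx_rV_inj => h; rewrite mulmx_jacobian diff_lin//.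
exact: continuous_mulmxr.
Qed.

Lemma smooth_near_mulmxr {m n} (a : 'M[R]_(m, n)) (v : 'rV[R]_m) :
  smooth_near v (mulmxr a).
Proof.
exists setT; first by split=> //; exact: openT.
by move=> k; apply: Ck_linear; exact: continuous_mulmxr.
Qed.

Lemma smooth_near_differentiable {m n} (F : 'rV[R]_m -> 'rV[R]_n) v :
  smooth_near v F -> differentiable F v.
Proof. by move=> [U [_ Uv] sF]; have [dF _] := sF 1%N; exact: dF. Qed.

Lemma jacobian_continuous {m n} (F : 'rV[R]_m -> 'rV[R]_n) v :
  smooth_near v F -> {for v, continuous (jacobian F)}.
Proof.
move=> [U [oU Uv] sF]; have [_ cF] := sF 1%N.
apply: (@cvg_mx _ _ (nbhs v) _) => i j.
rewrite (_ : (fun _ => _) = (fun w => ('d F w 'e_i) 0 j)); last first.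
  by apply/funext => w; rewrite -mulmx_jacobian -rowE [RHS]mxE.
rewrite (_ : jacobian F v i j = ('d F v 'e_i) 0 j); last first.
  by rewrite -mulmx_jacobian -rowE [RHS]mxE.
apply: (cvg_coord (F := nbhs v)).
exact: cF.
Qed.

(** Otherwise the kernels of the differences [a - J] would be finitely many proper subspaces
    covering the whole space. *)
Lemma finite_family_eq {n} (s : seq 'M[R]_n) (J : 'M[R]_n) :
  (forall h : 'rV[R]_n, exists2 a, a \in s & h *m a = h *m J) -> J \in s.
Proof.
move=> sJ; apply: contrapT => /negP nJ.
have [|||h _ hs] := @general_position R n [seq kermx (a - J) | a <- s] setT 0 => //.
- rewrite /codims_ge all_map; apply/allP => a sa /=; rewrite mxrank_ker.
  have aJ : a - J != 0 by rewrite subr_eq0; apply: contraNneq nJ => <-.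
  rewrite -mxrank_eq0 in aJ; have rn := rank_leq_row (a - J).
  by rewrite addn1 ltn_subrL lt0n aJ (leq_trans _ rn)// lt0n.
- exact: openT.
have [a sa haJ] := sJ h; move/negP: hs; apply.
apply/hasP; exists (kermx (a - J)); first exact: map_f.
by apply/sub_kermxP; rewrite mulmxBr haJ subrr.
Qed.

End Jacobians.

(** * Lifts of transition functions and their differentials *)

Section WeakLifts.
Context {R : realType} {n : nat} {M : topologicalType}.
Implicit Types (c d e : chart R n M) (F G : 'rV[R]_n -> 'rV[R]_n) (v w : 'rV[R]_n).

(** Smoothness and orientation are dropped, which makes composites immediate;
    [weak_transition_oriented] recovers them. *)
Definition weak_lift c d F v :=
  differentiable F v /\ \forall w \near v, fold d (F w) = fold c w.

Lemma oriented_weak_lift c d F v : oriented_lift c d F v -> weak_lift c d F v.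
Proof. by move=> [/smooth_near_differentiable dF lF _]. Qed.

Lemma weak_lift_comp c d e F G v :
  weak_lift c d F v -> weak_lift d e G (F v) -> weak_lift c e (G \o F) v.
Proof.
move=> [dF lF] [dG lG]; split; first exact: differentiable_comp.
have lGF : \forall w \near v, fold e (G (F w)) = fold d (F w).
  exact: (differentiable_continuous dF lG).
by apply: filterS (filterI lF lGF) => w [<-].
Qed.

Lemma fold_mulmxr c a v : chart_group c a -> fold c (v *m a) = fold c v.
Proof. by move=> ca; apply/esym/fold_fiber; exists a. Qed.

Lemma weak_lift_mulmxr c a v : chart_group c a -> weak_lift c c (mulmxr a) v.
Proof.
move=> ca; split; first exact: differentiable_mulmxr.
by apply: filterS filterT => w _; exact: fold_mulmxr.
Qed.

Lemma chart_group1 c : chart_group c 1%:M.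
Proof. by have [] := chart_groupP c. Qed.

Lemma chart_groupM c a b : chart_group c a -> chart_group c b -> chart_group c (a *m b).
Proof. by have [_ _ H _ _] := chart_groupP c; exact: H. Qed.

Lemma chart_groupV c a : chart_group c a -> chart_group c (invmx a).
Proof. by have [_ _ _ H _] := chart_groupP c; exact: H. Qed.

Lemma chart_group_det c a : chart_group c a -> \det a = 1.
Proof. by have [_ _ _ _ H] := chart_groupP c; move=> /H[]. Qed.

Lemma chart_group_unit c a : chart_group c a -> a \in unitmx.
Proof. by move=> /chart_group_det; rewrite unitmxE => ->; exact: unitr1. Qed.

Lemma oriented_lift_mulmxr c d F v a : chart_group d a ->
  oriented_lift c d F v -> oriented_lift c d (mulmxr a \o F) v.
Proof.
move=> da lF; have [sF nF dF] := lF; split.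
- by apply: smooth_near_comp => //; exact: smooth_near_mulmxr.
- by apply: filterS nF => w <- /=; exact: fold_mulmxr.
- rewrite jacobian_comp; [|exact: smooth_near_differentiable|exact: differentiable_mulmxr].
  by rewrite jacobian_mulmxr det_mulmx (chart_group_det da) mulr1.
Qed.

(* A lift of the identity that fixes [v] agrees along each line through [v]    *)
(* with a group element arbitrarily close to [v]; there are finitely many      *)
(* group elements, so its differential maps each vector as one of them does.   *)
Lemma weak_lift_jacobian c F v : weak_lift c c F v -> F v = v ->
  exists2 a, chart_group c a & v *m a = v /\ jacobian F v = a.
Proof.
move=> [dF lF] Fv.
have [/finite_seqP[s sE] _ _ _ _] := chart_groupP c.
suff : jacobian F v \in [seq a <- s | v *m a == v].
  rewrite mem_filter => /andP[/eqP va sJ].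
  by exists (jacobian F v); [rewrite sE|].
apply: finite_family_eq => h; apply: contrapT => nh.
pose P (a : 'M[R]_n) (t : R) := F (t *: h + v) <> (t *: h + v) *m a.
have cth : (fun t : R => t *: h + v) @ 0^' --> v.
  have E : v = 0 *: h + v by rewrite scale0r add0r.
  rewrite [X in _ --> X]E.
  apply: cvgD; last exact: cvg_cst.
  apply: cvgZ; last exact: cvg_cst.
  by apply: cvg_within.
have cF : (fun t : R => F (t *: h + v)) @ 0^' --> v.
  by rewrite -[X in _ --> X]Fv; apply: (cvg_comp _ F cth); exact: (differentiable_continuous dF).
have neq (f : R -> 'rV[R]_n) (l : 'rV[R]_n) : f @ 0^' --> l -> l != 0 ->
    \forall t \near 0^', f t != 0.
  move=> fl l0; have : nbhs l [set x | x != 0] by apply: open_nbhs_nbhs; split=> //; exact: open_neq0.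
  exact: fl.
have nP a : a \in s -> \forall t \near 0^', P a t.
  (* If [a] fixes [v], the difference quotients of [F] and [a] have distinct limits by the choice of
     [h]; otherwise the values themselves have distinct limits. *)
  move=> sa; have [va|va] := eqVneq (v *m a) v.
    have haJ : 'd F v h - h *m a != 0.
      rewrite subr_eq0; apply/eqP => haJ; apply: nh; exists a; last by rewrite mulmx_jacobian.
      by rewrite mem_filter va eqxx.
    have q : (fun t : R => t^-1 *: (F (t *: h + v) - v) - h *m a) @ 0^' --> 'd F v h - h *m a.
      apply: cvgB; last exact: cvg_cst.
      rewrite -deriveE// /derive -{2}Fv.
      exact: (diff_derivable dF).
    have t0 : \forall t \near 0^', t != 0 :> R by exact: nbhs_dnbhs_neq.
    apply: filterS (filterI t0 (neq _ _ q haJ)) => t [tn0 /eqP qn0] E; apply: qn0.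
    by rewrite E mulmxDl va addrK -scalemxAl scalerA mulVf// scale1r subrr.
  have q : (fun t : R => F (t *: h + v) - (t *: h + v) *m a) @ 0^' --> v - v *m a.
    apply: cvgB => //; apply: (cvg_comp _ (mulmxr a) cth); exact: continuous_mulmxr.
  have va0 : v - v *m a != 0 by rewrite subr_eq0 eq_sym.
  apply: filterS (neq _ _ q va0) => t /eqP qn0 E; apply: qn0.
  by rewrite E subrr.
have nPs : \forall t \near 0^', forall a, a \in s -> P a t.
  elim: s {sE nh} nP => [|a s IH] nP; first by apply: filterS filterT.
  have IHs := IH (fun b sb => nP b (mem_behead (s := a :: s) sb)).
  apply: filterS (filterI (nP a (mem_head _ _)) IHs) => t [Pa Ps] b.
  by rewrite inE => /predU1P[->//|]; exact: Ps.
have lFt : \forall t \near 0^', fold c (F (t *: h + v)) = fold c (t *: h + v).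
  exact: cth lF.
have nE : \forall t \near 0^',
    (forall a, a \in s -> P a t) /\ fold c (F (t *: h + v)) = fold c (t *: h + v).
  exact: filterI.
have [t [nPt lt]] := @filter_ex _ _ (Proper_dnbhs_numFieldType (0 : R)) _ nE.
have [a ca ta] := (fold_fiber c _ _).1 (esym lt).
by apply: (nPt a) => //; rewrite sE in ca.
Qed.

End WeakLifts.

(** * The frame bundle *)

Section GramSchmidt.
Context {R : realType}.

Definition spd {n} (h : 'M[R]_n) :=
  h^T = h /\ forall u : 'rV[R]_n, u != 0 -> 0 < (u *m h *m u^T) 0 0.

(** For symmetric [h], the Gram matrix of the other basis vectors projected orthogonally to the
    first one. *)
Definition schur {n} (h : 'M[R]_(1 + n)) : 'M[R]_n :=
  drsubmx h - (h 0 0)^-1 *: (dlsubmx h *m ursubmx h).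

(* A lower triangular [s] with [s *m h *m s^T = 1], that is, the Gram-Schmidt  *)
(* process for the scalar product [h], by elimination of the first vector.     *)
Fixpoint gram_schmidt n : 'M[R]_n -> 'M[R]_n :=
  match n with
  | 0 => fun=> 1%:M
  | n'.+1 => fun h : 'M[R]_(1 + n') =>
      let s := gram_schmidt (schur h) in
      block_mx (Num.sqrt (h 0 0))^-1%:M 0 (- (h 0 0)^-1 *: (s *m dlsubmx h)) s
  end.

Lemma spd_block {n} (h : 'M[R]_(1 + n)) : spd h ->
  [/\ 0 < h 0 0, spd (schur h),
      h = block_mx (h 0 0)%:M (ursubmx h) (dlsubmx h) (drsubmx h) &
      (dlsubmx h)^T = ursubmx h].
Proof.
move=> [hT hp].
have ul : ulsubmx h = (h 0 0)%:M.
  apply/matrixP => i j; rewrite !ord1 !mxE eqxx mulr1n.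
  by congr (h _ _); apply: val_inj.
have hE : h = block_mx (h 0 0)%:M (ursubmx h) (dlsubmx h) (drsubmx h).
  by rewrite -ul submxK.
have hT' : (block_mx (h 0 0)%:M (ursubmx h) (dlsubmx h) (drsubmx h))^T =
    block_mx (h 0 0)%:M (ursubmx h) (dlsubmx h) (drsubmx h) by rewrite -hE.
move: hT'; rewrite tr_block_mx => /eq_block_mx[_ dlT urT drT].
have a0 : 0 < h 0 0.
  have e0 : (row_mx 1%:M 0 : 'rV[R]_(1 + n)) != 0.
    apply/eqP => /matrixP/(_ 0 0); rewrite mxE.
    case: splitP => [j _|j /= jE]; last by [].
    by rewrite !ord1 !mxE eqxx; apply/eqP; rewrite oner_neq0.
  have := hp _ e0; rewrite [X in _ *m X *m _]hE mul_row_block mul1mx mul0mx addr0 tr_row_mx mul_row_col.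
  by rewrite trmx0 mulmx0 addr0 trmx1 mulmx1 mxE eqxx mulr1n.
split=> //; split.
  by rewrite /schur linearB /= linearZ /= trmx_mul dlT urT drT.
(* With this first coordinate the vector is orthogonal to the first basis vector, and [h] takes on
   it the value of [schur h] on [u]. *)
move=> u u0; pose x := - (h 0 0)^-1 *: (u *m dlsubmx h).
have w0 : row_mx x u != 0 by apply: contra u0 => /eqP; rewrite -row_mx0 => /eq_row_mx[_ ->].
have := hp _ w0.
rewrite [X in _ *m X *m _]hE mul_row_block tr_row_mx mul_row_col.
rewrite mul_mx_scalar /x scalerA mulrN mulfV ?gt_eqF// scaleN1r addNr mul0mx add0r.
rewrite -scalemxAl scaleNr addrC -mulmxA.
by rewrite -[u *m drsubmx h - _]/(_ - _) /schur mulmxBr -scalemxAr.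
Qed.

Lemma gram_schmidt_step {n} (h : 'M[R]_(1 + n)) (s : 'M[R]_n) :
    spd h -> s *m schur h *m s^T = 1%:M ->
  let S := block_mx (Num.sqrt (h 0 0))^-1%:M 0 (- (h 0 0)^-1 *: (s *m dlsubmx h)) s in
  S *m h *m S^T = 1%:M.
Proof.
move=> sh sS S; have [a0 _ hE dlT] := spd_block sh.
pose al := (Num.sqrt (h 0 0))^-1.
have an0 : h 0 0 != 0 by rewrite gt_eqF.
have ala : al * h 0 0 * al = 1.
  have sa0 : Num.sqrt (h 0 0) != 0 by rewrite gt_eqF// sqrtr_gt0.
  by rewrite /al -{2}(sqr_sqrtr (ltW a0)); field.
have Sh : S *m h = block_mx (al * h 0 0)%:M (al *: ursubmx h) 0 (s *m schur h).
  rewrite [X in _ *m X]hE mulmx_block !mul0mx !addr0.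
  congr block_mx.
  - by rewrite -scalar_mxM.
  - by rewrite mul_scalar_mx.
  - by rewrite mul_mx_scalar scalerA mulrN mulfV// scaleN1r addNr.
  - by rewrite /schur mulmxBr -scalemxAr -scalemxAl scaleNr addrC mulmxA.
rewrite Sh tr_block_mx mulmx_block !mul0mx !trmx0 !mulmx0 !add0r !addr0 sS.
rewrite tr_scalar_mx -scalar_mxM ala.
rewrite (_ : _ + _ = 0); first by rewrite -scalar_mx_block.
rewrite mul_scalar_mx linearZ /= scalerA trmx_mul dlT -scalemxAl -scalerDl.
by rewrite mulrN -mulrA mulfV// mulr1 addNr scale0r.
Qed.

Lemma gram_schmidtP {n} (h : 'M[R]_n) : spd h ->
  gram_schmidt h *m h *m (gram_schmidt h)^T = 1%:M /\ 0 < \det (gram_schmidt h).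
Proof.
elim: n h => [|n IH] h sh.
  by split; [rewrite [LHS]flatmx0 [RHS]flatmx0|rewrite det1 ltr01].
have [a0 /IH[sS dS] _ _] := spd_block sh.
split; first exact: gram_schmidt_step.
rewrite /= (det_lblock ((Num.sqrt (h 0 0))^-1%:M : 'M[R]_1)) det_scalar expr1.
by rewrite mulr_gt0// invr_gt0 sqrtr_gt0.
Qed.

Lemma gram_schmidt1 {n} : gram_schmidt (1%:M : 'M[R]_n) = 1%:M.
Proof.
elim: n => [//|n IH] /=.
have -> : schur (1%:M : 'M[R]_(1 + n)) = 1%:M.
  by rewrite /schur [in LHS](scalar_mx_block 1%N n 1) block_mxKur mulmx0 scaler0 subr0 block_mxKdr.
have -> : dlsubmx (1%:M : 'M[R]_(1 + n)) = 0.
  by rewrite (scalar_mx_block 1%N n 1) block_mxKdl.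
rewrite IH mulmx0 scaler0 mxE eqxx mulr1n sqrtr1 invr1.
by rewrite -(scalar_mx_block 1%N n 1).
Qed.

Lemma cvg_block_mx {T : Type} {F : set_system T} {FF : Filter F} {m1 m2 n1 n2}
    (A : T -> 'M[R]_(m1, n1)) (B : T -> 'M[R]_(m1, n2)) (C : T -> 'M[R]_(m2, n1))
    (D : T -> 'M[R]_(m2, n2)) (a : 'M[R]_(m1, n1)) (b : 'M[R]_(m1, n2))
    (c : 'M[R]_(m2, n1)) (d : 'M[R]_(m2, n2)) :
    A @ F --> a -> B @ F --> b -> C @ F --> c -> D @ F --> d ->
  (fun x => block_mx (A x) (B x) (C x) (D x)) @ F --> block_mx a b c d.
Proof.
move=> Aa Bb Cc Dd; apply: cvg_mx => i j.
rewrite -[i]fintype.splitK -[j]fintype.splitK.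
case: (fintype.split i) => i'; case: (fintype.split j) => j' /=.
- rewrite block_mxEul (_ : (fun x => _) = fun x => A x i' j'); first exact: cvg_coord.
  by apply/funext => x; rewrite block_mxEul.
- rewrite block_mxEur (_ : (fun x => _) = fun x => B x i' j'); first exact: cvg_coord.
  by apply/funext => x; rewrite block_mxEur.
- rewrite block_mxEdl (_ : (fun x => _) = fun x => C x i' j'); first exact: cvg_coord.
  by apply/funext => x; rewrite block_mxEdl.
- rewrite block_mxEdr (_ : (fun x => _) = fun x => D x i' j'); first exact: cvg_coord.
  by apply/funext => x; rewrite block_mxEdr.
Qed.

Lemma cvg_submatrix {m1 n1 m n} (G : 'M[R]_(m, n) -> 'M[R]_(m1, n1)) f g h :
  (forall x i j, G x i j = x (f i) (g j)) -> G @ h --> G h.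
Proof.
move=> GE; apply: (@cvg_mx _ _ (nbhs h)) => i j; rewrite GE.
rewrite (_ : (fun x => _) = (fun x : 'M[R]_(m, n) => x (f i) (g j))).
  exact: coord_continuous.
exact/funext.
Qed.

Lemma gram_schmidt_step_continuous {n} (h : 'M[R]_(1 + n)) :
    0 < h 0 0 -> {for schur h, continuous (@gram_schmidt n)} ->
  {for h, continuous (@gram_schmidt n.+1 : 'M[R]_(1 + n) -> 'M[R]_(1 + n))}.
Proof.
move=> a0 cS.
have an0 : h 0 0 != 0 by rewrite gt_eqF.
have sa0 : Num.sqrt (h 0 0) != 0 by rewrite gt_eqF// sqrtr_gt0.
have ca : (fun x : 'M[R]_(1 + n) => x 0 0) @ h --> h 0 0 by exact: coord_continuous.
have cai : (fun x : 'M[R]_(1 + n) => (x 0 0)^-1) @ h --> (h 0 0)^-1 by exact: (cvgV an0 ca).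
have cd : (fun x : 'M[R]_(1 + n) => dlsubmx x) @ h --> dlsubmx h.
  apply: (@cvg_submatrix _ _ _ _ (fun x => dlsubmx x) (@rshift 1 n) (@lshift 1 n) h) => x i j.
  by rewrite !mxE.
have cu : (fun x : 'M[R]_(1 + n) => ursubmx x) @ h --> ursubmx h.
  apply: (@cvg_submatrix _ _ _ _ (fun x => ursubmx x) (@lshift 1 n) (@rshift 1 n) h) => x i j.
  by rewrite !mxE.
have cdr : (fun x : 'M[R]_(1 + n) => drsubmx x) @ h --> drsubmx h.
  apply: (@cvg_submatrix _ _ _ _ (fun x => drsubmx x) (@rshift 1 n) (@rshift 1 n) h) => x i j.
  by rewrite !mxE.
have cs : (fun x : 'M[R]_(1 + n) => schur x) @ h --> schur h.
  exact: (cvgB cdr (cvgZ cai (cvg_mulmx cd cu))).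
have cgs : (fun x : 'M[R]_(1 + n) => gram_schmidt (schur x)) @ h --> gram_schmidt (schur h).
  exact: (cvg_comp _ _ cs cS).
apply: (@cvg_block_mx _ (nbhs h)) => //.
- apply: (@cvg_mx _ _ (nbhs h)) => i j; rewrite mxE.
  rewrite (_ : (fun x => _) = (fun x : 'M[R]_(1 + n) => (Num.sqrt (x 0 0))^-1 *+ (i == j))).
    by apply: cvgMn; apply: cvgV => //; apply: (cvg_comp _ _ ca); exact: sqrt_continuous.
  by apply/funext => x; rewrite mxE.
- exact: cvg_cst.
- apply: cvgZ; first exact: cvgN.
  exact: (cvg_mulmx (F := nbhs h)).
Qed.

Lemma gram_schmidt_continuous {n} (h : 'M[R]_n) : spd h ->
  {for h, continuous (@gram_schmidt n)}.
Proof.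
elim: n h => [|n IH] h sh.
  exact: (@cst_continuous _ _ (1%:M : 'M[R]_0) h).
by have [a0 sS _ _] := spd_block sh; exact: gram_schmidt_step_continuous (IH _ sS).
Qed.

End GramSchmidt.

Lemma near_fst {T U : topologicalType} (P : T -> Prop) (x : T * U) :
  (\forall y \near x.1, P y) -> \forall z \near x, P z.1.
Proof. by case: x => x y nP; exact: (@fst_continuous T U (x, y)). Qed.

Lemma near_set_val {U : topologicalType} (D : set U) (P : U -> Prop) (x : set_type D) :
  (\forall y \near set_val x, P y) -> \forall y \near x, P (set_val y).
Proof. by move=> nP; exact: (@initial_continuous _ _ (@set_val U D) x). Qed.

(** * Charts of the frame bundle *)

Section FrameBundleCharts.
Context {R : realType} {n : nat} {M : topologicalType}.
Variables (A : oriented_atlas R n M) (g : riemannian_metric A).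
Implicit Types (c d : chart R n M) (v w : 'rV[R]_n) (p q : local_frames g).

(** The value at [v] of the lift given by the atlas lies in the orbit of [w], so an element of the
    group of [d] corrects it. *)
Lemma lift_exists c d v w : atlas A c -> atlas A d -> fold c v = fold d w ->
  exists F, oriented_lift c d F v /\ F v = w.
Proof.
move=> Ac Ad cd; have [|F lF] := atlas_compatible Ac Ad (v := v).
  by rewrite cd; exists w.
have Fv : fold d (F v) = fold d w by rewrite -cd; case: lF => _ /nbhs_singleton.
have [a da ->] := (fold_fiber d _ _).1 Fv.
by exists (mulmxr a \o F); split; [exact: oriented_lift_mulmxr|].
Qed.

Lemma mulmx_invg (a : 'M[R]_n) v : a \in unitmx -> v *m a = v -> v *m invmx a = v.
Proof. by move=> ua va; rewrite -{1}va mulmxK. Qed.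

Lemma mulmx_invr_cancel (e J K a : 'M[R]_n) : a \in unitmx -> J *m K = a ->
  e *m J *m (K *m invmx a) = e.
Proof. by move=> ua JK; rewrite mulmxA -(mulmxA e) JK mulmxK. Qed.

Lemma mulmx_invl_cancel (K J J0 b b0 : 'M[R]_n) : K \in unitmx -> b0 \in unitmx ->
  K *m J = b -> K *m J0 = b0 -> J0 *m (invmx b0 *m b) = J.
Proof.
move=> uK ub0 KJ KJ0; apply: (can_inj (mulKmx uK)).
by rewrite mulmxA KJ0 KJ mulKVmx.
Qed.

Definition weak_transition c v (e : 'M[R]_n) d w (e' : 'M[R]_n) := exists F,
  [/\ weak_lift c d F v, F v = w & e *m jacobian F v = e'].

Lemma weak_transition_fold c v e d w e' : weak_transition c v e d w e' ->
  fold c v = fold d w.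
Proof. by move=> [F [[_ /nbhs_singleton <-] <- _]]. Qed.

Lemma weak_transition_refl c v e : weak_transition c v e c v e.
Proof.
exists (mulmxr 1%:M); split; last by rewrite jacobian_mulmxr mulmx1.
  exact: weak_lift_mulmxr (chart_group1 _).
by rewrite /= mulmx1.
Qed.

Lemma weak_transition_trans c v e c1 v1 e1 c2 v2 e2 :
    weak_transition c v e c1 v1 e1 -> weak_transition c1 v1 e1 c2 v2 e2 ->
  weak_transition c v e c2 v2 e2.
Proof.
move=> [F [lF Fp Je]] [G [lG Gq Ke]]; exists (G \o F).
rewrite -Fp in lG Gq Ke; split; [exact: weak_lift_comp lF lG|exact: Gq|].
by rewrite (jacobian_comp lF.1 lG.1) mulmxA Je.
Qed.

Lemma weak_transition_sym c v e d w e' : atlas A c -> atlas A d ->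
  weak_transition c v e d w e' -> weak_transition d w e' c v e.
Proof.
move=> Ac Ad pq; have fpq := weak_transition_fold pq; case: pq => F [lF Fp Je].
have [G [lG Gq]] := lift_exists Ad Ac (esym fpq).
have wG := oriented_weak_lift lG; rewrite -Fp in wG Gq.
have [a ca [va Ja]] := weak_lift_jacobian (weak_lift_comp lF wG) Gq.
have ua := chart_group_unit ca.
rewrite (jacobian_comp lF.1 wG.1) in Ja.
exists (mulmxr (invmx a) \o G); rewrite -Fp; split.
- by apply: weak_lift_comp wG (weak_lift_mulmxr _ _); exact: chart_groupV.
- by rewrite /= Gq mulmx_invg.
- rewrite (jacobian_comp wG.1 (differentiable_mulmxr _ _)).
  by rewrite jacobian_mulmxr -Je (mulmx_invr_cancel _ ua Ja).
Qed.

(** Composed with a lift back, [F] and an oriented lift [F0] with the same value have Jacobians [b]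
    and [b0] in the group of [d]. So [F0] corrected by [b0^-1 b] has the Jacobian of [F] and stays
    oriented. *)
Lemma weak_transition_oriented c v e d w e' : atlas A c -> atlas A d ->
    weak_transition c v e d w e' ->
  exists F, [/\ oriented_lift c d F v, F v = w & e *m jacobian F v = e'].
Proof.
move=> Ac Ad pq; have fpq := weak_transition_fold pq; case: pq => F [lF Fp Je].
have [F0 [lF0 F0p]] := lift_exists Ac Ad fpq.
have [G [lG Gq]] := lift_exists Ad Ac (esym fpq).
have wF0 := oriented_weak_lift lF0; have wG := oriented_weak_lift lG.
rewrite -Gq in lF wF0 Fp F0p.
have [b b_in [wb Jb]] := weak_lift_jacobian (weak_lift_comp wG lF) Fp.
have [b0 b0_in [wb0 Jb0]] := weak_lift_jacobian (weak_lift_comp wG wF0) F0p.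
rewrite (jacobian_comp wG.1 lF.1) in Jb.
rewrite (jacobian_comp wG.1 wF0.1) in Jb0.
have ub0 := chart_group_unit b0_in.
have bb0 : chart_group d (invmx b0 *m b).
  by apply: chart_groupM => //; exact: chart_groupV.
rewrite Gq in lF Fp F0p wF0 Jb Jb0.
exists (mulmxr (invmx b0 *m b) \o F0); split.
- exact: oriented_lift_mulmxr.
- by rewrite /= F0p mulmxA mulmx_invg.
- rewrite (jacobian_comp wF0.1 (differentiable_mulmxr _ _)).
  have uG : jacobian G w \in unitmx.
    by rewrite unitmxE unitfE; case: lG => _ _ /gt_eqF ->.
  by rewrite jacobian_mulmxr (mulmx_invl_cancel uG ub0 Jb Jb0).
Qed.

Definition lf_weak_transition p q :=
  weak_transition (lf_chart p) (lf_point p) (lf_frame p) (lf_chart q) (lf_point q) (lf_frame q).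

Lemma lf_atlas p : atlas A (lf_chart p).
Proof. exact: svalP (projT1 p). Qed.

Lemma frame_transition_weak p q : frame_transition p q -> lf_weak_transition p q.
Proof. by move=> [F [/oriented_weak_lift lF Fp Je]]; exists F; split; [exact: lF|exact: Fp|exact: Je]. Qed.

(** Weak transitions are reflexive, symmetric and transitive, hence contain the generated
    equivalence, and each of them is realised by an oriented lift. *)
Lemma SO_piP p q : SO_pi p = SO_pi q <-> frame_transition p q.
Proof.
split=> [/eqmodP/asboolP H|H]; last by apply/eqmodP/asboolP; exact: rst_step.
apply: weak_transition_oriented; [exact: lf_atlas|exact: lf_atlas|].
change (lf_weak_transition p q).
elim: {p q} H => [p q|p|p q _|p q r _ pq _ qr].
- exact: frame_transition_weak.
- exact: weak_transition_refl.
- by apply: weak_transition_sym; exact: lf_atlas.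
- exact: weak_transition_trans pq qr.
Qed.

Lemma SO_pi_repr (b : SO_bundle g) : SO_pi (SO_repr b) = b.
Proof. exact: reprK. Qed.

Lemma SO_proj_pi p : SO_proj (SO_pi p) = fold (lf_chart p) (lf_point p).
Proof.
have /SO_piP/frame_transition_weak := SO_pi_repr (SO_pi p).
exact: weak_transition_fold.
Qed.

Lemma oriented_lift_near c d F v : oriented_lift c d F v ->
  \forall w \near v, oriented_lift c d F w.
Proof.
move=> [sF lF dF]; have [U [oU Uv] sU] := sF.
have cJ : (fun w => \det (jacobian F w)) @ v --> \det (jacobian F v).
  exact: (cvg_det (jacobian_continuous sF)).
have dJ : \forall w \near v, 0 < \det (jacobian F w).
  by apply: (cJ [set x | 0 < x]); exact: lt_nbhsr.
apply: filterS (filterI (open_nbhs_nbhs (conj oU Uv)) (filterI (nbhs_interior lF) dJ)).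
by move=> w [Uw [lw dw]]; split; [exists U|exact: lw|exact: dw].
Qed.

Lemma chart_frames_lift c d F v e : atlas A c -> atlas A d ->
    oriented_lift c d F v -> chart_frames g c (v, e) ->
  chart_frames g d (F v, e *m jacobian F v).
Proof.
move=> Ac Ad lF [/= eg de]; have gl := gram_lift g Ac Ad lF.
split=> /=; last by rewrite det_mulmx mulr_gt0//; case: lF.
by rewrite -eg gl trmx_mul !mulmxA.
Qed.

Lemma SO_pi_continuous : continuous (@SO_pi _ _ _ _ g).
Proof. exact: pi_continuous. Qed.

(** The saturation of an open set is open: a lift that carries one frame into [O] carries all nearby
    frames into [O]. *)
Lemma SO_pi_open (O : set (local_frames g)) : open O -> open (@SO_pi _ _ _ _ g @` O).
Proof.
move=> oO.
change (open (@SO_pi _ _ _ _ g @^-1` (@SO_pi _ _ _ _ g @` O))).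
have -> : @SO_pi _ _ _ _ g @^-1` (@SO_pi _ _ _ _ g @` O) =
    [set q | exists2 p, O p & frame_transition q p].
  apply/seteqP; split=> q /=.
    by move=> [p Op /esym/SO_piP pq]; exists p.
  by move=> [p Op /SO_piP/esym pq]; exists p.
apply/sigT_openP => d; rewrite openE => y [[c z] Oz [F [lF Fy Je]]].
have /sigT_openP/(_ c)[G oG GO] := oO.
have Gz : G (set_val z) by have : (set_val @^-1` G) z by rewrite GO.
rewrite /lf_chart /lf_point /lf_frame /= in lF Fy Je.
have cFJ : (fun we : 'rV[R]_n * 'M[R]_n => (F we.1, we.2 *m jacobian F we.1)) @ set_val y -->
    (F (set_val y).1, (set_val y).2 *m jacobian F (set_val y).1).
  have [sF _ _] := lF.
  have c1 : (fun we : 'rV[R]_n * 'M[R]_n => F we.1) @ set_val y --> F (set_val y).1.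
    have cF := differentiable_continuous (smooth_near_differentiable sF).
    exact: (cvg_comp fst F cvg_fst cF).
  have c2 : (fun we : 'rV[R]_n * 'M[R]_n => we.2) @ set_val y --> (set_val y).2.
    exact: cvg_snd.
  have c3 : (fun we : 'rV[R]_n * 'M[R]_n => jacobian F we.1) @ set_val y -->
      jacobian F (set_val y).1.
    exact: (cvg_comp fst (jacobian F) cvg_fst (jacobian_continuous sF)).
  exact: (cvg_pair c1 (cvg_mulmx c2 c3)).
have nG : \forall we \near set_val y, G (F we.1, we.2 *m jacobian F we.1).
  apply: (cFJ G); apply: open_nbhs_nbhs; split=> //.
  by rewrite Fy Je -surjective_pairing.
have nF : \forall we \near set_val y, oriented_lift (sval d) (sval c) F we.1.
  exact (near_fst (oriented_lift_near lF)).
have nG' := near_set_val nG; have nF' := near_set_val nF.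
apply: filterS (filterI nG' nF') => y' [Gy' lF'].
have fr := chart_frames_lift (svalP d) (svalP c) lF' (_ : chart_frames g (sval d) (_, _)).
have yP : chart_frames g (sval d) ((set_val y').1, (set_val y').2).
  by rewrite -surjective_pairing; exact: set_valP.
exists (existT _ c (SigSub (mem_set (fr _ yP)))).
  have : (set_val @^-1` G) (SigSub (mem_set (fr _ yP))) by [].
  by rewrite GO.
by exists F.
Qed.

Definition orthonormalize c v (m : 'M[R]_n) := gram_schmidt (m *m gram g c v *m m^T) *m m.

Lemma spd_gram c v (m : 'M[R]_n) : atlas A c -> 0 < \det m -> spd (m *m gram g c v *m m^T).
Proof.
move=> Ac dm; split.
  by rewrite !trmx_mul trmxK (gram_sym g v Ac) mulmxA.
move=> u u0; have um : u *m m != 0.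
  apply: contra u0 => /eqP um.
  have mU : m \in unitmx by rewrite unitmxE unitfE gt_eqF.
  by rewrite -(mulmxK mU u) um mul0mx.
by have := gram_pos g v Ac um; rewrite trmx_mul !mulmxA.
Qed.

Lemma orthonormalize_frame c v (m : 'M[R]_n) : atlas A c -> 0 < \det m ->
  chart_frames g c (v, orthonormalize c v m).
Proof.
move=> Ac dm; have [sS ds] := gram_schmidtP (spd_gram v Ac dm).
split; last by rewrite /= det_mulmx mulr_gt0.
by rewrite -[RHS]sS /= /orthonormalize trmx_mul !mulmxA.
Qed.

Lemma orthonormalize_id c v e : chart_frames g c (v, e) -> orthonormalize c v e = e.
Proof. by move=> [/= ee _]; rewrite /orthonormalize ee gram_schmidt1 mul1mx. Qed.

Lemma gram_continuous c v : atlas A c -> {for v, continuous (gram g c)}.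
Proof.
move=> Ac; have H : Ck_on 0 setT (gram g c) by exact: gram_smooth.
exact: (H v I).
Qed.

Lemma orthonormalize_continuous c (vm : 'rV[R]_n * 'M[R]_n) :
    atlas A c -> 0 < \det vm.2 ->
  {for vm, continuous (fun vm => orthonormalize c vm.1 vm.2)}.
Proof.
move=> Ac dm.
have c2 : (fun vm : 'rV[R]_n * 'M[R]_n => vm.2) @ vm --> vm.2 by exact: cvg_snd.
have cg : (fun vm : 'rV[R]_n * 'M[R]_n => gram g c vm.1) @ vm --> gram g c vm.1.
  exact: (cvg_comp fst (gram g c) cvg_fst (gram_continuous Ac)).
have cm : (fun vm : 'rV[R]_n * 'M[R]_n => vm.2 *m gram g c vm.1 *m vm.2^T) @ vm -->
    vm.2 *m gram g c vm.1 *m vm.2^T.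
  exact: (cvg_mulmx (cvg_mulmx c2 cg) (cvg_trmx c2)).
apply: (cvg_mulmx (F := nbhs vm)) c2.
exact: (cvg_comp _ _ cm (gram_schmidt_continuous (spd_gram vm.1 Ac dm))).
Qed.

Definition positive : set ('rV[R]_n * 'M[R]_n) := [set vm | 0 < \det vm.2].

Lemma open_positive : open positive.
Proof.
rewrite openE => vm dm.
have : (fun vm : 'rV[R]_n * 'M[R]_n => \det vm.2) @ vm --> \det vm.2.
  by apply: (cvg_det (F := nbhs vm)); exact: cvg_snd.
by move=> /(_ [set x | 0 < x]); apply; exact: lt_nbhsr.
Qed.

Lemma chart_frames_positive c ve : chart_frames g c ve -> positive ve.
Proof. by case. Qed.

Implicit Types (ac : atlas_chart A).

(** Off [positive] the value is a default, the orthonormalised standard basis. *)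
Definition frame_at ac (vm : 'rV[R]_n * 'M[R]_n) : set_type (chart_frames g (sval ac)) :=
  match pselect (0 < \det vm.2) with
  | left H => SigSub (mem_set (orthonormalize_frame vm.1 (svalP ac) H))
  | right _ => SigSub (mem_set (orthonormalize_frame vm.1 (svalP ac)
                 (eq_ind_r (fun x => 0 < x) ltr01 (det1 R n))))
  end.

Lemma frame_atE ac vm : positive vm ->
  set_val (frame_at ac vm) = (vm.1, orthonormalize (sval ac) vm.1 vm.2).
Proof. by move=> dm; rewrite /frame_at; case: pselect. Qed.

(* The frame bundle over the chart [ac], extended to all bases [m] of positive *)
(* determinant: these form an open subset of a vector space, which retracts    *)
(* onto the orthonormal frames by the Gram-Schmidt process.                    *)
Definition frame_chart ac vm : SO_bundle g :=
  SO_pi (existT _ (ac : {classic atlas_chart A}) (frame_at ac vm) : local_frames g).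

Lemma frame_chart_continuous ac : {within positive, continuous (frame_chart ac)}.
Proof.
have cf : {within positive, continuous (frame_at ac)}.
  apply: within_set_type; apply/within_continuousP => vm V dm.
  rewrite frame_atE// => nV.
  have cv : {for vm, continuous (fun vm => (vm.1, orthonormalize (sval ac) vm.1 vm.2))}.
    exact (cvg_pair (@fst_continuous _ _ vm) (orthonormalize_continuous (svalP ac) dm)).
  have nV' : \forall w \near vm, V (w.1, orthonormalize (sval ac) w.1 w.2) by exact: cv.
  apply: filterS nV' => w Vw dw.
  by rewrite frame_atE.
have cs : continuous (fun z : set_type (chart_frames g (sval ac)) =>
    SO_pi (existT _ (ac : {classic atlas_chart A}) z : local_frames g)).
  move=> z; apply: (@continuous_comp _ _ _
    (existT (fun c : {classic atlas_chart A} => set_type (chart_frames g (sval c))) ac)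
    (@SO_pi _ _ _ _ g)).
    exact: existT_continuous.
  exact: SO_pi_continuous.
exact (within_compl cf cs).
Qed.

Lemma frame_at_frame ac ve : chart_frames g (sval ac) ve -> set_val (frame_at ac ve) = ve.
Proof.
move=> fve; rewrite frame_atE; last exact: chart_frames_positive fve.
by rewrite orthonormalize_id -?surjective_pairing.
Qed.

Lemma frame_chart_open ac ve V : chart_frames g (sval ac) ve -> nbhs ve V ->
  nbhs (frame_chart ac ve) (frame_chart ac @` (V `&` chart_frames g (sval ac))).
Proof.
move=> fve nV; pose W := V°; have oW : open W := open_interior V.
have Wve : W ve := nV; have WV : W `<=` V := @interior_subset _ V.
pose Wt := existT (fun c : {classic atlas_chart A} => set_type (chart_frames g (sval c))) ac
  @` (set_val @^-1` W).
have oWt : open (Wt : set (local_frames g)).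
  by apply: existT_open_map; exists W.
rewrite nbhsE; exists (@SO_pi _ _ _ _ g @` Wt).
  split; first exact: SO_pi_open.
  exists (existT _ ac (frame_at ac ve)) => //; exists (frame_at ac ve) => //.
  by rewrite /preimage /= frame_at_frame.
move=> _ [_ [z Wz <-] <-]; have fz := set_valP z.
exists (set_val z); first by split=> //; exact: WV.
rewrite /frame_chart; congr SO_pi; congr existT.
by apply: val_inj; exact: frame_at_frame.
Qed.

(** Moved back by a group element, the lift identifying the two frames fixes [v], so by
    [weak_lift_jacobian] it acts on frames as a group element. *)
Lemma frame_chart_inj ac v e v' e' :
    chart_frames g (sval ac) (v, e) -> chart_frames g (sval ac) (v', e') ->
    frame_chart ac (v, e) = frame_chart ac (v', e') ->
  exists2 a, chart_group (sval ac) a & v' = v *m a /\ e' = e *m a.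
Proof.
move=> fve fve' /SO_piP[F]; rewrite /lf_chart /lf_point /lf_frame /=.
rewrite !frame_at_frame// => -[/oriented_weak_lift lF /= Fv Je].
have : fold (sval ac) v = fold (sval ac) v' by rewrite -Fv; case: lF => _ /nbhs_singleton.
move=> /fold_fiber[b cb v'E].
have lG := weak_lift_comp lF (weak_lift_mulmxr (F v) (chart_groupV cb)).
have ub := chart_group_unit cb.
have [|a ca [va Ja]] := weak_lift_jacobian lG; first by rewrite /= Fv v'E mulmxK.
rewrite (jacobian_comp lF.1 (differentiable_mulmxr _ _)) jacobian_mulmxr in Ja.
exists (a *m b); first exact: chart_groupM.
by rewrite mulmxA va -v'E -Ja mulmxKV.
Qed.

Lemma frame_chart_proj ac vm : SO_proj (frame_chart ac vm) = fold (sval ac) vm.1.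
Proof.
rewrite /frame_chart SO_proj_pi /lf_chart /lf_point /=; congr fold.
by rewrite /frame_at; case: pselect.
Qed.

Lemma frame_chart_surj ac v (b : SO_bundle g) : fold (sval ac) v = SO_proj b ->
  exists2 e, chart_frames g (sval ac) (v, e) & frame_chart ac (v, e) = b.
Proof.
rewrite -(SO_pi_repr b); set q := SO_repr b; rewrite SO_proj_pi => fv.
have [F [lF Fv]] := lift_exists (lf_atlas q) (svalP ac) (esym fv).
have fq : chart_frames g (lf_chart q) (lf_point q, lf_frame q).
  by rewrite -surjective_pairing; exact: set_valP.
have fr := chart_frames_lift (lf_atlas q) (svalP ac) lF fq.
rewrite Fv in fr; exists (lf_frame q *m jacobian F (lf_point q)) => //.
apply/esym/SO_piP; exists F; rewrite /lf_chart /lf_point /lf_frame /=.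
by rewrite frame_at_frame.
Qed.

End FrameBundleCharts.

(** * Regular points *)

Section ArctangentChart.
Context {R : realType}.
Implicit Types (V : normedModType R).

Lemma diff_comp1 V (f : V -> R) (phi : R -> R) (dphi : R) v :
    differentiable f v -> is_derive (f v) 1 phi dphi ->
  differentiable (phi \o f) v /\ forall h, 'd (phi \o f) v h = 'd f v h * dphi.
Proof.
move=> df [dp <-]; have dphi' := (derivable1_diffP phi (f v)).1 dp.
split; first exact: differentiable_comp.
by move=> h; rewrite (diff_comp df dphi') /= (deriv1E dp) derive1E.
Qed.

Lemma CkS_comp1 V k (U : set V) (f : V -> R) (phi dphi : R -> R) :
    open U -> (forall v, U v -> is_derive (f v) 1 phi (dphi (f v))) ->
  Ck_on k.+1 U f -> Ck_on k U (dphi \o f) -> Ck_on k.+1 U (phi \o f).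
Proof.
move=> oU pD cf cd; have [df df'] := cf.
have key v (Uv : U v) := diff_comp1 (df v Uv) (pD v Uv).
split=> [v Uv|h]; first by have [] := key v Uv.
have cs : Ck_on k U ((fun v => 'd f v h) * (dphi \o f)) by exact (CkM oU (df' h) cd).
by apply: Ck_eq oU _ cs => v Uv; have [_ ->] := key v Uv.
Qed.

(** The tangent solves [y' = 1 + y^2]: its derivative is polynomial in itself, so each order of
    smoothness gives the next. Inverses are treated likewise. *)
Lemma smooth_on_tan V (U : set V) (f : V -> R) : open U ->
  (forall v, U v -> cos (f v) != 0) -> smooth_on U f -> smooth_on U (tan \o f).
Proof.
move=> oU cf sf; elim=> [|k IH].
  move=> v Uv; apply: continuous_comp; first exact: (sf 0%N).
  by apply: continuous_tan; exact: cf.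
apply: (CkS_comp1 (dphi := fun x => 1 + tan x * tan x)) => //.
  by move=> v Uv; rewrite -expr2 -cos2_tan2 ?cf//; exact: is_derive_tan (cf v Uv).
have c1 : Ck_on k U (cst 1 : V -> R) by exact: Ck_cst.
exact (CkD oU c1 (CkM oU IH IH)).
Qed.

Lemma smooth_on_inv V (U : set V) (f : V -> R) : open U ->
  (forall v, U v -> f v != 0) -> smooth_on U f -> smooth_on U (fun v => (f v)^-1).
Proof.
move=> oU f0 sf; change (smooth_on U (GRing.inv \o f)); elim=> [|k IH].
  by move=> v Uv; apply: (cvgV (f0 v Uv)); exact: (sf 0%N).
apply: (CkS_comp1 (dphi := fun x => - 1 * (x^-1 * x^-1))) => //.
  move=> v Uv; apply: DeriveDef; first by apply: derivableV => //; exact: f0.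
  rewrite deriveV ?f0// derive_id /GRing.scale /= mulr1 mulN1r expr2 invfM //.
have c1 : Ck_on k U (cst (- 1) : V -> R) by exact: Ck_cst.
exact (CkM oU c1 (CkM oU IH IH)).
Qed.

Lemma smooth_on_atan V (U : set V) (f : V -> R) : open U ->
  smooth_on U f -> smooth_on U (atan \o f).
Proof.
move=> oU sf [|k].
  move=> v Uv; apply: continuous_comp; first exact: (sf 0%N).
  exact: continuous_atan.
have dD v (_ : U v) : is_derive (f v) 1 atan (1 + f v * f v)^-1.
  by rewrite -expr2; exact: is_derive1_atan.
apply: (CkS_comp1 (dphi := fun x => (1 + x * x)^-1) oU dD (sf k.+1)).
apply: (@smooth_on_inv _ _ (fun v => 1 + f v * f v) oU).
  by move=> v _; rewrite gt_eqF// ltr_pwDl// -expr2 sqr_ge0.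
move=> j; have c1 : Ck_on j U (cst 1 : V -> R) by exact: Ck_cst.
exact (CkD oU c1 (CkM oU (sf j) (sf j))).
Qed.

Context {n : nat}.
Variables (r : R) (v : 'rV[R]_n).
Hypothesis r0 : 0 < r.
Implicit Types (u w h : 'rV[R]_n).

Definition cube := [set w : 'rV[R]_n | forall i, - (trigo.pi / 2) < (w 0 i - v 0 i) / r < trigo.pi / 2].
(** A chart is parametrised by all of [R^n], so restricting one to a small cube requires a
    diffeomorphism of [R^n] onto the cube. *)
Definition to_cube u : 'rV[R]_n := \row_i (v 0 i + r * atan (u 0 i)).
Definition of_cube w : 'rV[R]_n := \row_i tan ((w 0 i - v 0 i) / r).

Lemma to_cubeE u i : (to_cube u 0 i - v 0 i) / r = atan (u 0 i).
Proof. by rewrite mxE addrAC subrr add0r mulrC mulKf// gt_eqF. Qed.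

Lemma to_cube_in u : cube (to_cube u).
Proof. by move=> i; rewrite to_cubeE atan_gtNpi2 atan_ltpi2. Qed.

Lemma to_cubeK : cancel to_cube of_cube.
Proof. by move=> u; apply/rowP => i; rewrite mxE to_cubeE atanK. Qed.

Lemma of_cubeK w : cube w -> to_cube (of_cube w) = w.
Proof.
move=> cw; apply/rowP => i; rewrite !mxE tanK; last by rewrite in_itv /=; exact: cw.
by rewrite mulrC divfK ?gt_eqF// addrC subrK.
Qed.

Lemma cube_center : cube v.
Proof. by move=> i; rewrite subrr mul0r oppr_lt0 divr_gt0// trigo.pi_gt0. Qed.

Lemma smooth_coord (U : set 'rV[R]_n) i : smooth_on U (fun w => w 0 i).
Proof.
move=> k; have cT : Ck_on k setT (fun w : 'rV[R]_n => w 0 i).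
  apply: (Ck_coord i openT (F := @id 'rV[R]_n)).
  exact: (@Ck_linear _ _ _ k setT idfun (fun x => @cvg_id _ _)).
have sC j (F' : 'rV[R]_n -> R) : Ck_on j setT F' -> Ck_on j U F'.
  elim: j F' => [|j IH] F' /=; first by move=> H w _; exact: H.
  by move=> [H1 H2]; split=> [w _|h]; [exact: H1|exact/IH/H2].
exact: sC.
Qed.

Lemma smooth_on_affine (U : set 'rV[R]_n) i (a b : R) : open U ->
  smooth_on U (fun w => a + b * w 0 i).
Proof.
move=> oU k; have ca : Ck_on k U (cst a : 'rV[R]_n -> R) by exact: Ck_cst.
have cb : Ck_on k U (cst b : 'rV[R]_n -> R) by exact: Ck_cst.
exact (CkD oU ca (CkM oU cb (smooth_coord U i k))).
Qed.

Lemma open_cube : open cube.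
Proof.
rewrite openE => w cw.
change (nbhs w cube).
apply: (@filter_forall _ _ (fun i (x : 'rV[R]_n) =>
  - (trigo.pi / 2) < (x 0 i - v 0 i) / r < trigo.pi / 2) (nbhs w)) => i.
have cc : (fun x : 'rV[R]_n => (x 0 i - v 0 i) / r) @ w --> (w 0 i - v 0 i) / r.
  exact: (cvgM (cvgB (@coord_continuous _ _ _ 0 i w) (cvg_cst _)) (cvg_cst _)).
have /andP[c1 c2] := cw i.
have n1 : nbhs w [set x : 'rV[R]_n | - (trigo.pi / 2) < (x 0 i - v 0 i) / r] by exact: cc (lt_nbhsr c1).
have n2 : nbhs w [set x : 'rV[R]_n | (x 0 i - v 0 i) / r < trigo.pi / 2] by exact: cc (lt_nbhsl c2).
by apply: filterS (filterI n1 n2) => x [x1 x2]; apply/andP.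
Qed.

Lemma smooth_to_cube : smooth_on setT to_cube.
Proof.
move=> k; apply: (Ck_row openT) => i.
have st := smooth_on_atan openT (smooth_coord setT i).
have ca : Ck_on k setT (cst (v 0 i) : 'rV[R]_n -> R) by exact: Ck_cst.
have cb : Ck_on k setT (cst r : 'rV[R]_n -> R) by exact: Ck_cst.
have cs := CkD openT ca (CkM openT cb (st k)).
by apply: Ck_eq openT _ cs => u _; rewrite mxE.
Qed.

Lemma smooth_of_cube : smooth_on cube of_cube.
Proof.
move=> k; apply: (Ck_row open_cube) => i.
have sa := smooth_on_affine i (- (v 0 i / r)) r^-1 open_cube.
have fE w : - (v 0 i / r) + r^-1 * w 0 i = (w 0 i - v 0 i) / r.
  by rewrite mulrBl addrC mulrC.
have st : smooth_on cube (tan \o (fun w => - (v 0 i / r) + r^-1 * w 0 i)).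
  apply: smooth_on_tan sa => //; first exact: open_cube.
  by move=> w cw; rewrite fE gt_eqF// cos_gt0_pihalf//; exact: cw.
by apply: Ck_eq open_cube _ (st k) => w _; rewrite mxE /= fE.
Qed.

Lemma smooth_near_to_cube u : smooth_near u to_cube.
Proof. by exists setT; [split=> //; exact: openT|exact: smooth_to_cube]. Qed.

Lemma smooth_near_of_cube w : cube w -> smooth_near w of_cube.
Proof. by exists cube; [split=> //; exact: open_cube|exact: smooth_of_cube]. Qed.

Lemma diff_coord (F : 'rV[R]_n -> 'rV[R]_n) u h i : differentiable F u ->
  'd (fun w => F w 0 i) u h = ('d F u h) 0 i.
Proof.
move=> dF.
have lin : linear (fun x : 'rV[R]_n => x 0 i : R^o) by move=> a x y; rewrite !mxE.
pose Lm := GRing.isLinear.Build _ _ _ _ _ lin.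
pose L : {linear 'rV[R]_n -> R^o} := HB.pack (fun x : 'rV[R]_n => x 0 i : R^o) Lm.
have cL : continuous L by exact: coord_continuous.
have dL : differentiable L (F u) by exact: linear_differentiable.
change ('d (L \o F) u h = L ('d F u h)).
rewrite (diff_comp dF dL); change ('d L (F u) ('d F u h) = L ('d F u h)).
by rewrite (diff_lin _ cL).
Qed.

Lemma jacobian_to_cube u : jacobian to_cube u = diag_mx (\row_i (r / (1 + u 0 i ^+ 2))).
Proof.
have dF := smooth_near_differentiable (smooth_near_to_cube u).
apply: mulmx_rV_inj => h; rewrite mulmx_jacobian; apply/rowP => j.
rewrite -(diff_coord h j dF) mul_mx_diag !mxE.
have sa := smooth_coord setT j 1%N.
have [da _] := sa; have {}da := da u I.
have [dat datE] := diff_comp1 da (is_derive1_atan (u 0 j)).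
have -> : (fun w => to_cube w 0 j) = cst (v 0 j) + r *: (atan \o (fun w => w 0 j)).
  by apply/funext => w; rewrite mxE.
rewrite (diffD (differentiable_cst _ _) (differentiableZ _ dat)).
rewrite diff_cst (diffZ _ dat).
change (0 + r * 'd (atan \o (fun w : 'rV[R]_n => w 0 j)) u h = h 0 j * (r / (1 + u 0 j ^+ 2))).
rewrite datE.
have -> : (fun w : 'rV[R]_n => w 0 j) = (fun w => mulmxr 1%:M w 0 j).
  by apply/funext => w; rewrite /= mulmx1.
rewrite (diff_coord h j (differentiable_mulmxr _ _)) -mulmx_jacobian jacobian_mulmxr.
by rewrite mulmx1 add0r mulrCA.
Qed.

Lemma det_jacobian_to_cube u : 0 < \det (jacobian to_cube u).
Proof.
rewrite jacobian_to_cube det_diag; apply: prodr_gt0 => i _.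
by rewrite mxE divr_gt0// ltr_pwDl// sqr_ge0.
Qed.

Lemma det_jacobian_of_cube w : cube w -> 0 < \det (jacobian of_cube w).
Proof.
move=> cw; set u := of_cube w; have uw : to_cube u = w by exact: of_cubeK.
have dt := smooth_near_differentiable (smooth_near_to_cube u).
have dof : differentiable of_cube (to_cube u).
  by rewrite uw; exact: smooth_near_differentiable (smooth_near_of_cube cw).
have := jacobian_comp dt dof; rewrite uw.
have -> : of_cube \o to_cube = mulmxr 1%:M.
  by apply/funext => x; rewrite /= to_cubeK mulmx1.
rewrite jacobian_mulmxr => /(congr1 determinant); rewrite det1 det_mulmx => E.
by rewrite -(pmulr_rgt0 _ (det_jacobian_to_cube u)) -E.
Qed.

End ArctangentChart.

Lemma det_mulmx_gt0 {R : realType} {n} (a b : 'M[R]_n) :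
  0 < \det a -> 0 < \det b -> 0 < \det (a *m b).
Proof. by move=> a0 b0; rewrite det_mulmx mulr_gt0. Qed.

(** * Regular points as points with trivial stabiliser *)

Section RegularPoints.
Context {R : realType} {n : nat} {M : topologicalType}.
Variable (A : oriented_atlas R n M).
Implicit Types (c d : chart R n M) (v w u : 'rV[R]_n).

Definition free_point c v := forall a, chart_group c a -> v *m a = v -> a = 1%:M.

(** Let [F] be a lift to a chart with trivial group. If [a] fixes [v], then [F \o mulmxr a] is a
    lift too, so it equals [F] near [v]; comparing the invertible Jacobians gives [a = 1]. *)
Lemma regular_free_point c v : atlas A c -> (~` singular_set A) (fold c v) -> free_point c v.
Proof.
move=> Ac /regularP[d [Ad d1 [w _ wv]]] a ca va.
have [F [lF _]] := lift_exists Ac Ad (esym wv).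
have wF := oriented_weak_lift lF; have wa := weak_lift_mulmxr v ca.
have waF : weak_lift c d (F \o mulmxr a) v by apply: (weak_lift_comp wa); rewrite /= va.
have FE : \forall u \near v, F u = (F \o mulmxr a) u.
  apply: filterS (filterI wF.2 waF.2) => u [Fu Fau].
  have [b + ->] := (fold_fiber d (F u) ((F \o mulmxr a) u)).1 (etrans Fu (esym Fau)).
  by rewrite d1 => ->; rewrite mulmx1.
have [_ dE] := near_is_diff FE wF.1.
have dF' : differentiable F (mulmxr a v) by rewrite /= va; exact: wF.1.
have JE : jacobian (F \o mulmxr a) v = jacobian F v.
  apply: mulmx_rV_inj => h.
  exact (etrans (mulmx_jacobian _ _ _)
    (etrans (congr1 (fun f => f h) dE) (esym (mulmx_jacobian F v h)))).
move: JE; rewrite (jacobian_comp wa.1 dF') jacobian_mulmxr /= va => JE.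
have uJ : jacobian F v \in unitmx by rewrite unitmxE unitfE; case: lF => _ _ /gt_eqF ->.
by rewrite -(mulmxK uJ a) JE mulmxV.
Qed.

(** For each of the finitely many [a] other than 1, [w' - w *m a] is close to [v - v *m a], which is
    nonzero. The number of rows is arbitrary: the lemma is used for points and for frames. *)
Lemma free_neighborhood c {m} (v : 'M[R]_(m, n)) :
    (forall a, chart_group c a -> v *m a = v -> a = 1%:M) ->
  exists2 e : R, 0 < e &
  forall (w w' : 'M[R]_(m, n)) a, ball v e w -> ball v e w' -> chart_group c a ->
    w' = w *m a -> a = 1%:M.
Proof.
move=> fv; have [/finite_seqP[s sE] _ _ _ _] := chart_groupP c.
pose P (a : 'M[R]_n) (ww : 'M[R]_(m, n) * 'M[R]_(m, n)) := a <> 1%:M -> ww.2 <> ww.1 *m a.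
have nP a : a \in s -> nbhs (v, v) (P a).
  move=> sa; have [a1|a1] := pselect (a = 1%:M).
    by apply: filterS filterT => ww _.
  have va : v - v *m a != 0.
    by rewrite subr_eq0; apply/eqP => /esym va; apply/a1/fv => //; rewrite sE.
  have c1 : (fun ww : 'M[R]_(m, n) * 'M[R]_(m, n) => ww.1 *m a) @ (v, v) --> v *m a.
    exact: (cvg_comp fst (mulmxr a) (@fst_continuous _ _ (v, v)) (@continuous_mulmxr _ _ _ _ a v)).
  have c2 : (fun ww : 'M[R]_(m, n) * 'M[R]_(m, n) => ww.2) @ (v, v) --> v.
    exact: (@snd_continuous _ _ (v, v)).
  have nz : nbhs (v - v *m a) [set x | x != 0].
    by apply: open_nbhs_nbhs; split=> //; exact: open_neq0.
  have nn : nbhs (v, v) [set ww : 'M[R]_(m, n) * 'M[R]_(m, n) | ww.2 - ww.1 *m a != 0].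
    exact: (cvgB c2 c1 nz).
  apply: filterS nn => ww /= /eqP ww0 _ E; apply: ww0.
  by rewrite E subrr.
have nPs : nbhs (v, v) [set ww | forall a, a \in s -> P a ww].
  elim: s {sE} nP => [|a s IH] nP; first by apply: filterS filterT.
  have IHs := IH (fun b sb => nP b (mem_behead (s := a :: s) sb)).
  apply: filterS (filterI (nP a (mem_head _ _)) IHs) => t [Pa Ps] b.
  by rewrite inE => /predU1P[->//|]; exact: Ps.
have /nbhs_ballP[e /= e0 eP] := nPs; exists e => // w w' a vw vw' ca w'E.
apply: contrapT => a1; apply: (eP (w, w') _ a _ a1) => //.
by rewrite sE in ca.
Qed.

Section CubeChart.
Variables (c : chart R n M) (r : R) (v : 'rV[R]_n).
Hypothesis r0 : 0 < r.
Hypothesis cube_free : forall w w' a, cube r v w -> cube r v w' -> chart_group c a ->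
  w' = w *m a -> a = 1%:M.

Local Lemma cube_group : finite_subgroup_SO [set (1%:M : 'M[R]_n)].
Proof.
split=> //.
- by move=> a b -> ->; rewrite /= mulmx1.
- by move=> a -> /=; rewrite invmx1.
- by move=> a ->; rewrite trmx1 mulmx1 det1.
Qed.

Local Definition cube_fold u := fold c (to_cube r v u).

Local Lemma to_cube_continuous : continuous (to_cube r v).
Proof. by move=> u; exact: (@smooth_to_cube R n r v 0%N u I). Qed.

Local Lemma cube_fold_continuous : continuous cube_fold.
Proof.
move=> u; apply: (@continuous_comp _ _ _ (to_cube r v) (fold c)).
  exact: to_cube_continuous.
exact: fold_continuous.
Qed.

Local Lemma cube_fold_open W : open W -> open (cube_fold @` W).
Proof.
move=> oW; rewrite /cube_fold -(image_comp (to_cube r v) (fold c)); apply: fold_open.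
have -> : to_cube r v @` W = cube r v `&` of_cube r v @^-1` W.
  apply/seteqP; split=> [_ [u Wu <-]|w [cw Ww]].
    by split; [exact: to_cube_in|rewrite /preimage /= to_cubeK].
  by exists (of_cube r v w) => //; exact: of_cubeK.
rewrite openE => w [cw Ww]; apply: filterI.
  by apply: open_nbhs_nbhs; split=> //; exact: open_cube.
have cc : {for w, continuous (of_cube r v)} by exact: (@smooth_of_cube R n r v 0%N w cw).
by apply: cc; exact: open_nbhs_nbhs.
Qed.

Local Lemma cube_fold_fiber u w :
  cube_fold u = cube_fold w <-> exists2 a, [set (1%:M : 'M[R]_n)] a & w = u *m a.
Proof.
split=> [/fold_fiber[a ca uw]|[a -> ->]]; last by rewrite mulmx1.
have a1 := cube_free (to_cube_in v r0 u) (to_cube_in v r0 w) ca uw.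
exists a => //; rewrite a1 !mulmx1 in uw *.
by rewrite -(to_cubeK v r0 w) uw to_cubeK.
Qed.

Definition cube_chart : chart R n M :=
  Chart cube_group cube_fold_continuous cube_fold_open cube_fold_fiber.

Lemma cube_chart_compatible d : atlas A c -> atlas A d ->
  compatible cube_chart d /\ compatible d cube_chart.
Proof.
move=> Ac Ad; split=> [u|w].
  rewrite /= /cube_fold => du; have [F lF] := atlas_compatible Ac Ad du.
  have [sF nF dF] := lF; exists (F \o to_cube r v).
  have st := smooth_near_to_cube r v u; split.
  - exact: smooth_near_comp st sF.
  - exact: (to_cube_continuous nF).
  - rewrite (jacobian_comp (smooth_near_differentiable st) (smooth_near_differentiable sF)).
    exact (det_mulmx_gt0 (det_jacobian_to_cube v r0 u) dF).
move=> [u _ uw]; have [F [lF Fw]] := lift_exists Ad Ac (esym uw).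
have [sF nF dF] := lF.
have cF : cube r v (F w) by rewrite Fw; exact: to_cube_in.
have so := smooth_near_of_cube cF.
exists (of_cube r v \o F); split.
- exact: smooth_near_comp sF so.
- have nC : \forall x \near w, cube r v (F x).
    apply: (differentiable_continuous (smooth_near_differentiable sF)).
    by apply: open_nbhs_nbhs; split=> //; exact: open_cube.
  by apply: filterS (filterI nF nC) => x [<- Cx]; rewrite /= /cube_fold of_cubeK.
- rewrite (jacobian_comp (smooth_near_differentiable sF) (smooth_near_differentiable so)).
  exact (det_mulmx_gt0 dF (det_jacobian_of_cube r0 cF)).
Qed.

End CubeChart.

(** On a small cube around [v] the group makes no identification, so the reparametrised cube is a
    chart with trivial group; it belongs to the atlas by maximality. *)
Lemma free_point_regular c v : maximal_atlas A -> atlas A c -> free_point c v ->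
  (~` singular_set A) (fold c v).
Proof.
move=> mA Ac fv; have [e e0 eF] := free_neighborhood fv.
(* The cube with parameter [e / 2] has half-width [e / 2] times [pi / 2], which is less than [e]
   because [pi / 2 < 2]. *)
have r0 : 0 < e / 2 by rewrite divr_gt0.
have cb w : cube (e / 2) v w -> ball v e w.
  move=> cw; split=> [//|i j]; rewrite !ord1 /ball /=; have /andP[w1 w2] := cw j.
  have := @trigo.pihalf_lt2 R; rewrite ltr_distlC.
  move: w1 w2; rewrite ltr_pdivlMr// ltr_pdivrMr// => w1 w2 p2.
  by apply/andP; split; nra.
have cf w w' a : cube (e / 2) v w -> cube (e / 2) v w' -> chart_group c a ->
    w' = w *m a -> a = 1%:M by move=> /cb w1 /cb w2; exact: eF.
have Acc : atlas A (cube_chart r0 cf).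
  by apply: mA => d Ad; exact: cube_chart_compatible.
apply: (trivial_chart_regular Acc) => //.
exists (of_cube (e / 2) v v) => //=; rewrite /cube_fold of_cubeK//.
exact: cube_center.
Qed.

Lemma minimal_chart_exists x : exists c, minimal_chart A x c.
Proof.
pose P k := `[< exists c, [/\ atlas A c, chart_dom c x & chart_group c #= `I_k] >].
have exP : exists k, P k.
  have [c Ac cx] := atlas_cover A x.
  have [[k ck] _ _ _ _] := chart_groupP c.
  by exists k; apply/asboolP; exists c.
have [k /asboolP[c [Ac cx ck]] kmin] := ex_minnP exP.
exists c; split=> // d Ad dx.
have [[l dl] _ _ _ _] := chart_groupP d.
have kl : (k <= l)%N by apply: kmin; apply/asboolP; exists d.
by rewrite (card_le_eql ck) (card_le_eqr dl) card_le_II.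
Qed.

(** The subspaces are the fixed spaces of the nontrivial elements of the chart group, which is a
    singularity group as the chart is minimal. *)
Lemma free_point_subspaces x c : singular_codim_ge A 4 -> minimal_chart A x c ->
  exists2 Qs : seq 'M[R]_n, codims_ge 4 Qs &
    forall v, free_point c v <-> ~~ on_some Qs v.
Proof.
move=> cod mc; have [/finite_seqP[s sE] _ _ _ _] := chart_groupP c.
have s_in a : a \in s = `[< chart_group c a >] by apply/idP/asboolP; rewrite sE.
exists [seq eigenspace a 1 | a <- s & a != 1%:M].
  rewrite /codims_ge all_map; apply/allP => a /=; rewrite mem_filter s_in.
  move=> /andP[/eqP a1 /asboolP ca].
  have := cod x _ a (ex_intro2 _ _ c mc erefl) ca a1; rewrite /fixed_codim.
  rewrite leq_subRL; last exact: rank_leq_row.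
  by [].
move=> v; split=> [fv|/hasPn nv a ca va].
  apply/hasPn => _ /mapP[a + ->]; rewrite mem_filter s_in => /andP[a1 /asboolP ca].
  apply/negP => /eigenspaceP; rewrite scale1r => va.
  by move/eqP: a1; apply; exact: fv.
apply: contrapT => /eqP a1.
have aE : eigenspace a 1 \in [seq eigenspace a 1 | a <- s & a != 1%:M].
  by apply: map_f; rewrite mem_filter a1 s_in; apply/asboolP.
move/negP: (nv _ aE); apply.
by apply/eigenspaceP; rewrite scale1r.
Qed.

End RegularPoints.

(** * Spin structures *)

Section RegularFrames.
Context {R : realType} {n : nat} {M : topologicalType}.
Variables (A : oriented_atlas R n M) (g : riemannian_metric A).
Local Notation g' := (regular_metric g).
Local Notation incl := (@local_frames_incl _ _ _ _ g).
Local Notation so_incl := (@SO_incl _ _ _ _ g).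

Lemma local_frames_inclP (p q : local_frames g') :
  frame_transition (incl p) (incl q) <-> frame_transition p q.
Proof.
split=> [[F [lF Fp Je]]|[F [lF Fp Je]]]; exists F; split => //.
  case: lF => sF nF dF; split; [exact: sF| |exact: dF].
  by apply: filterS nF => w /val_inj.
exact: chart_incl_lift.
Qed.

Lemma SO_incl_pi (p : local_frames g') : so_incl (SO_pi p) = SO_pi (incl p).
Proof. by apply/SO_piP/local_frames_inclP/SO_piP; exact: SO_pi_repr. Qed.

Lemma SO_incl_inj : injective so_incl.
Proof.
move=> b b'; rewrite -(SO_pi_repr b) -(SO_pi_repr b') !SO_incl_pi.
by move=> /SO_piP/local_frames_inclP/SO_piP.
Qed.

Lemma local_frames_incl_continuous : continuous incl.
Proof. by move=> [c z] V nV; exact: nV. Qed.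

Lemma SO_incl_continuous : continuous so_incl.
Proof.
apply/quotient_continuous.
change (continuous (so_incl \o @SO_pi _ _ _ _ g')).
have -> : so_incl \o @SO_pi _ _ _ _ g' = @SO_pi _ _ _ _ g \o incl by apply/funext => p; exact: SO_incl_pi.
move=> p; apply: continuous_comp; first exact: local_frames_incl_continuous.
exact: SO_pi_continuous.
Qed.

Lemma local_frames_incl_open (O : set (local_frames g')) : open O -> open (incl @` O).
Proof.
move=> oO; rewrite openE => _ [[c z] Oz <-].
have /sigT_openP/(_ c) oOc := oO.
have nOc : nbhs z (existT (fun c : {classic atlas_chart (regular_atlas A)} =>
  set_type (chart_frames g' (sval c))) c @^-1` O) by exact: open_nbhs_nbhs.
have nI : nbhs z [set y | (incl @` O) (incl (existT _ c y))].
  by apply: filterS nOc => y Oy; exists (existT _ c y).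
exact: nI.
Qed.

Lemma SO_incl_open (W : set (SO_bundle g')) : open W -> open (so_incl @` W).
Proof.
move=> oW.
have -> : so_incl @` W = @SO_pi _ _ _ _ g @` (incl @` (@SO_pi _ _ _ _ g' @^-1` W)).
  apply/seteqP; split=> [_ [b Wb <-]|_ [_ [p Wp <-] <-]].
    exists (incl (SO_repr b)); last by rewrite -SO_incl_pi SO_pi_repr.
    by exists (SO_repr b) => //; rewrite /preimage /= SO_pi_repr.
  by exists (SO_pi p) => //; exact: SO_incl_pi.
apply/SO_pi_open/local_frames_incl_open.
by apply: open_comp => // p _; exact: SO_pi_continuous.
Qed.

Lemma SO_proj_incl (b : SO_bundle g') : SO_proj (so_incl b) = regular_val (SO_proj b).
Proof. by rewrite -(SO_pi_repr b) SO_incl_pi !SO_proj_pi. Qed.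

Lemma range_SO_incl (b : SO_bundle g) :
  range so_incl b <-> (~` singular_set A) (SO_proj b).
Proof.
split=> [[b' _ <-]|/regularP[c [Ac c1 [v _ vb]]]].
  by rewrite SO_proj_incl; exact: set_valP.
have [c' c'E] := chart_incl_surj Ac c1.
move: Ac c1 vb; rewrite -{}c'E => Ac c1 vb.
have [e fe eb] := @frame_chart_surj _ _ _ _ g (exist _ _ Ac) v b vb.
pose z := frame_at g (exist _ _ Ac : atlas_chart A) (v, e) : set_type (chart_frames g (chart_incl c')).
pose p : local_frames g' := existT _ (exist _ c' (conj Ac c1) :
  {classic atlas_chart (regular_atlas A)}) (z : set_type (chart_frames g' c')).
exists (SO_pi p) => //; rewrite SO_incl_pi -eb; apply/SO_piP.
apply: weak_transition_oriented; [exact: lf_atlas|exact: lf_atlas|].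
exact: weak_transition_refl.
Qed.

End RegularFrames.

(** * Frames over singular points *)

Section RegularFramesComplement.
Context {R : realType} {n : nat} {M : topologicalType}.
Variables (A : oriented_atlas R n M) (g : riemannian_metric A).
Hypothesis maxA : maximal_atlas A.
Hypothesis codimA : singular_codim_ge A 4.
Local Notation so_incl := (@SO_incl _ _ _ _ g).
Local Notation fc := (frame_chart g).
Implicit Types (ac : atlas_chart A) (ve w : 'rV[R]_n * 'M[R]_n) (Qs : seq 'M[R]_n).

(** The ball lies in the vector space of pairs of a point and a matrix, where segments and linear
    subspaces make sense; orthonormal frames enter only through the centre and the injectivity of
    [frame_chart]. *)
Record adapted_ball ac ve Qs (r : R) : Prop := AdaptedBall {
  ab_radius : 0 < r ;
  ab_codim : codims_ge 4 Qs ;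
  ab_positive : ball ve r `<=` positive ;
  ab_center : chart_frames g (sval ac) ve ;
  ab_regular : forall w, range so_incl (fc ac w) <-> ~~ on_some Qs w.1 ;
  ab_inj : forall w w', ball ve r w -> ball ve r w' ->
    chart_frames g (sval ac) w -> chart_frames g (sval ac) w' ->
    fc ac w = fc ac w' -> w = w' }.

Lemma adapted_chart x : exists ac v Qs,
  [/\ fold (sval ac) v = x, codims_ge 4 Qs &
      forall u, free_point (sval ac) u <-> ~~ on_some Qs u].
Proof.
have [c mc] := minimal_chart_exists A x; have [Ac [v _ vx] _] := mc.
have [Qs cQs fQs] := free_point_subspaces codimA mc.
by exists (exist _ c Ac), v, Qs.
Qed.

Lemma range_frame_chart ac w : range so_incl (fc ac w) <-> free_point (sval ac) w.1.
Proof.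
split=> [/range_SO_incl|fw]; first by rewrite frame_chart_proj; exact: regular_free_point (svalP ac).
by apply/range_SO_incl; rewrite frame_chart_proj; exact: free_point_regular (svalP ac) fw.
Qed.

Lemma adapted_ball_exists (b : SO_bundle g) V : nbhs b V -> exists ac ve Qs r,
  [/\ adapted_ball ac ve Qs r, fc ac ve = b & fc ac @` ball ve r `<=` V].
Proof.
move=> nV; have [ac [v [Qs [vb cQs fQs]]]] := adapted_chart (SO_proj b).
have [e fe eb] := frame_chart_surj vb.
have de := chart_frames_positive fe.
have ue : e \in unitmx by rewrite unitmxE unitfE gt_eqF.
(* Applied to the basis [e], not to the point [v]: the group acts freely on bases even where [v] is
   singular, which gives injectivity on orthonormal frames. *)
have [|r1 r10 free1] := @free_neighborhood _ _ _ (sval ac) _ e.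
  by move=> a ca ea; rewrite -(mulKmx ue a) ea mulVmx.
have nP : nbhs (v, e) positive by apply: open_nbhs_nbhs; split=> //; exact: open_positive.
have nfV : \forall w \near (v, e), positive w -> V (fc ac w).
  have /within_continuousP := @frame_chart_continuous _ _ _ _ g ac.
  by apply=> //; rewrite eb.
have nB : nbhs (v, e) (ball (v, e) r1) by exact: nbhsx_ballx.
have /nbhs_ballP[r /= r0 rP] : nbhs (v, e) (positive `&`
    ([set w | positive w -> V (fc ac w)] `&` ball (v, e) r1)).
  by apply: filterI => //; exact: filterI.
exists ac, (v, e), Qs, r; split=> //; last first.
  by move=> _ [w /rP[pw [fw _]] <-]; exact: fw.
split=> //.
- by move=> w /rP[].
- by move=> w; split=> [/range_frame_chart/fQs|/fQs/range_frame_chart].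
- move=> [w1 w2] [w1' w2'] /rP[_ [_ bw]] /rP[_ [_ bw']] fw fw' E.
  have [a ca [-> w2E]] := frame_chart_inj fw fw' E.
  by rewrite w2E (free1 _ _ _ bw.2 bw'.2 ca w2E) !mulmx1.
Qed.

Lemma adapted_ball_nbhs ac ve Qs r : adapted_ball ac ve Qs r ->
  nbhs (fc ac ve) (fc ac @` (ball ve r `&` chart_frames g (sval ac))).
Proof.
move=> ab; apply: frame_chart_open (ab_center ab) _.
exact: nbhsx_ballx (ab_radius ab).
Qed.

(** The image of a small adapted ball meets SO(M \ S) in the image of the cut ball, which is
    nonempty and connected. *)
Lemma frames_locally_connected : locally_connected_in setT (range so_incl).
Proof.
move=> b V _ nV; have [ac [ve [Qs [r [ab <- rV]]]]] := adapted_ball_exists nV.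
have [r0 cQs pos _ reg _] := ab.
exists (fc ac @` ball ve r); split=> //.
- by apply: filterS (adapted_ball_nbhs ab) => _ [w [bw _] <-]; exists w.
- have cQ1 := codims_geS (codims_geS (codims_geS cQs)).
  have [w [bw wQ]] := cut_ball_nonempty ve r0 cQ1.
  by exists (fc ac w); split; [exists w|exact/reg].
- have -> : fc ac @` ball ve r `&` range so_incl = fc ac @` cut_ball Qs ve r.
    apply/seteqP; split=> [_ [[w bw <-] /reg wQ]|_ [w [bw wQ] <-]]; first by exists w.
    by split; [exists w|exact/reg].
  apply: connected_continuous_connected.
    exact: cut_ball_connected (codims_geS (codims_geS cQs)).
  apply: continuous_subspaceW (@frame_chart_continuous _ _ _ _ g ac).
  by move=> w [/pos].
Qed.

(** [om] picks the only orthonormal frame of the ball above [b]; it is continuous because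
    [frame_chart] is open on orthonormal frames. *)
Lemma adapted_ball_section ac ve Qs r : adapted_ball ac ve Qs r ->
  let U := fc ac @` (ball ve r `&` chart_frames g (sval ac)) in
  exists2 om : SO_bundle g -> 'rV[R]_n * 'M[R]_n, {within U, continuous om} &
    forall b, U b -> [/\ ball ve r (om b), chart_frames g (sval ac) (om b) & fc ac (om b) = b].
Proof.
move=> ab U.
have [om omE] : {om : SO_bundle g -> 'rV[R]_n * 'M[R]_n & forall b, U b ->
    [/\ ball ve r (om b), chart_frames g (sval ac) (om b) & fc ac (om b) = b]}.
  apply: (@choice _ _ (fun b w => U b ->
    [/\ ball ve r w, chart_frames g (sval ac) w & fc ac w = b])) => b.
  have [[w [bw fw] wb]|nU] := pselect (U b); first by exists w.
  by exists (0, 0).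
exists om => //; apply/within_continuousP => b V Ub nV.
have [bb fb ob] := omE b Ub.
have := frame_chart_open fb nV; rewrite ob => nb.
have nb' : nbhs b (fc ac @` ((V `&` ball ve r) `&` chart_frames g (sval ac))).
  rewrite -ob; apply: frame_chart_open fb _; apply: filterI => //.
  by apply: open_nbhs_nbhs; split=> //; apply: ball_open; exact: ab_radius ab.
apply: filterS nb' => _ [w [[Vw bw] fw] <-] Uw.
have [bo fo oE] := omE _ Uw.
by rewrite (ab_inj ab bo bw fo fw oE).
Qed.

(** On the cut ball [frame_chart] takes values in SO(M \ S) and lifts to [E'] by [cut_ball_lift].
    Composing the lift with [om] gives the section. *)
Lemma regular_cover_locally_trivial (E' : twofold_covering (SO_bundle (regular_metric g)))
    (b : SO_bundle g) : exists2 U, nbhs b U &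
  exists s : SO_bundle (regular_metric g) -> Defs.total E', is_lift (so_incl @^-1` U) id s.
Proof.
have [ac [ve [Qs [r [ab <- _]]]]] := adapted_ball_exists (filterT : nbhs b setT).
have [r0 cQs pos _ reg _] := ab.
exists (fc ac @` (ball ve r `&` chart_frames g (sval ac))); first exact: (adapted_ball_nbhs ab).
have [om com omE] := adapted_ball_section ab.
set U := _ @` _ in com omE *.
have iB : 'rV[R]_n * 'M[R]_n -> inhabited (SO_bundle (regular_metric g)).
  by move=> _; exact: dense_inhabited frames_locally_connected b.
have cfc : {within cut_ball Qs ve r, continuous (fc ac)}.
  apply: continuous_subspaceW (@frame_chart_continuous _ _ _ _ g ac).
  by move=> w [/pos].
have [|f cf fE] := open_embedding_factor (@SO_incl_inj _ _ _ _ g)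
    (@SO_incl_open _ _ _ _ g) iB cfc.
  by move=> w [bw wQ]; exact/reg.
have [h [ch ph]] := cut_ball_lift E' r0 (codims_geS cQs) cf.
have omc x : (so_incl @^-1` U) x -> cut_ball Qs ve r (om (so_incl x)).
  move=> Ux; have [bo _ oE] := omE _ Ux; split=> //.
  by apply/reg; rewrite oE; exists x.
exists (h \o (om \o so_incl)); split.
  apply: (within_comp (D := cut_ball Qs ve r)) ch omc.
  apply: (within_comp (D := U)) com _ => //.
  by apply: continuous_within; exact: SO_incl_continuous.
move=> x Ux; rewrite /= ph; last exact: omc.
apply: (@SO_incl_inj _ _ _ _ g); rewrite fE; last exact: omc.
by have [] := omE _ Ux.
Qed.

(** Sections are pushed to [E] by [u] and pulled back to [E'] by [restriction_lift]. *)
Lemma restriction_fiber (E : twofold_covering (SO_bundle g))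
    (E' : twofold_covering (SO_bundle (regular_metric g))) x :
    is_restriction so_incl E E' ->
  trivial_over (@cov _ E') (SO_fiber x) <-> trivial_over (@cov _ E) (SO_fiber (regular_val x)).
Proof.
move=> [u [cu pu eu]]; split=> /trivial_overP[s [cs ps]]; apply/trivial_overP.
- have iB : SO_bundle g -> inhabited (SO_bundle (regular_metric g)).
    by move=> b; exact: dense_inhabited frames_locally_connected b.
  have [|j cj jE] := open_embedding_factor (@SO_incl_inj _ _ _ _ g)
      (@SO_incl_open _ _ _ _ g) iB (@within_id _ (SO_fiber (regular_val x))).
    by move=> b bx; apply/range_SO_incl; rewrite /= bx; exact: (set_valP x).
  have jx b : SO_fiber (regular_val x) b -> SO_fiber x (j b).
    by move=> bx; apply: val_inj; rewrite -[LHS]SO_proj_incl jE.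
  exists (u \o (s \o j)); split.
    exact: within_compl (within_comp cj cs jx) cu.
  by move=> b bx /=; rewrite pu ps ?jE//; exact: jx.
- have ix b : SO_fiber x b -> SO_fiber (regular_val x) (so_incl b).
    by move=> bx; rewrite /SO_fiber /= SO_proj_incl bx.
  have ci : {within SO_fiber x, continuous so_incl}.
    by apply: continuous_within; exact: SO_incl_continuous.
  have lsi : is_lift (SO_fiber x) (so_incl \o id) (s \o so_incl).
    by split; [exact: within_comp ci cs ix|move=> b /ix/ps].
  have [s' [cs' ps'] _] := restriction_lift cu pu eu (@within_id _ _) lsi.
  by exists s'.
Qed.

(* The fibre over a singular point is moved to a regular fibre along a segment *)
(* of a chart; a section over the former lifts along this homotopy.            *)
Lemma trivial_over_regular_fiber (E : twofold_covering (SO_bundle g)) x :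
  trivial_over (@cov _ E) (SO_fiber x) ->
  exists x' : regular_part A, trivial_over (@cov _ E) (SO_fiber (regular_val x')).
Proof.
move=> /trivial_overP[s [cs ps]].
have [ac [v [Qs [vx cQs fQs]]]] := adapted_chart x.
have cQ1 := codims_geS (codims_geS (codims_geS cQs)).
have [v1 _ /fQs fv1] := general_position cQ1 openT (I : setT v).
have reg1 := free_point_regular maxA (svalP ac) fv1.
pose x' : regular_part A := SigSub (mem_set reg1).
exists x'; rewrite /regular_val /=; apply/trivial_overP.
pose D := [set m : 'M[R]_n | 0 < \det m].
(* The basis [m] is kept along the segment, and [frame_chart] orthonormalises it for the metric at
   each point. *)
pose H (mt : 'M[R]_n * R) := fc ac (seg v v1 mt.2, mt.1).
have cH : {within D `*` [set t : R | 0 <= t <= 1], continuous H}.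
  apply: (within_comp (D := positive)) (@frame_chart_continuous _ _ _ _ g ac) _.
    apply: continuous_within; apply: pair_continuous; last exact: fst_continuous.
    move=> mt; apply: (@continuous_comp _ _ _ (fun mt : 'M[R]_n * R => ((v, v1), mt.2))
      (fun abt => seg abt.1.1 abt.1.2 abt.2)).
      by apply: pair_continuous => ?; [exact: cvg_cst|exact: snd_continuous].
    exact: seg_continuous.
  by move=> mt [].
have Hx m : SO_fiber x (H (m, 0)).
  by rewrite /SO_fiber /H /= frame_chart_proj /= seg0 vx.
have [|s1 [cs1 ps1]] := homotopy_lifting (C := E) cH (s0 := fun m => s (H (m, 0))).
  split; last by move=> m Dm; exact: ps.
  apply: (within_comp (D := SO_fiber x) (f := fun m => H (m, 0))) cs _ => [|m _]; last exact: Hx.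
  apply: (within_comp (D := D `*` [set t : R | 0 <= t <= 1]) (f := fun m => (m, 0 : R))) cH _.
    apply: continuous_within; apply: pair_continuous.
      by move=> m; exact: cvg_id.
    exact: cst_continuous.
  by move=> m Dm; split=> //=; rewrite lexx ler01.
have Hv1 m : H (m, 1) = fc ac (v1, m) by rewrite /H /= seg1.
set F1 := SO_fiber _.
have [fr frE] : {fr : SO_bundle g -> 'M[R]_n & forall b, F1 b ->
    chart_frames g (sval ac) (v1, fr b) /\ fc ac (v1, fr b) = b}.
  apply: (@choice _ _ (fun b e => F1 b -> chart_frames g (sval ac) (v1, e) /\ fc ac (v1, e) = b)) => b.
  have [bx|nb] := pselect (F1 b); last by exists 0.
  have [e fe eb] := @frame_chart_surj _ _ _ _ g ac v1 b (esym bx).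
  by exists e.
(* The stabiliser of [v1] is trivial, so a base point near [v1] that is equivalent to [v1]
   determines the same frame matrix; this makes [fr] continuous. *)
have [r r0 free1] := free_neighborhood fv1.
have cfr : {within F1, continuous fr}.
  apply/within_continuousP => b V Fb nV; have [fb ob] := frE b Fb.
  have nb : nbhs b (fc ac @` ((ball v1 r `*` V) `&` chart_frames g (sval ac))).
    rewrite -{1}ob; apply: frame_chart_open fb _.
    by exists (ball v1 r, V) => //=; split=> //; exact: nbhsx_ballx.
  apply: filterS nb => _ [[w e] [[/= bw Ve] fwe] <-] Fw.
  have [fo oE] := frE _ Fw.
  have [a ca [wE eE]] := frame_chart_inj fo fwe oE.
  have a1 := free1 _ _ _ (ballxx v1 r0) bw ca wE.
  by rewrite a1 mulmx1 in eE; rewrite -eE.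
have frD b : F1 b -> D (fr b) by move=> /frE[/chart_frames_positive].
exists (s1 \o fr); split; first exact: within_comp cfr cs1 frD.
by move=> b Fb /=; rewrite ps1 ?Hv1; [have [] := frE b Fb|exact: frD].
Qed.

Lemma restriction_spin (E : twofold_covering (SO_bundle g))
    (E' : twofold_covering (SO_bundle (regular_metric g))) :
    is_restriction so_incl E E' ->
  (forall x, ~ trivial_over (@cov _ E) (SO_fiber x)) <->
  (forall x, ~ trivial_over (@cov _ E') (SO_fiber x)).
Proof.
move=> rE; split=> nt x tx.
  by apply: (nt (regular_val x)); exact/(restriction_fiber _ rE).
have [x' tx'] := trivial_over_regular_fiber tx.
by apply: (nt x'); exact/(restriction_fiber _ rE).
Qed.

End RegularFramesComplement.

(** * Isomorphism classes of coverings and of spin structures *)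

Section CoveringIso.
Context {B : topologicalType}.
Implicit Types E : twofold_covering B.

Lemma covering_iso_refl E : covering_iso E E.
Proof. by exists id, id; split=> // x; exact: cvg_id. Qed.

Lemma covering_iso_sym E F : covering_iso E F -> covering_iso F E.
Proof.
by move=> [f [h [cf ch fK hK pf]]]; exists h, f; split=> // e; rewrite -pf hK.
Qed.

Lemma covering_iso_trans E F G :
  covering_iso E F -> covering_iso F G -> covering_iso E G.
Proof.
move=> [f [h [cf ch fK hK pf]]] [f' [h' [cf' ch' fK' hK' pf']]].
exists (f' \o f), (h \o h'); split.
- by move=> x; apply: continuous_comp; [exact: cf|exact: cf'].
- by move=> x; apply: continuous_comp; [exact: ch'|exact: ch].
- by move=> x /=; rewrite fK' fK.
- by move=> x /=; rewrite hK hK'.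
- by move=> x /=; rewrite pf' pf.
Qed.

End CoveringIso.

Section SpinClasses.
Context {R : realType} {n : nat} {M : topologicalType}.
Context {A : oriented_atlas R n M} (g : riemannian_metric A).
Implicit Types E F : spin_structure g.

Lemma spin_class_eq (C D : spin_class g) : sval C = sval D -> C = D.
Proof.
case: C D => [C pC] [D pD] /= CD; case: _ / CD pD => pD.
by congr exist; exact: Prop_irrelevance.
Qed.

Lemma spin_class_ofP (C : spin_class g) : exists E, C = spin_class_of E.
Proof. by case: C => C [E CE]; exists E; apply: spin_class_eq. Qed.

Lemma eq_spin_class_of E F : spin_class_of E = spin_class_of F <-> covering_iso E F.
Proof.
split=> [/(congr1 sval)/= EF|EF].
  have : spin_iso_class F F by exact: covering_iso_refl.
  by rewrite -EF.
apply: spin_class_eq; apply/funext => G; apply/propext; split=> EG.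
  exact: covering_iso_trans (covering_iso_sym EF) EG.
exact: covering_iso_trans EF EG.
Qed.

End SpinClasses.

Theorem theorem1 (R : realType) (n : nat) (M : topologicalType)
    (A : oriented_atlas R n M) (g : riemannian_metric A) :
  hausdorff_space M ->
  maximal_atlas A ->
  singular_codim_ge A 4 ->
  (spin g <-> spin (regular_metric g)) /\
  exists Phi : spin_class g -> spin_class (regular_metric g),
    bijective Phi /\
    forall (E : spin_structure g) (E' : spin_structure (regular_metric g)),
      Phi (spin_class_of E) = spin_class_of E' <-> restricts_to E E'.
Proof.
move=> _ maxA codimA.
have res (E : spin_structure g) : exists E' : spin_structure (regular_metric g),
    restricts_to E E'.
  have [E' rE] := is_restriction_exists (@SO_incl_continuous _ _ _ _ g) E.
  have nt := (restriction_spin maxA codimA rE).1 (@spin_nontrivial _ _ _ _ _ E).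
  by exists (SpinStructure nt).
have ext (E' : spin_structure (regular_metric g)) : exists E : spin_structure g,
    restricts_to E E'.
  have [E rE] := is_restriction_surj (@SO_incl_continuous _ _ _ _ g)
    (@SO_incl_inj _ _ _ _ g) (@SO_incl_open _ _ _ _ g)
    (frames_locally_connected maxA codimA)
    (regular_cover_locally_trivial maxA codimA E').
  have nt := (restriction_spin maxA codimA rE).2 (@spin_nontrivial _ _ _ _ _ E').
  by exists (SpinStructure nt).
have uniqr (E : spin_structure g) (E1 E2 : spin_structure (regular_metric g)) :
    restricts_to E E1 -> restricts_to E E2 -> covering_iso E1 E2.
  exact: is_restriction_iso.
have uniql (E1 E2 : spin_structure g) (E' : spin_structure (regular_metric g)) :
    restricts_to E1 E' -> restricts_to E2 E' -> covering_iso E1 E2.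
  apply: is_restriction_inj.
  - exact: SO_incl_inj.
  - exact: SO_incl_open.
  - exact: frames_locally_connected.
split.
  split=> -[E]; first by have [E' _] := res E; constructor.
  by have [E' _] := ext E; constructor.
(* The value on each class is chosen through some pair of representatives; [PhiP] shows that any
   other pair gives the same relation. *)
have [Phi PhiE] : {Phi : spin_class g -> spin_class (regular_metric g) &
    forall C, exists E E', [/\ C = spin_class_of E, Phi C = spin_class_of E' & restricts_to E E']}.
  apply: (@choice _ _ (fun C D => exists E E',
    [/\ C = spin_class_of E, D = spin_class_of E' & restricts_to E E'])) => C.
  have [E ->] := spin_class_ofP C; have [E' rE] := res E.
  by exists (spin_class_of E'), E, E'.
have PhiP (E : spin_structure g) (E' : spin_structure (regular_metric g)) :
    Phi (spin_class_of E) = spin_class_of E' <-> restricts_to E E'.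
  have [F [F' [/eq_spin_class_of EF -> rF]]] := PhiE (spin_class_of E).
  have rE : restricts_to E F' := is_restriction_isol (covering_iso_sym EF) rF.
  split=> [/eq_spin_class_of F'E'|rE']; first exact: is_restriction_isor F'E' rE.
  by apply/eq_spin_class_of; exact: uniqr rE rE'.
exists Phi; split=> //.
(* Extension gives a right inverse, and it is also a left inverse because two extensions of the same
   covering are isomorphic. *)
have [Psi PsiE] : {Psi : spin_class (regular_metric g) -> spin_class g &
    forall D, Phi (Psi D) = D}.
  apply: (@choice _ _ (fun D C => Phi C = D)) => D.
  have [E' ->] := spin_class_ofP D; have [E rE] := ext E'.
  by exists (spin_class_of E); apply/PhiP.
exists Psi => // C.
have [E CE] := spin_class_ofP C; have [F PF] := spin_class_ofP (Psi (Phi C)).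
have [E' rE] := res E.
have rF : restricts_to F E' by apply/PhiP; rewrite -PF PsiE CE; apply/PhiP.
by rewrite PF CE; apply/eq_spin_class_of; exact: uniql rF rE.
Qed.
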